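(* Suppose that $\lim_{\varepsilon\to0}\frac{(d^\varepsilon)^2}{\alpha^\varepsilon}=0$, $\lim_{\varepsilon\to 0}q^\varepsilon=q$ with $q=0$, and $\lim_{\varepsilon\to 0}r^\varepsilon=r\in[0,\infty)$. Let $\{\lambda_k^\varepsilon\}_{k\in\mathbb{N}}$ be the sequence of eigenvalues of $\mathcal{A}^\varepsilon$ written in ascending order and repeated according to multiplicity. Then for each $k\in\mathbb{N}$, $\lambda_k^\varepsilon\to 0$ as $\varepsilon\to 0$.
   Context: Let $n\ge 2$, let $\Omega\subset\mathbb{R}^n$ be a bounded Lipschitz domain with $0\in\Omega$, and let $\Gamma=\{x\in\Omega:\ x_n=0\}$. Let $\varepsilon>0$ be a small parameter, $R\in(0,1/2)$ a constant, $R^\varepsilon=R\varepsilon$, and $0<d^\varepsilon<R^\varepsilon$ with $d^\varepsilon=o(\varepsilon)$ as $\varepsilon\to0$. For $i=(i_1,\dots,i_{n-1})\in\mathbb{Z}^{n-1}$ let $x^{i,\varepsilon}=(\varepsilon i_1,\dots,\varepsilon i_{n-1},0)$ and $$D_i^\varepsilon=\{x\in\mathbb{R}^n:\ R^\varepsilon-d^\varepsilon<|x-x^{i,\varepsilon}|<R^\varepsilon\},\qquad B_i^\varepsilon=\{x\in\mathbb{R}^n:\ |x-x^{i,\varepsilon}|<R^\varepsilon-d^\varepsilon\}.$$ Let $\mathcal{I}^\varepsilon$ be the set of $i\in\mathbb{Z}^{n-1}$ with $x^{i,\varepsilon}\in\Gamma$ and $\mathrm{dist}(x^{i,\varepsilon},\partial\Omega)\ge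 \varepsilon\sqrt n/2$. Let $\alpha^\varepsilon,\beta^\varepsilon>0$ be constants. Put $a^\varepsilon=\alpha^\varepsilon$ on $\bigcup_{i\in\mathcal{I}^\varepsilon}D_i^\varepsilon$ and $a^\varepsilon=1$ on the rest of $\Omega$; $b^\varepsilon=\beta^\varepsilon$ on $\bigcup_{i\in\mathcal{I}^\varepsilon}B_i^\varepsilon$ and $b^\varepsilon=1$ on the rest of $\Omega$. Put $$q^\varepsilon=\frac{\alpha^\varepsilon n}{R\,d^\varepsilon\varepsilon\beta^\varepsilon},\qquad r^\varepsilon=R^n\varkappa_n\,\varepsilon\beta^\varepsilon,$$ where $\varkappa_n$ is the volume of the unit ball in $\mathbb{R}^n$. $\mathcal{H}^\varepsilon$ is $L^2(\Omega)$ with scalar product $(u,v)_{\mathcal{H}^\varepsilon}=\int_\Omega u\overline{v}\,b^\varepsilon\,dx$. $\mathcal{A}^\varepsilon$ (formally $-\frac1{b^\varepsilon}\mathrm{div}(a^\varepsilon\nabla)$ with Dirichlet conditions on $\partial\Omega$) is the self-adjoint operator in $\mathcal{H}^\varepsilon$ associated with the form $\eta^\varepsilon[u,v]=\int_\Omega a^\varepsilon\nabla u\cdot\nabla\overline v\,dx$, $\mathrm{dom}(\eta^\varepsilon)=H^1_0(\Omega)$. Its spectrum is purely discrete. *)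

(* Defs.v *)
From HB Require Import structures.
From mathcomp Require Import all_boot all_order all_algebra.
From mathcomp Require Import all_classical all_reals all_analysis.
From mathcomp Require Import complex.

Set Implicit Arguments.
Unset Strict Implicit.
Unset Printing Implicit Defensive.

Import Order.TTheory GRing.Theory Num.Theory.
Import numFieldNormedType.Exports.

Local Open Scope classical_set_scope.
Local Open Scope ring_scope.
Local Open Scope complex_scope.

Definition measure_row_display : measure_display.
Proof. exact: default_measure_display. Qed.

(* The sigma-algebra generated by the coordinates, i.e. the Borel sigma-algebra
   of R^n. *)
Section measurable_row.
Context {R : realType} {n : nat}.

Definition row_coord (i : 'I_n) (x : 'rV[R]_n) : R := x 0 i.

Let row_set0 : g_sigma_preimage row_coord set0.
Proof. exact: sigma_algebra0. Qed.

Let row_setC A :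
  g_sigma_preimage row_coord A -> g_sigma_preimage row_coord (~` A).
Proof. exact: sigma_algebraC. Qed.

Let row_bigcup (F : (set 'rV[R]_n)^nat) :
  (forall i, g_sigma_preimage row_coord (F i)) ->
  g_sigma_preimage row_coord (\bigcup_i (F i)).
Proof. exact: sigma_algebra_bigcup. Qed.

HB.instance Definition _ :=
  @isMeasurable.Build measure_row_display 'rV[R]_n
    (g_sigma_preimage row_coord) row_set0 row_setC row_bigcup.

Lemma measurable_row_coord (i : 'I_n) :
  measurable_fun [set: 'rV[R]_n] (row_coord i).
Proof.
move=> _ Y mY; rewrite setTI; apply: sub_sigma_algebra => /=.
rewrite -bigcup_seq/=; exists i => /=; first by rewrite mem_index_enum.
by exists Y => //; rewrite setTI.
Qed.

Lemma measurable_fun_row d (T : measurableType d) (f : T -> 'rV[R]_n) :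
  (forall i, measurable_fun [set: T] (fun t => f t 0 i)) ->
  measurable_fun [set: T] f.
Proof.
move=> mf.
set G := \big[setU/set0]_(i < n) preimage_set_system setT (row_coord i) measurable.
have mE : @measurable _ 'rV[R]_n = <<s G >> by [].
apply: (measurability _ mE) => _ [A + <-]; rewrite /G -bigcup_seq => -[i _ [B mB <-]].
by rewrite setTI; have := mf i measurableT B mB; rewrite !setTI.
Qed.

End measurable_row.

(* Lebesgue measure on R^(n+1) is the image of the product of the Lebesgue
   measures of R and R^n. *)
Section row_lebesgue_measure.
Context {R : realType}.

Definition row_cons n (p : measurableTypeR R * 'rV[R]_n) : 'rV[R]_n.+1 :=
  \row_j (if unlift ord0 j is Some k then p.2 0 k else p.1).

Definition row_uncons n (x : 'rV[R]_n.+1) : measurableTypeR R * 'rV[R]_n :=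
  (x 0 ord0, \row_(j < n) x 0 (lift ord0 j)).

Lemma row_consK n : cancel (@row_cons n) (@row_uncons n).
Proof.
move=> [a y]; rewrite /row_uncons mxE unlift_none; congr pair.
by apply/rowP => j; rewrite !mxE liftK.
Qed.

Lemma measurable_row_cons n : measurable_fun setT (@row_cons n).
Proof.
apply: measurable_fun_row => i; have [j ->|->] := unliftP ord0 i.
  rewrite (_ : (fun t => _) = row_coord j \o snd).
    by apply: measurableT_comp; [exact: measurable_row_coord|exact: measurable_snd].
  by apply/funext => p; rewrite mxE liftK.
rewrite (_ : (fun t => _) = fst); first exact: measurable_fst.
by apply/funext => p; rewrite mxE unlift_none.
Qed.

Lemma measurable_row_uncons n : measurable_fun setT (@row_uncons n).
Proof.
apply: measurable_fun_pair; first exact: (measurable_row_coord ord0).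
apply: measurable_fun_row => i.
rewrite (_ : (fun t => _) = row_coord (lift ord0 i)).
  exact: measurable_row_coord.
by apply/funext => x; rewrite mxE.
Qed.

Section step.
Variables (n : nat) (mu : {sigma_finite_measure set 'rV[R]_n -> \bar R}).

Definition row_lebesgue_step : set 'rV[R]_n.+1 -> \bar R :=
  pushforward (lebesgue_measure \x mu)%E (@row_cons n).

Let step0 : row_lebesgue_step set0 = 0%E.
Proof. by rewrite /row_lebesgue_step /pushforward preimage_set0 measure0. Qed.

Let step_ge0 A : (0 <= row_lebesgue_step A)%E.
Proof. by rewrite /row_lebesgue_step /pushforward measure_ge0. Qed.

Let step_sigma_additive : semi_sigma_additive row_lebesgue_step.
Proof.
exact: (@measure_semi_sigma_additive _ _ _
  (measure_function_pushforward__canonical__measure_function_Measure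
     (lebesgue_measure \x mu)%E (@measurable_row_cons n))).
Qed.

HB.instance Definition _ := isMeasure.Build _ _ _ row_lebesgue_step
  step0 step_ge0 step_sigma_additive.

Let row_lebesgue_step_sigma_finite : sigma_finite setT row_lebesgue_step.
Proof.
have /sigma_finiteP[F [TF ndF Foo]] := sigma_finiteT (@lebesgue_measure R).
have /sigma_finiteP[G [TG ndG Goo]] := sigma_finiteT mu.
have stepE k : row_lebesgue_step (@row_uncons n @^-1` (F k `*` G k)) =
    ((lebesgue_measure \x mu) (F k `*` G k))%E.
  rewrite /row_lebesgue_step /pushforward -comp_preimage.
  by rewrite (_ : _ \o _ = id) ?preimage_id//; apply/funext => p; exact: row_consK.
exists (fun k => @row_uncons n @^-1` (F k `*` G k)).
  apply/esym; rewrite -subTset => x _.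
  have : setT (row_uncons x).1 by []; rewrite TF => -[i _ Fi].
  have : setT (row_uncons x).2 by []; rewrite TG => -[j _ Gj].
  exists (maxn i j) => //; split.
    by move: Fi; exact/subsetPset/ndF/leq_maxl.
  by move: Gj; exact/subsetPset/ndG/leq_maxr.
move=> k; have [? ?] := Foo k; have [? ?] := Goo k; split.
  by rewrite -[X in measurable X]setTI; apply: measurable_row_uncons => //;
    exact: measurableX.
by rewrite stepE product_measure1E// lte_mul_pinfty// ge0_fin_numE.
Qed.

HB.instance Definition _ := Measure_isSigmaFinite.Build _ _ _
  row_lebesgue_step row_lebesgue_step_sigma_finite.

End step.

Fixpoint row_lebesgue_measure n : {sigma_finite_measure set 'rV[R]_n -> \bar R} :=
  if n is k.+1 then row_lebesgue_step (row_lebesgue_measure k)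
  else (\d_(0 : 'rV[R]_0)).

End row_lebesgue_measure.

Section euclidean_space.
Context {R : realType}.

(* The library norm of 'rV[R]_n is the max norm; it induces the same topology
   and the same bounded sets. *)
Definition enorm n (x : 'rV[R]_n) : R := Num.sqrt (\sum_j x 0 j ^+ 2).

Definition edist n (x : 'rV[R]_n) (A : set 'rV[R]_n) : R :=
  inf [set enorm (x - y) | y in A].

Definition frontier n (A : set 'rV[R]_n) : set 'rV[R]_n :=
  closure A `\` interior A.

Definition unit_ball_volume n : R :=
  fine (row_lebesgue_measure n [set x : 'rV[R]_n | enorm x < 1]).

(* Near each boundary point, and in suitable Cartesian coordinates
   y = x *m O with O orthogonal, the set is the strict epigraph
   gamma (y_1, ..., y_(n-1)) < y_n of a Lipschitz function. *)
Definition lipschitz_boundary m (D : set 'rV[R]_m.+1) : Prop :=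
  forall p, frontier D p ->
  exists (O : 'M[R]_m.+1) (rad L : R) (gamma : 'rV[R]_m -> R),
    [/\ O *m O^T = 1%:M, 0 < rad,
        forall s t, `|gamma s - gamma t| <= L * enorm (s - t) &
        forall x, enorm (x - p) < rad ->
          D x <-> gamma (col' ord_max (x *m O)) < (x *m O) 0 ord_max].

Definition bounded_lipschitz_domain m (D : set 'rV[R]_m.+1) : Prop :=
  [/\ open D, connected D, bounded_set D & lipschitz_boundary D].

End euclidean_space.

Section sobolev.
Context {R : realType} {n : nat}.
Local Notation E := 'rV[R]_n.
Local Notation mu := (row_lebesgue_measure n).
Implicit Types (D : set E) (u v f phi : E -> R[i]) (g h : 'I_n -> E -> R[i]).

Definition abs2 (z : R[i]) : R := complex.Re z ^+ 2 + complex.Im z ^+ 2.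

Definition cintegral D f : R[i] :=
  (\int[mu]_(x in D) complex.Re (f x))%R +i* (\int[mu]_(x in D) complex.Im (f x))%R.

Definition sqnorm D u : \bar R := (\int[mu]_(x in D) (abs2 (u x))%:E)%E.

Definition L2 D u : Prop :=
  [/\ measurable_fun D (fun x => complex.Re (u x)),
      measurable_fun D (fun x => complex.Im (u x)) & (sqnorm D u < +oo)%E].

Definition ae_eq_on D u v : Prop := {ae mu, forall x, D x -> u x = v x}.

Definition partial (j : 'I_n) (w : E -> R) : E -> R :=
  fun x => 'D_(delta_mx 0 j) w x.

Definition smooth (w : E -> R) : Prop :=
  forall (s : seq 'I_n) (x : E), differentiable (foldr partial w s) x.

Definition test_function D phi : Prop :=
  [/\ smooth (fun x => complex.Re (phi x)), smooth (fun x => complex.Im (phi x)) &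
      exists K : set E, [/\ compact K, K `<=` D & forall x, ~ K x -> phi x = 0]].

Definition cgrad phi (j : 'I_n) : E -> R[i] := fun x =>
  partial j (fun y => complex.Re (phi y)) x +i* partial j (fun y => complex.Im (phi y)) x.

Definition weak_gradient D u g : Prop :=
  forall (j : 'I_n) phi, test_function D phi ->
    cintegral D (fun x => u x * cgrad phi j x) =
    - cintegral D (fun x => g j x * phi x).

(* [H1 D u g] : u is in H^1(D) and g is its gradient. *)
Definition H1 D u g : Prop :=
  [/\ L2 D u, forall j, L2 D (g j) & weak_gradient D u g].

Definition H1_sqnorm D u g : \bar R :=
  (sqnorm D u + \sum_(j < n) sqnorm D (g j))%E.

(* [H10 D u g] : u is in H^1_0(D), the closure of the test functions in
   H^1(D), and g is its gradient. *)
Definition H10 D u g : Prop :=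
  H1 D u g /\
  exists phi : nat -> E -> R[i],
    (forall k, test_function D (phi k)) /\
    H1_sqnorm D (fun x => phi k x - u x)
      (fun j x => cgrad (phi k) j x - g j x) @[k --> \oo] --> 0%E.

End sobolev.

(* The operator -(1/b) div(a grad) with Dirichlet conditions on D.  Elements of
   L^2(D) are represented by functions, identified when equal a.e. on D, and
   operators by their graphs. *)
Section form_operator.
Context {R : realType} {n : nat}.
Local Notation E := 'rV[R]_n.
Variables (D : set E) (a b : E -> R).
Implicit Types (u v f : E -> R[i]) (z : R[i]).

Definition weighted_inner u v : R[i] :=
  cintegral D (fun x => u x * (v x)^* * (b x)%:C).

Definition weighted_sqnorm u : R := complex.Re (weighted_inner u u).

Definition form (g h : 'I_n -> E -> R[i]) : R[i] :=
  cintegral D (fun x => (a x)%:C * \sum_(j < n) g j x * (h j x)^*).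

(* [operator u f] : u is in the domain of the operator associated with the
   form, and f is its image. *)
Definition operator u f : Prop :=
  L2 D f /\
  exists g, H10 D u g /\
    forall v h, H10 D v h -> form g h = weighted_inner f v.

Definition eigenspace z : set (E -> R[i]) :=
  [set u | operator u (fun x => z * u x)].

Definition has_dimension (V : set (E -> R[i])) (k : nat) : Prop :=
  exists w : 'I_k -> E -> R[i],
    [/\ forall i, V (w i),
        forall c : 'I_k -> R[i],
          ae_eq_on D (fun x => \sum_(i < k) c i * w i x) (fun=> 0) ->
          forall i, c i = 0 &
        forall u, V u -> exists c : 'I_k -> R[i],
          ae_eq_on D u (fun x => \sum_(i < k) c i * w i x)].

Definition resolvent_set : set R[i] :=
  [set z | (forall u, eigenspace z u -> ae_eq_on D u (fun=> 0)) /\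
    exists C : R, forall f, L2 D f ->
      exists2 u, operator u (fun x => z * u x + f x) &
        weighted_sqnorm u <= C * weighted_sqnorm f].

Definition spectrum : set R[i] := ~` resolvent_set.

(* The spectrum consists of isolated eigenvalues of finite multiplicity. *)
Definition purely_discrete_spectrum : Prop :=
  forall z, spectrum z ->
    (exists2 delta : R, 0 < delta &
       forall z', spectrum z' -> abs2 (z' - z) < delta ^+ 2 -> z' = z) /\
    (exists2 k, (0 < k)%N & has_dimension (eigenspace z) k).

(* lam lists the eigenvalues in ascending order, each one being repeated
   according to its multiplicity. *)
Definition eigenvalue_sequence (lam : nat -> R) : Prop :=
  {homo lam : i j / (i <= j)%N >-> i <= j} /\
  forall z : R[i], exists2 k,
    has_dimension (eigenspace z) k & ([set i | (lam i)%:C = z] #= `I_k)%card.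

End form_operator.

Section microstructure.
Context {R : realType} {m : nat}.
Local Notation E := 'rV[R]_m.+1.
(* rho is the constant written R in R^eps = R eps. *)
Variables (Omega : set E) (rho : R) (d : R -> R).
Implicit Types (e : R) (i : 'I_m -> int).

Definition hyperplane_slice : set E := [set x | Omega x /\ x 0 ord_max = 0].

Definition center e i : E :=
  \row_j (if unlift ord_max j is Some k then e * (i k)%:~R else 0).

Definition shell e i : set E :=
  [set x | rho * e - d e < enorm (x - center e i) < rho * e].

Definition core e i : set E :=
  [set x | enorm (x - center e i) < rho * e - d e].

Definition admissible e : set ('I_m -> int) :=
  [set i | hyperplane_slice (center e i) /\
     e * Num.sqrt m.+1%:R / 2 <= edist (center e i) (frontier Omega)].

Definition acoef (alpha : R -> R) e (x : E) : R :=
  if x \in \bigcup_(i in admissible e) shell e i then alpha e else 1.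

Definition bcoef (beta : R -> R) e (x : E) : R :=
  if x \in \bigcup_(i in admissible e) core e i then beta e else 1.

End microstructure.

Section scalings.
Context {R : realType}.

Definition qcoef (n : nat) (rho : R) (d alpha beta : R -> R) (e : R) : R :=
  alpha e * n%:R / (rho * d e * e * beta e).

Definition rcoef (n : nat) (rho : R) (beta : R -> R) (e : R) : R :=
  rho ^+ n * unit_ball_volume n * e * beta e.

End scalings.

(* Main.v *)
(** Let [u_0, ..., u_k] be smooth radial functions, one for each of [k + 1] cells
    near the origin, constant on the core, supported in the ball, with gradient of
    size [1 / d] on the shell.  Their supports are disjoint, so on their span the
    Rayleigh quotient is at most
      [C alpha d^-2 |shell| / (beta |core|) <= C' q],
    which tends to [0]; by the min-max principle so does the k-th eigenvalue.

    The min-max principle is derived from the discreteness of the spectrum.  It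
    makes [T = (A + 1)^-1] available.  If the k-th eigenvalue exceeded the bound
    [c], a nonzero element of the span would be orthogonal to all eigenfunctions
    with eigenvalue at most [c].  Let [s >= (1 + c)^-1] be the supremum of
    [<Tu, u> / |u|^2] on their orthogonal complement.  It is isolated in the
    spectrum, so [|(s - T)u|^2 >= dl <(s - T)u, u>] for some [dl > 0], and the
    iterates of [1 - (s - T)] started at an almost maximizing [u] converge to an
    eigenvector of [T], a contradiction. *)

Require Import Defs.
From mathcomp Require Import all_boot all_order all_algebra.
From mathcomp Require Import all_classical all_reals all_analysis.
From mathcomp Require Import complex.
From mathcomp Require Import measurable_realfun.
From mathcomp Require Import ring lra.

Set Implicit Arguments.
Unset Strict Implicit.
Unset Printing Implicit Defensive.

Import Order.TTheory GRing.Theory Num.Theory.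
Import numFieldNormedType.Exports.

Local Open Scope classical_set_scope.
Local Open Scope ring_scope.


(** * Eigenvectors of symmetric operators *)

(** Neither functional calculus nor a compact embedding enters. Discreteness acts through isolated
    spectral points and bounded solution operators off the spectrum; under t = 1 / (1 + z) the
    latter make T - t bounded below. The inequality with [dl] then rests on a distance principle: if
    T - t is bounded below for all t in an open interval of centre c and radius r, then |(T - c)u|
    >= r |u|. It is proved by improving a best constant.

    Functions are identified almost everywhere, so the abstract part works with a semidefinite real
    form, up to null vectors; the complex product is recovered by multiplying by i. The iteration
    has geometric rates, so completeness of L^2 is stated for such sequences.

    The bumps are built from exp(-1/t) by sums, products and composition, which keeps all iterated
    partial derivatives in one explicit class. Once d <= R eps / 2, the core keeps at least 2^-n of
    the volume of its ball, and C' = 64 2^n / p^2 with [p] the height of the bumps. *)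

Section semidefinite_form.
Context {R : realType} {V : Type}.
(* [comb a u v] stands for [a u + v].  No vector space axiom is assumed: vectors
   are only compared through the form, hence up to null vectors. *)
Variables (comb : R -> V -> V -> V) (K : V -> Prop).

Definition psd_form (b : V -> V -> R) : Prop :=
  [/\ forall u v, K u -> K v -> b u v = b v u,
      forall a u v w, K u -> K v -> K w ->
        b (comb a u v) w = a * b u w + b v w &
      forall u, K u -> 0 <= b u u].

Hypothesis combK : forall a u v, K u -> K v -> K (comb a u v).

Lemma psd_sqr b a u v : psd_form b -> K u -> K v ->
  b (comb a u v) (comb a u v) = a ^+ 2 * b u u + 2 * a * b u v + b v v.
Proof.
move=> [bC bl b0] Ku Kv; have Kc := combK a Ku Kv.
rewrite bl// [b u _]bC// [b v _]bC// !bl// (bC v u)//; ring.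
Qed.

(** The quadratic polynomial of [psd_sqr] is nonnegative, in particular at its minimizer
    [- b u v / b u u]. If [b u u = 0] it is affine in [a], and a nonzero [b u v] would let it reach
    -1. *)
Lemma psd_cauchy_schwarz b u v : psd_form b -> K u -> K v ->
  b u v ^+ 2 <= b u u * b v v.
Proof.
move=> bp Ku Kv; have [bC bl b0] := bp.
have H a : 0 <= a ^+ 2 * b u u + 2 * a * b u v + b v v.
  by rewrite -psd_sqr//; apply: b0; exact: combK.
have u0 := b0 _ Ku; have v0 := b0 _ Kv.
have [z|nz] := eqVneq (b u u) 0.
  have [->|ne] := eqVneq (b u v) 0; first by rewrite expr0n/= mulr_ge0.
  have := H (- (b v v + 1) / (2 * b u v)).
  rewrite z mulr0 add0r.
  have -> : 2 * (- (b v v + 1) / (2 * b u v)) * b u v = - (b v v + 1) by field.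
  lra.
have pu : 0 < b u u by rewrite lt_neqAle eq_sym nz.
have := H (- b u v / b u u).
have -> : (- b u v / b u u) ^+ 2 * b u u + 2 * (- b u v / b u u) * b u v + b v v
  = (b u u * b v v - b u v ^+ 2) / b u u by field.
by rewrite pmulr_lge0 ?invr_gt0// subr_ge0.
Qed.

(** This is B^2 <= M B for 0 <= B <= M. Cauchy-Schwarz for the form <B u, v>, taken at [u] and
    [B u], gives |Bu|^4 <= <Bu, u> <BBu, Bu> <= <Bu, u> M |Bu|^2. *)
Lemma psd_operator_bound ip B M : psd_form ip -> 0 <= M ->
  (forall u, K u -> K (B u)) ->
  (forall u v, K u -> K v -> ip (B u) v = ip u (B v)) ->
  (forall u, K u -> 0 <= ip (B u) u <= M * ip u u) ->
  forall u, K u -> ip (B u) (B u) <= M * ip (B u) u.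
Proof.
move=> ipp M0 KB Bs Bb u Ku; have [iC il i0] := ipp.
have bp : psd_form (fun u v => ip (B u) v).
  split=> [x y Kx Ky|a x y w Kx Ky Kw|x Kx].
  - by rewrite Bs// iC//; exact: KB.
  - by rewrite Bs ?il ?Bs//; [exact: KB|exact: combK].
  - by have /andP[] := Bb _ Kx.
have KBu := KB _ Ku.
have := psd_cauchy_schwarz bp Ku KBu => /= h.
have /andP[p1 p2] := Bb _ Ku; have /andP[q1 q2] := Bb _ KBu.
have [z|nz] := eqVneq (ip (B u) (B u)) 0; first by rewrite z mulr_ge0.
have pB : 0 < ip (B u) (B u) by rewrite lt_neqAle eq_sym nz i0.
rewrite -(ler_pM2r pB) -expr2 (le_trans h)//.
by rewrite (le_trans (ler_wpM2l p1 q2))// mulrCA mulrA.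
Qed.

End semidefinite_form.

(** * The top of the spectrum of a symmetric operator between 0 and 1 *)

Section isolated_top.
Context {R : realType} {V : Type}.
Variables (comb : R -> V -> V -> V) (K : V -> Prop) (ip : V -> V -> R).
Variable T : V -> V.
Local Notation N u := (ip u u).
Local Notation shift c u := (comb (- c) u (T u)).

Hypothesis combK : forall a u v, K u -> K v -> K (comb a u v).
Hypothesis ipp : psd_form comb K ip.
Hypothesis TK : forall u, K u -> K (T u).
Hypothesis Ts : forall u v, K u -> K v -> ip (T u) v = ip u (T v).
Hypothesis Tb : forall u, K u -> 0 <= ip (T u) u <= N u.

Let ipC u v : K u -> K v -> ip u v = ip v u. Proof. by case: ipp => + _ _; exact. Qed.
Let ipl a u v w : K u -> K v -> K w -> ip (comb a u v) w = a * ip u w + ip v w.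
Proof. by case: ipp => _ + _; exact. Qed.
Let ipr a u v w : K u -> K v -> K w -> ip w (comb a u v) = a * ip w u + ip w v.
Proof.
by move=> Ku Kv Kw; rewrite ipC ?ipl// 1?(ipC Ku)// 1?(ipC Kv)//; exact: combK.
Qed.
Let N0 u : K u -> 0 <= N u. Proof. by case: ipp => _ _; exact. Qed.
Let ipTl a u v w : K u -> K v -> K w ->
  ip (T (comb a u v)) w = a * ip (T u) w + ip (T v) w.
Proof.
move=> Ku Kv Kw; rewrite Ts ?ipl ?Ts//; [exact: TK|exact: combK].
Qed.
Let ipTr a u v w : K u -> K v -> K w ->
  ip w (T (comb a u v)) = a * ip w (T u) + ip w (T v).
Proof.
by move=> Ku Kv Kw; rewrite -!Ts// ?ipr//; [exact: TK|exact: combK].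
Qed.

(** [shift s u] is (T - s)u, so [s] is not an approximate eigenvalue of [T] on [K]; for a symmetric
    operator this stands in for invertibility of T - s. *)
Definition bounded_below s : Prop :=
  exists2 C : R, 0 < C & forall u, K u -> N u <= C * ip (shift s u) (shift s u).

Let shiftK s u : K u -> K (shift s u).
Proof. by move=> Ku; apply: combK => //; exact: TK. Qed.

Let shift2 s t u w : K u -> K w ->
  ip (shift s (shift t u)) w =
  ip (T (T u)) w - (s + t) * ip (T u) w + s * t * ip u w.
Proof.
move=> Ku Kw; have K1 := TK Ku; have K2 := TK K1; have K3 := shiftK t Ku.
have K4 := TK K3.
rewrite ipl// ipTl// ipl//; ring.
Qed.

Let NTle u : K u -> ip (T u) (T u) <= ip (T u) u.
Proof.
move=> Ku; rewrite -[leRHS]mul1r.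
by apply: (psd_operator_bound combK ipp) => // v Kv; rewrite mul1r; exact: Tb.
Qed.

Let Nsh s u : K u -> ip (shift s u) (shift s u) =
  ip (T u) (T u) - 2 * s * ip (T u) u + s ^+ 2 * N u.
Proof.
move=> Ku; have K1 := TK Ku; have K3 := shiftK s Ku.
rewrite ipl// !ipr// (ipC Ku K1); ring.
Qed.

Let shift_le s u : s <= 1 -> (forall u, K u -> ip (T u) u <= s * N u) -> K u ->
  ip (shift s u) (shift s u) <= s * N u - ip (T u) u.
Proof.
move=> s1 top Ku; rewrite Nsh//.
(* The operator inside is s - T: [comb] adds its last vector with coefficient 1, so s u is written
   (s - 1) u + u. It lies between 0 and 1, hence (s - T)^2 <= s - T. *)
have := psd_operator_bound (B := fun u => comb (-1) (T u) (comb (s - 1) u u)) (M := 1) combK ipp.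
move=> /(_ ler01) H.
have KB x : K x -> K (comb (-1) (T x) (comb (s - 1) x x)).
  by move=> Kx; apply: combK; [exact: TK|exact: combK].
have Bip x y : K x -> K y -> ip (comb (-1) (T x) (comb (s - 1) x x)) y = s * ip x y - ip (T x) y.
  move=> Kx Ky; rewrite ipl ?ipl//; [ring|exact: TK|exact: combK].
have -> : ip (T u) (T u) - 2 * s * ip (T u) u + s ^+ 2 * N u =
    ip (comb (-1) (T u) (comb (s - 1) u u)) (comb (-1) (T u) (comb (s - 1) u u)).
  have K1 := TK Ku; have K3 := KB _ Ku.
  rewrite Bip// (ipC Ku K3) (ipC K1 K3) !Bip//.
  rewrite ?(ipC Ku K1) -?(Ts Ku K1) ?(Ts K1 Ku); ring.
apply: (le_trans (H _ _ _ u Ku)) => //.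
- move=> x y Kx Ky; rewrite Bip// (ipC Kx (KB _ Ky)) Bip// (ipC Ky Kx).
  by rewrite Ts// (ipC Kx (TK Ky)).
- move=> x Kx; rewrite Bip// mul1r; apply/andP; split; first by rewrite subr_ge0 top.
  have /andP[p1 p2] := Tb Kx; have := N0 Kx.
  have : 0 <= (1 - s) * N x by rewrite mulr_ge0 ?N0// subr_ge0.
  lra.
- by rewrite Bip// mul1r.
Qed.

(* [(T - c) ^ 2 - g ^ 2] is nonnegative and factors as
   [(T - c - g) (T - c + g)]. *)
Lemma bounded_below_pair c g : 0 <= c -> 0 <= g ->
  (forall u, K u -> g ^+ 2 * N u <= ip (shift c u) (shift c u)) ->
  bounded_below (c + g) -> bounded_below (c - g) ->
  exists2 d, 0 < d &
    forall u, K u -> (g ^+ 2 + d) * N u <= ip (shift c u) (shift c u).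
Proof.
move=> c0 g0 lo [C1 C10 h1] [C2 C20 h2].
pose B u := comb (- g ^+ 2) u (shift c (shift c u)).
have KB u : K u -> K (B u).
  by move=> Ku; apply: combK => //; do 2 apply: shiftK.
have Bip u w : K u -> K w -> ip (B u) w =
    ip (T (T u)) w - 2 * c * ip (T u) w + (c ^+ 2 - g ^+ 2) * ip u w.
  move=> Ku Kw; rewrite /B ipl// ?shift2//; last by do 2 apply: shiftK.
  ring.
have Bs u v : K u -> K v -> ip (B u) v = ip u (B v).
  move=> Ku Kv; have K1 := TK Ku; have K2 := TK Kv; have K3 := TK K2.
  rewrite Bip// [RHS]ipC ?Bip//; last exact: KB.
  by rewrite !(ipC Kv)// ?(ipC _ Ku)// !Ts// ?(ipC K1)//; exact: TK.
have Bu u : K u -> ip (B u) u = ip (shift c u) (shift c u) - g ^+ 2 * N u.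
  move=> Ku; have K1 := TK Ku.
  rewrite Bip// Nsh// Ts//; ring.
have bd : forall u, K u -> ip (B u) (B u) <= (1 + c ^+ 2) * ip (B u) u.
  apply: (psd_operator_bound combK ipp) => //; first by rewrite addr_ge0// sqr_ge0.
  move=> u Ku; rewrite Bu// subr_ge0 lo//= lerBlDr.
  rewrite Nsh//; have := NTle Ku; have /andP[p1 p2] := Tb Ku; have := N0 Ku.
  have := mulr_ge0 c0 p1; have := mulr_ge0 (sqr_ge0 g) (N0 Ku); lra.
(* Both shifts are bounded below, so |u|^2 <= C1 C2 |B u|^2, and B^2 <= (1 + c^2) B turns this into
   a lower bound for <B u, u> = |(T - c)u|^2 - g^2 |u|^2. *)
have key u : K u -> N u <= C1 * C2 * (1 + c ^+ 2) * ip (B u) u.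
  move=> Ku; apply: (le_trans (h1 _ Ku)).
  rewrite -!mulrA ler_pM2l//.
  apply: (le_trans (h2 _ (shiftK _ Ku))); rewrite ler_pM2l//.
  have -> : ip (shift (c - g) (shift (c + g) u)) (shift (c - g) (shift (c + g) u))
     = ip (B u) (B u); last exact: bd.
  have K1 := shiftK (c + g) Ku; have K2 := shiftK (c - g) K1; have K3 := KB _ Ku.
  have e w : K w -> ip (shift (c - g) (shift (c + g) u)) w = ip (B u) w.
    by move=> Kw; rewrite shift2// Bip//; ring.
  by rewrite e// ipC// e.
have c1 : 0 < 1 + c ^+ 2 by rewrite ltr_pwDl// sqr_ge0.
exists (C1 * C2 * (1 + c ^+ 2))^-1; first by rewrite invr_gt0 !mulr_gt0.
move=> u Ku; have := key _ Ku; rewrite -ler_pdivrMl; last by rewrite !mulr_gt0.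
by rewrite Bu//; lra.
Qed.

(** Let g^2 be the infimum of |(T - c)u|^2 / |u|^2. If g < r, then c + g and c - g both lie in the
    interval, and [bounded_below_pair] raises the infimum. The vector [u0] makes the set of
    quotients nonempty. *)
Lemma spectral_gap c r u0 : 0 <= c -> 0 < r -> K u0 -> 0 < N u0 ->
  (forall s, `|s - c| < r -> bounded_below s) ->
  forall u, K u -> r ^+ 2 * N u <= ip (shift c u) (shift c u).
Proof.
move=> c0 r0 Ku0 u00 reg.
pose A := [set ip (shift c u) (shift c u) / N u | u in [set u | K u /\ 0 < N u]].
have A0 : A !=set0 by exists (ip (shift c u0) (shift c u0) / N u0); exists u0.
have Alb : has_lbound A.
  by exists 0 => _ [u [Ku u1] <-]; rewrite divr_ge0// ?N0//; exact: shiftK.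
have Ainf : has_inf A by [].
have i0 : 0 <= inf A.
  apply: lb_le_inf => // _ [u [Ku u1] <-].
  by rewrite divr_ge0// ?N0//; exact: shiftK.
have lo u : K u -> inf A * N u <= ip (shift c u) (shift c u).
  move=> Ku; have [z|nz] := eqVneq (N u) 0.
    by rewrite z mulr0 N0//; exact: shiftK.
  have pu : 0 < N u by rewrite lt_neqAle eq_sym nz N0.
  by rewrite -ler_pdivlMr//; apply: ge_inf => //; exists u.
have [h|h] := leP (r ^+ 2) (inf A).
  by move=> u Ku; apply: le_trans (lo _ Ku); rewrite ler_wpM2r// N0.
exfalso; pose g := Num.sqrt (inf A).
have gE : g ^+ 2 = inf A by rewrite sqr_sqrtr.
have g0 : 0 <= g by rewrite sqrtr_ge0.
have gr : g < r by rewrite -(ltr_pXn2r (_ : (0 < 2)%N)) ?nnegrE ?gE// ltW.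
have [|||d d0 hd] := @bounded_below_pair c g c0 g0.
- by move=> u Ku; rewrite gE lo.
- by apply: reg; rewrite addrAC subrr add0r ger0_norm.
- by apply: reg; rewrite addrAC subrr add0r normrN ger0_norm.
have : inf A + d <= inf A.
  apply: lb_le_inf => // _ [u [Ku u1] <-].
  by rewrite ler_pdivlMr// -gE hd.
by rewrite gerDl leNgt d0.
Qed.

(** Completeness in the form that the iteration delivers: squared steps decaying geometrically, and
    convergence in the seminorm. *)
Hypothesis complete : forall (u : nat -> V) (C q : R),
  0 <= C -> 0 <= q < 1 -> (forall n, K (u n)) ->
  (forall n, ip (comb (-1) (u n) (u n.+1)) (comb (-1) (u n) (u n.+1)) <= C * q ^+ n) ->
  exists2 v, K v &
    forall e, 0 < e -> exists M, forall n, (M <= n)%N ->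
      ip (comb (-1) (u n) v) (comb (-1) (u n) v) < e.

(* The iterates of [1 - (s - T)] converge: the energy [e u] of [s - T] shrinks
   by the factor [1 - dl], and controls the size of the steps. *)
Lemma top_eigenvector_of_gap s dl :
  0 < dl -> dl <= s -> s <= 1 ->
  (forall u, K u -> ip (T u) u <= s * N u) ->
  (forall e, 0 < e -> exists2 u, K u & 0 < N u /\ s * N u - ip (T u) u <= e * N u) ->
  (forall u, K u ->
     dl * (s * N u - ip (T u) u) <= ip (shift s u) (shift s u)) ->
  exists2 u, K u & 0 < N u /\ ip (shift s u) (shift s u) = 0.
Proof.
move=> dl0 dls s1 top near gap.
pose e u := s * N u - ip (T u) u.
have e0 u : K u -> 0 <= e u by move=> Ku; rewrite subr_ge0 top.
have she u : K u -> ip (shift s u) (shift s u) <= e u by exact: shift_le.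
pose Y u := comb (1 - s) u (T u).
have KY u : K u -> K (Y u) by move=> Ku; apply: combK => //; exact: TK.
have eY u : K u -> e (Y u) <= (1 - dl) * e u.
  move=> Ku; have K1 := TK Ku; have K2 := TK K1; have K3 := shiftK s Ku.
  have K4 := KY _ Ku; have K5 := TK K3.
  have h1 := gap _ Ku; have h2 := she _ K3.
  (* The last term is at most |(s - T)u|^2, because 0 <= T and s <= 1. So one copy of -|(s - T)u|^2
     survives, and [gap] bounds it by -dl e(u). *)
  suff E : e (Y u) = e u - 2 * ip (shift s u) (shift s u) + e (shift s u).
    have h3 : e (shift s u) <= ip (shift s u) (shift s u).
      rewrite /e; have /andP[p1 p2] := Tb K3; have := N0 K3.
      have : 0 <= (1 - s) * ip (shift s u) (shift s u) by rewrite mulr_ge0 ?N0// subr_ge0.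
      lra.
    by move: h1; rewrite -/(e u) E; lra.
  rewrite /e /Y !ipTl ?ipl ?ipr//; try exact: combK.
  rewrite (ipC Ku K1) (Ts K1 Ku); ring.
have NY u : K u -> N u - 2 * e u <= N (Y u).
  move=> Ku; have K1 := TK Ku; have K3 := shiftK s Ku.
  have -> : N (Y u) = N u - 2 * e u + ip (shift s u) (shift s u).
    rewrite /Y Nsh// /e ipl ?ipr//; try exact: combK.
    rewrite (ipC Ku K1); ring.
  by rewrite lerDl N0.
(* A step loses at most 2 e(u) of squared norm, and these losses sum to at most 2 e(u0) / dl. The
   choice of dl / 4 preserves half of [N u0], so the limit is not null. *)
have [u0 Ku0 [u00 small]] := near (dl / 4) (divr_gt0 dl0 (ltr0Sn _ _)).
pose u n := iter n Y u0.
have Ku n : K (u n) by elim: n => //= n ih; exact: KY.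
have q0 : 0 <= 1 - dl by rewrite subr_ge0 (le_trans dls).
have q1 : 1 - dl < 1 by lra.
have eu n : e (u n) <= (1 - dl) ^+ n * e u0.
  elim: n => [|n ih]; first by rewrite expr0 mul1r.
  rewrite /= (le_trans (eY _ (Ku n)))// exprS -mulrA ler_wpM2l//.
have Nu n : N u0 - 2 * e u0 / dl * (1 - (1 - dl) ^+ n) <= N (u n).
  elim: n => [|n ih]; first by rewrite expr0 subrr mulr0 subr0.
  apply: le_trans (NY _ (Ku n)); have := eu n.
  have -> : 2 * e u0 / dl * (1 - (1 - dl) ^+ n.+1) =
     2 * e u0 / dl * (1 - (1 - dl) ^+ n) + 2 * ((1 - dl) ^+ n * e u0).
    by rewrite exprS; field; rewrite gt_eqF.
  lra.
have Nu' n : N u0 / 2 <= N (u n).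
  apply: le_trans (Nu n).
  have h : 2 * e u0 / dl <= N u0 / 2.
    rewrite ler_pdivrMr//; move: small; rewrite -/(e u0); lra.
  have h0 : 0 <= 2 * e u0 / dl by rewrite divr_ge0 ?(ltW dl0)// mulr_ge0 ?e0.
  have hq : 0 <= 2 * e u0 / dl * (1 - dl) ^+ n by rewrite mulr_ge0// exprn_ge0.
  lra.
have [|n|v Kv cv] := @complete u (e u0) (1 - dl) (e0 _ Ku0) _ Ku _.
- by rewrite q0 q1.
- have K1 := TK (Ku n); have K4 := KY _ (Ku n).
  have -> : ip (comb (-1) (u n) (u n.+1)) (comb (-1) (u n) (u n.+1)) =
     ip (shift s (u n)) (shift s (u n)).
    rewrite -[u n.+1]/(Y (u n)) Nsh// (psd_sqr combK _ ipp)// /Y.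
    rewrite (psd_sqr combK _ ipp)// ipr// (ipC (Ku n) K1); ring.
  by rewrite (le_trans (she _ _))// mulrC eu.
(* From |2 b - a|^2 >= 0; it compares squared norms without taking roots. *)
have low a b : K a -> K b -> N a <= 2 * N b + 2 * ip (comb (-1) a b) (comb (-1) a b).
  move=> Ka Kb.
  have := N0 (combK 1 (combK (-1) Ka Kb) Kb).
  have Kc := combK (-1) Ka Kb.
  have -> : ip (comb 1 (comb (-1) a b) b) (comb 1 (comb (-1) a b) b)
    = N a + 4 * N b - 4 * ip a b.
    rewrite !(psd_sqr combK _ ipp)// ipl//; ring.
  rewrite (psd_sqr combK _ ipp)//; lra.
exists v => //; split.
- have [M /(_ M (leqnn _)) cM] := cv (N u0 / 8) (divr_gt0 u00 (ltr0Sn _ _)).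
  by have := low _ _ (Ku M) Kv; have := Nu' M; lra.
apply/eqP; rewrite eq_le N0 ?andbT; last exact: shiftK.
apply/ler_addgt0Pl => ep ep0; rewrite addr0.
(* |(s - T)v|^2 is at most twice e(u_n) plus twice |u_n - v|^2, and each of these two is made
   smaller than ep / 4. *)
have ep4 : 0 < ep / 4 by lra.
have [M cM] := cv _ ep4.
have /cvgrPdist_lt /(_ _ ep4) [M' _ gM] :
    (1 - dl) ^+ n * e u0 @[n --> \oo] --> 0.
  rewrite -(mul0r (e u0)); apply: cvgM; last exact: cvg_cst.
  by apply: cvg_expr; rewrite ger0_norm.
pose n := maxn M M'; have {}cM := cM n (leq_maxl _ _).
have {}gM := gM n (leq_maxr _ _); rewrite /= in gM.
rewrite sub0r normrN ger0_norm in gM; last by rewrite mulr_ge0 ?e0// exprn_ge0.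
have K3 := shiftK s Kv; have K4 := shiftK s (Ku n).
have Kd := combK (-1) (Ku n) Kv.
have := low _ _ K3 K4.
have -> : ip (comb (-1) (shift s v) (shift s (u n))) (comb (-1) (shift s v) (shift s (u n))) =
  ip (shift s (comb (-1) (u n) v)) (shift s (comb (-1) (u n) v)).
  have K1 := TK (Ku n); have K2 := TK Kv; have K5 := TK Kd.
  rewrite !(psd_sqr combK _ ipp)// !(ipl _ _ _ _)// !ipr// !ipTl// !ipTr//.
  have E : ip (u n) (T v) = ip v (T (u n)).
    by rewrite -Ts// ipC//; exact: TK.
  rewrite ?(ipC K1 (Ku n)) ?(ipC K1 Kv) ?(ipC K2 Kv)
    ?(ipC K2 (Ku n)) ?(ipC Kv (Ku n)) ?(ipC K2 K1) ?E; ring.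
have := she _ Kd; have := she _ (Ku n); have := eu n.
have : e (comb (-1) (u n) v) <= ip (comb (-1) (u n) v) (comb (-1) (u n) v).
  rewrite /e; have /andP[p1 p2] := Tb Kd; have := N0 Kd.
  have : 0 <= (1 - s) * ip (comb (-1) (u n) v) (comb (-1) (u n) v).
    by rewrite mulr_ge0 ?N0// subr_ge0.
  lra.
move: cM gM; lra.
Qed.

Theorem top_eigenvector tau u0 : 0 < tau -> K u0 -> 0 < N u0 ->
  tau * N u0 <= ip (T u0) u0 ->
  (forall s, tau <= s -> bounded_below s \/
     exists2 dl, 0 < dl & forall t, 0 < `|t - s| < dl -> bounded_below t) ->
  exists2 s, tau <= s &
    exists2 u, K u & 0 < N u /\ ip (shift s u) (shift s u) = 0.
Proof.
move=> tau0 Ku0 u00 ray alt.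
pose A := [set ip (T u) u / N u | u in [set u | K u /\ 0 < N u]].
have Aub : ubound A 1.
  move=> _ [u [Ku u1] <-]; rewrite ler_pdivrMr// mul1r.
  by have /andP[] := Tb Ku.
have As : has_sup A.
  by split; [exists (ip (T u0) u0 / N u0); exists u0|exists 1].
pose s := sup A.
have ts : tau <= s.
  apply: (@le_trans _ _ (ip (T u0) u0 / N u0)); first by rewrite ler_pdivlMr.
  by apply: sup_upper_bound => //; exists u0.
have s1 : s <= 1 by apply: sup_le_ub => //; case: As.
have s0 : 0 < s by exact: lt_le_trans ts.
have top u : K u -> ip (T u) u <= s * N u.
  move=> Ku; have [z|nz] := eqVneq (N u) 0.
    by rewrite z mulr0; have /andP[_] := Tb Ku; rewrite z.
  have pu : 0 < N u by rewrite lt_neqAle eq_sym nz N0.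
  by rewrite -ler_pdivrMr//; apply: sup_upper_bound => //; exists u.
have near e : 0 < e ->
    exists2 u, K u & 0 < N u /\ s * N u - ip (T u) u <= e * N u.
  move=> e0; have [_ [u [Ku u1] <-] h] := sup_adherent e0 As.
  exists u => //; split=> //.
  by move: h; rewrite ltr_pdivlMr// -/s; lra.
exists s => //.
(* The first alternative is impossible: almost maximizers have small e(u), hence small |(s - T)u|^2
   by [shift_le]. *)
have [[C C0 hC]|[dl dl0 hdl]] := alt _ ts.
  have /near[u Ku [u1]] : 0 < (2 * C)^-1 by rewrite invr_gt0 mulr_gt0.
  have := hC _ Ku; rewrite Nsh// => h1 h2; exfalso.
  have h3 := shift_le s1 top Ku; rewrite Nsh// in h3.
  have : C * (s * N u - ip (T u) u) <= N u / 2.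
    rewrite -ler_pdivlMl// (le_trans h2)// le_eqVlt; apply/orP; left.
    by apply/eqP; field; rewrite gt_eqF.
  have := le_trans h1 (ler_wpM2l (ltW C0) h3); lra.
pose r := Num.min dl s / 2.
have r0 : 0 < r by rewrite divr_gt0// lt_min dl0 s0.
have rd : 2 * r <= dl.
  by rewrite /r mulrC divfK ?pnatr_eq0// ge_min lexx.
have rs : 2 * r <= s.
  by rewrite /r mulrC divfK ?pnatr_eq0// ge_min lexx orbT.
have sr0 : 0 <= s - r by lra.
(* The open interval of centre s - r and radius r ends at [s]. Expanding |(T - s + r)u|^2 >= r^2
   |u|^2 cancels r^2 |u|^2 and leaves the gap inequality with dl = 2 r. *)
have gap := @spectral_gap (s - r) r u0 sr0 r0 Ku0 u00.
apply: (@top_eigenvector_of_gap s (2 * r)) => //; first by rewrite mulr_gt0.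
move=> u Ku.
have /gap/(_ _ Ku) : forall t, `|t - (s - r)| < r -> bounded_below t.
  move=> t; rewrite ltr_norml => /andP[t1 t2]; apply: hdl.
  have ts0 : t - s < 0 by lra.
  rewrite ltr0_norm//; lra.
rewrite !Nsh//; lra.
Qed.

End isolated_top.

(** * Completeness of L^2 *)

Section square_integrable.
Context d (T : measurableType d) (R : realType).
Variables (mu : {measure set T -> \bar R}) (D : set T).
Hypothesis mD : measurable D.
Implicit Types f g : T -> R.

Definition sqint f : Prop :=
  measurable_fun D f /\ mu.-integrable D (fun x => (f x ^+ 2)%:E).

Lemma sqintP f : sqint f <->
  measurable_fun D f /\ (\int[mu]_(x in D) (f x ^+ 2)%:E < +oo)%E.
Proof.
split=> -[mf h]; split=> //; first exact: integrable_lty.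
apply/integrableP; split.
  by apply/measurable_EFinP; exact: measurable_funX.
by under eq_integral do rewrite gee0_abs ?lee_fin ?sqr_ge0//.
Qed.

Lemma sqintM f g : sqint f -> sqint g ->
  mu.-integrable D (fun x => (f x * g x)%:E).
Proof.
move=> [mf f2] [mg g2].
apply: (le_integrable mD _ _ (integrableD mD f2 g2)).
  by apply/measurable_EFinP; exact: measurable_funM.
move=> x _ /=; rewrite lee_fin [leRHS]ger0_norm ?addr_ge0 ?sqr_ge0//.
rewrite normrM -(real_normK (num_real (f x))) -(real_normK (num_real (g x))).
have := sqr_ge0 (`|f x| - `|g x|).
have := mulr_ge0 (normr_ge0 (f x)) (normr_ge0 (g x)); nra.
Qed.

Lemma sqint_comb a f g : sqint f -> sqint g -> sqint (fun x => a * f x + g x).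
Proof.
move=> sf sg; have [mf f2] := sf; have [mg g2] := sg; split.
  by apply: measurable_funD => //; exact: measurable_funM.
rewrite (_ : (fun x => _) = (fun x => (a ^+ 2)%:E * (f x ^+ 2)%:E +
    ((2 * a)%:E * (f x * g x)%:E + (g x ^+ 2)%:E))%E).
  apply: integrableD => //; first exact: integrableZl.
  by apply: integrableD => //; apply: integrableZl => //; exact: sqintM.
by apply/funext => x; rewrite -!EFinM -!EFinD; congr EFin; ring.
Qed.

Lemma sqint0 : sqint (fun=> 0).
Proof.
split; first exact: measurable_cst.
by rewrite (_ : (fun x => _) = cst 0%E) ?integrable0//; apply/funext => x; rewrite expr0n.
Qed.

(** The weighted series [S] of squared increments is integrable, hence finite almost everywhere.
    Where it is finite, the increments are at most w^n times the root of [S], with w^2 = p, so the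
    sequence converges pointwise, and |f_n - g|^2 <= S p^n / (1 - w)^2 gives the rate after
    integration. The maximum with 1/2 keeps [p] positive when [q = 0]. *)
Lemma sqint_geometric_cauchy (f : nat -> T -> R) (C q : R) :
  0 <= C -> 0 <= q < 1 -> (forall n, sqint (f n)) ->
  (forall n, \int[mu]_(x in D) ((f n.+1 x - f n x) ^+ 2) <= C * q ^+ n) ->
  exists2 g, sqint g & exists C' q' : R, [/\ 0 <= C', 0 < q' < 1 &
    forall n, \int[mu]_(x in D) ((f n x - g x) ^+ 2) <= C' * q' ^+ n].
Proof.
move=> C0 /andP[q0 q1] sf df.
have sdf n : sqint (fun x => f n.+1 x - f n x).
  rewrite (_ : (fun x => _) = (fun x => -1 * f n x + f n.+1 x)).
    exact: sqint_comb.
  by apply/funext => x; rewrite mulN1r addrC.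
(* [p ^+ 2 >= q], so that the series [S] below, weighted by [p ^- n], is integrable *)
pose w : R := Num.sqrt (Num.sqrt (Num.max q 2^-1)).
pose p := w ^+ 2.
have m0 : 0 < Num.max q 2^-1 :> R by rewrite lt_max invr_gt0 orbC ltr0n.
have m1 : Num.max q 2^-1 < 1 :> R by rewrite gt_max q1/= invf_lt1 ?ltr1n.
have pE : p = Num.sqrt (Num.max q 2^-1) by rewrite /p sqr_sqrtr// sqrtr_ge0.
have p2 : p ^+ 2 = Num.max q 2^-1 by rewrite pE sqr_sqrtr ?ltW.
have p0 : 0 < p by rewrite pE sqrtr_gt0.
have p1 : p < 1.
  by rewrite -(ltr_pXn2r (_ : (0 < 2)%N)) ?nnegrE ?expr1n ?p2 ?(ltW p0).
have w0 : 0 < w by rewrite sqrtr_gt0 -pE.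
have w1 : w < 1.
  by rewrite -(ltr_pXn2r (_ : (0 < 2)%N)) ?nnegrE ?expr1n ?(ltW w0)//.
have qp n : C * q ^+ n / p ^+ n <= C * p ^+ n.
  rewrite ler_pdivrMr ?exprn_gt0// -mulrA ler_wpM2l// -exprMn -expr2 p2.
  by rewrite lerXn2r ?nnegrE ?(ltW m0)// le_max lexx.
pose t n x := (((f n.+1 x - f n x) ^+ 2) / p ^+ n)%:E.
have t0 n x : (0 <= t n x)%E.
  by rewrite lee_fin divr_ge0 ?sqr_ge0// exprn_ge0// ltW.
have mt n : measurable_fun D (t n).
  apply/measurable_EFinP; apply: measurable_funM; last exact: measurable_cst.
  by apply: measurable_funX; case: (sdf n).
pose S x := (\sum_(n <oo) t n x)%E.
have mS : measurable_fun D S by exact: ge0_emeasurable_sum.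
have S0 x : (0 <= S x)%E by exact: nneseries_ge0.
have intt n : (\int[mu]_(x in D) t n x <= (C * p ^+ n)%:E)%E.
  rewrite /t; under eq_integral do rewrite EFinM.
  rewrite ge0_integralZr//=.
  - have -> : (\int[mu]_(x in D) ((f n.+1 x - f n x) ^+ 2)%:E =
      (\int[mu]_(x in D) ((f n.+1 x - f n x) ^+ 2))%R%:E)%E.
      by rewrite /Rintegral fineK//; apply: integrable_fin_num => //; case: (sdf n).
    rewrite -EFinM lee_fin (le_trans _ (qp n))// ler_wpM2r//.
    by rewrite invr_ge0 exprn_ge0// ltW.
  - by apply/measurable_EFinP; apply: measurable_funX; case: (sdf n).
  - by move=> x _; rewrite lee_fin sqr_ge0.
  - by rewrite lee_fin invr_ge0 exprn_ge0// ltW.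
have intS : (\int[mu]_(x in D) S x <= (C / (1 - p))%:E)%E.
  rewrite integral_nneseries//.
  apply: (@le_trans _ _ (\sum_(n <oo) (C * p ^+ n)%:E)%E).
    apply: lee_nneseries => n *; last exact: intt.
    by apply: integral_ge0 => x _; exact: t0.
  have np : `|p| < 1 by rewrite ger0_norm// ltW.
  have h := @cvg_geometric_series _ C _ np.
  have -> : (\sum_(n <oo) (C * p ^+ n)%:E)%E = (C / (1 - p))%:E.
    apply/cvg_lim => //; apply: cvg_EFin.
      by apply: nearW => k /=; rewrite sumEFin.
    rewrite [X in X @ _ --> _](_ : _ = series (geometric C p))//.
    by apply/funext => k /=; rewrite sumEFin.
  by [].
have Soo : {ae mu, forall x, D x -> S x \is a fin_num}.
  apply: integrable_ae => //; apply/integrableP; split=> //.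
  under eq_integral do rewrite gee0_abs//.
  by rewrite (le_lt_trans intS)// ltry.
have tS n x : (t n x <= S x)%E.
  apply: (le_trans _ (@nneseries_lim_ge _ _ xpredT 0 n.+1 _)) => //.
  by rewrite big_nat_recr//= leeDr// sume_ge0.
pose E := D `&` [set x | (S x < +oo)%E].
have mE : measurable E.
  exact: emeasurable_fun_infty_o.
(* Truncation to the set where [S] is finite makes the sequence converge at every point of [D], so
   its limit is measurable. *)
pose h n x := f n x * \1_E x.
have hE n x : E x -> h n x = f n x by move=> Ex; rewrite /h indicE mem_set// mulr1.
have hE' n x : ~ E x -> h n x = 0 by move=> Ex; rewrite /h indicE memNset// mulr0.
have step n x : E x -> `|f n.+1 x - f n x| <= Num.sqrt (fine (S x)) * w ^+ n.
  move=> [Dx Sx].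
  rewrite -(ler_pXn2r (_ : (0 < 2)%N)) ?nnegrE//; last first.
    by rewrite mulr_ge0 ?sqrtr_ge0// exprn_ge0// ltW.
  rewrite exprMn sqr_sqrtr ?fine_ge0// -exprM mulnC exprM -/p.
  rewrite real_normK ?num_real// -ler_pdivrMr ?exprn_gt0//.
  rewrite -lee_fin fineK; first exact: tS.
  by rewrite ge0_fin_numE.
have dist n k x : E x -> `|f (n + k)%N x - f n x| <=
    Num.sqrt (fine (S x)) * w ^+ n / (1 - w) * (1 - w ^+ k).
  move=> Ex; elim: k => [|k ih].
    by rewrite addn0 subrr normr0 expr0 subrr mulr0.
  rewrite (_ : _ - _ = (f (n + k).+1 x - f (n + k)%N x) + (f (n + k)%N x - f n x)); last first.
    by rewrite addnS; ring.
  apply: (le_trans (ler_normD _ _)).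
  apply: (le_trans (lerD (step _ _ Ex) ih)).
  rewrite le_eqVlt; apply/orP; left; apply/eqP.
  by rewrite exprD exprS; field; rewrite subr_eq0 gt_eqF.
have dist' n k x : E x -> `|f (n + k)%N x - f n x| <=
    Num.sqrt (fine (S x)) / (1 - w) * w ^+ n.
  move=> Ex; apply: (le_trans (dist _ _ _ Ex)).
  rewrite [leRHS]mulrAC ler_piMr//.
    by rewrite divr_ge0 ?mulr_ge0 ?sqrtr_ge0 ?exprn_ge0 ?subr_ge0 ?(ltW w0) ?(ltW w1).
  by rewrite gerBl exprn_ge0// ltW.
have hc x : D x -> cvgn (h ^~ x).
  move=> Dx; have [Ex|Ex] := pselect (E x); last first.
    rewrite (_ : h ^~ x = cst 0); first exact: is_cvg_cst.
    by apply/funext => n; rewrite hE'.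
  have : cvgn (series (telescope (h ^~ x))).
    apply: normed_cvg.
    apply: (@series_le_cvg _ _ (geometric (Num.sqrt (fine (S x))) w)) => [n|n|n|].
    - by rewrite normr_ge0.
    - by rewrite mulr_ge0 ?sqrtr_ge0// exprn_ge0// ltW.
    - by rewrite [X in X <= _]/= [telescope _ n]/(h n.+1 x - h n x) !hE//; exact: step.
    - by apply: is_cvg_geometric_series; rewrite ger0_norm// ltW.
  move=> cs.
  rewrite (_ : h ^~ x = (fun=> h 0%N x) \+ series (telescope (h ^~ x))).
    by apply: is_cvgD => //; exact: is_cvg_cst.
  by apply/funext => n /=; rewrite [LHS](eq_sum_telescope (h ^~ x)).
pose g x := limn (h ^~ x).
have mh n : measurable_fun D (h n).
  by apply: measurable_funM; [case: (sf n)|exact: measurable_indic].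
have mg : measurable_fun D g.
  by apply: (measurable_fun_cvg mh) => x Dx; exact: hc.
have fg n x : E x -> `|f n x - g x| <= Num.sqrt (fine (S x)) / (1 - w) * w ^+ n.
  move=> Ex; have Dx : D x by case: Ex.
  have cf : `|f n x - h k x| @[k --> \oo] --> `|f n x - g x|.
    by apply: cvg_norm; apply: cvgB; [exact: cvg_cst|exact: hc].
  apply: (cvgr_to_le cf); exists n => //= k nk.
  by rewrite hE// distrC -(subnKC nk) dist'.
pose C1 := ((1 - w) ^+ 2)^-1.
have intfg n : (\int[mu]_(x in D) ((f n x - g x) ^+ 2)%:E <=
    (C1 * p ^+ n * (C / (1 - p)))%:E)%E.
  have C1p : 0 <= C1 * p ^+ n.
    by rewrite mulr_ge0 ?invr_ge0 ?sqr_ge0// exprn_ge0// ltW.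
  apply: (@le_trans _ _ (\int[mu]_(x in D) ((C1 * p ^+ n)%:E * S x))%E); last first.
    by rewrite ge0_integralZl_EFin// [leRHS]EFinM lee_wpmul2l ?lee_fin.
  apply: ae_ge0_le_integral => //.
  - by move=> x _; rewrite lee_fin sqr_ge0.
  - apply/measurable_EFinP/measurable_funX/measurable_funB => //; by case: (sf n).
  - by move=> x _; rewrite mule_ge0.
  - exact: measurable_funeM.
  apply: filterS Soo => x Sx Dx; have {}Sx := Sx Dx.
  have Ex : E x by split=> //=; rewrite -ge0_fin_numE.
  rewrite -(fineK Sx) -EFinM lee_fin -real_normK ?num_real//.
  have B0 : 0 <= Num.sqrt (fine (S x)) / (1 - w) * w ^+ n.
    by rewrite mulr_ge0 ?exprn_ge0 ?(ltW w0)// divr_ge0 ?sqrtr_ge0// subr_ge0 ltW.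
  apply: (@le_trans _ _ ((Num.sqrt (fine (S x)) / (1 - w) * w ^+ n) ^+ 2)).
    by rewrite lerXn2r ?nnegrE ?normr_ge0// fg.
  rewrite !exprMn sqr_sqrtr ?fine_ge0// exprVn -/C1.
  have -> : (w ^+ n) ^+ 2 = p ^+ n by rewrite /p -!exprM mulnC.
  have -> : w ^+ n * w ^+ n = p ^+ n by rewrite /p -exprD -exprM addnn mul2n.
  by rewrite -mulrA mulrC.
have sfg n : sqint (fun x => f n x - g x).
  apply/sqintP; split; first by apply: measurable_funB => //; case: (sf n).
  by rewrite (le_lt_trans (intfg n))// ltry.
exists g.
  rewrite (_ : g = fun x => -1 * (f 0 x - g x) + f 0 x); first exact: sqint_comb.
  by apply/funext => x; ring.
exists (C1 * (C / (1 - p))), p; split => [||n].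
- by rewrite mulr_ge0 ?invr_ge0 ?sqr_ge0// divr_ge0// subr_ge0 ltW.
- by rewrite p0.
- rewrite -lee_fin /Rintegral fineK.
    by rewrite (le_trans (intfg n))// lee_fin mulrAC.
  by apply: integrable_fin_num => //; case: (sfg n).
Qed.

End square_integrable.

Lemma integrable_indic_lty d (T : measurableType d) (R : realType)
    (mu : {measure set T -> \bar R}) (D A : set T) : measurable D -> measurable A ->
  (mu A < +oo)%E -> mu.-integrable D (fun x => (\1_A x : R)%:E).
Proof.
move=> mD mA Aoo; apply/integrableP; split; first exact/measurable_EFinP/measurable_indic.
under eq_integral do rewrite gee0_abs ?lee_fin//.
rewrite integral_indic//; apply: le_lt_trans Aoo.
by apply: le_measure; rewrite ?inE//; exact: measurableI.
Qed.

(** * Lebesgue measure of R^n *)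

Section row_measurability.
Context {R : realType} {n : nat}.
Implicit Types (A : set 'rV[R]_n) (x y : 'rV[R]_n).

Lemma row_ballE x e y : 0 < e -> ball x e y <-> forall j, `|x 0 j - y 0 j| < e.
Proof.
move=> e0; split=> [[_ h] j|h]; first exact: h.
by split=> // i j; rewrite !ord1; exact: h.
Qed.

(** An open set is the union of the cubes with rational centre and radius 1 / (k + 1) that it
    contains. There are countably many of them, and each is a finite intersection of coordinate
    conditions. *)
Lemma open_row_measurable A : open A -> measurable A.
Proof.
move=> oA.
pose B (p : 'rV[rat]_n * nat) : set 'rV[R]_n :=
  \bigcap_(j in [set: 'I_n]) [set x | `|x 0 j - ratr (p.1 0 j)| < p.2.+1%:R^-1].
have mB p : measurable (B p).
  apply: fin_bigcap_measurable => // j _.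
  set r : R := ratr _; set k : R := _^-1.
  have := @measurable_row_coord R n j measurableT _ (measurable_itv `]r - k, r + k[).
  rewrite setTI; congr measurable; apply/seteqP; split=> x /=;
    rewrite in_itv/= /row_coord ltr_norml; move: (x 0 j) => z /andP[? ?].
    by apply/andP; split; lra.
  by apply/andP; split; lra.
pose F p : set 'rV[R]_n := if pselect (B p `<=` A) then B p else set0.
have -> : A = \bigcup_p F p.
  apply/seteqP; split=> x; last first.
    by case=> p _; rewrite /F; case: pselect => // BA /BA.
  move=> Ax; have /nbhs_ballP[e /= e0 eA] := open_nbhs_nbhs (conj oA Ax).
  have [k ke] : exists k, (k.+1%:R : R)^-1 < e / 2.
    have e2 : 0 < e / 2 by rewrite divr_gt0.
    exists (Num.truncn (e / 2)^-1).
    by rewrite invf_plt ?posrE ?ltr0n// truncnS_gt.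
  set ik : R := _^-1 in ke.
  have k0 : 0 < ik by rewrite invr_gt0.
  have qP j : exists r : rat, `|x 0 j - ratr r| < ik.
    have : x 0 j - ik < x 0 j + ik by lra.
    move/rat_in_itvoo => [r]; rewrite in_itv/= => /andP[r1 r2]; exists r.
    by rewrite ltr_norml; apply/andP; split; lra.
  exists (\row_j sval (cid (qP j)), k) => //.
  have Bx : B (\row_j sval (cid (qP j)), k) x.
    by move=> j _ /=; rewrite mxE; case: cid.
  rewrite /F; case: pselect => //; apply; apply: subset_trans eA => y By.
  apply/row_ballE => // j.
  rewrite -(subrKA (ratr ((\row_j sval (cid (qP j))) 0 j))).
  apply: (le_lt_trans (ler_normD _ _)).
  have := By j I; have := Bx j I; rewrite /= -/ik => h1; rewrite distrC => h2; lra.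
apply: countable_bigcupT_measurable => // p.
rewrite /F; case: (pselect (B p `<=` A)) => ?; [exact: mB|exact: measurable0].
Qed.

Lemma continuous_row_measurable (f : 'rV[R]_n -> R) D :
  continuous f -> measurable_fun D f.
Proof.
move=> cf; apply: (@measurable_funS _ _ _ _ setT) => //.
apply: (measurability _ (RGenOpens.measurableE R)) => _ [_ [a [b ->] <-]].
rewrite setTI; apply: open_row_measurable.
by move/continuousP: cf; apply; exact: interval_open.
Qed.

End row_measurability.

(** Lebesgue measure is determined by its values on half-open intervals, and [t] times the image
    measure has the right ones. *)
Lemma lebesgue_measure_affine (R : realType) (c t : R) (A : set (measurableTypeR R)) :
  0 < t -> measurable A ->
  lebesgue_measure ((fun a => c + t * a) @^-1` A) = (t^-1%:E * lebesgue_measure A)%E.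
Proof.
move=> t0.
have mphi : measurable_fun [set: measurableTypeR R]
    ((fun a : R => c + t * a) : _ -> measurableTypeR R).
  by apply: measurable_funD; [exact: measurable_cst|exact: measurable_funM].
move=> mA.
have t'0 : 0 <= t by exact: ltW.
pose nu : {measure set (measurableTypeR R) -> \bar R} :=
  measure_function_pushforward__canonical__measure_function_Measure
    (@lebesgue_measure R) mphi.
suff -> : lebesgue_measure A = mscale (NngNum t'0) nu A.
  by rewrite /mscale/= muleA -EFinM mulVf ?gt_eqF// mul1e.
apply: lebesgue_measure_unique => // X [[a b] _ <-].
change (lebesgue_measure `]a, b]%classic =
  (t%:E * lebesgue_measure ((fun x : R => (c + t * x)%R) @^-1` `]a, b]%classic))%E).
have -> : (fun x : R => c + t * x) @^-1` `]a, b]%classic = `] (a - c) / t, (b - c) / t]%classic.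
  apply/seteqP; split=> x /=; rewrite !in_itv/= ltr_pdivrMr// ler_pdivlMr// => /andP[? ?].
    by apply/andP; split; lra.
  by apply/andP; split; lra.
rewrite !lebesgue_measure_itv/= !lte_fin ltr_pM2r ?invr_gt0// ltrD2r.
case: ifPn => _; last by rewrite mule0.
by rewrite -EFinB -EFinM; congr EFin; field; rewrite gt_eqF.
Qed.

Lemma row_cons_affine (R : realType) n (c : 'rV[R]_n.+1) t (p : measurableTypeR R * 'rV[R]_n) :
  c + t *: row_cons p = row_cons (c 0 ord0 + t * p.1, (row_uncons c).2 + t *: p.2).
Proof.
apply/rowP => j; rewrite !mxE; case: unliftP => [k ->|->] //.
by rewrite !mxE.
Qed.

(** Induction on the dimension by slicing: the slice of the preimage at [a] is the affine preimage
    of the slice of [A] at [c 0 ord0 + t * a]. The induction hypothesis treats the slices, the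
    one-dimensional case the outer integral. *)
Lemma row_lebesgue_measure_affine (R : realType) n (c : 'rV[R]_n) (t : R) A :
  0 < t -> measurable A ->
  row_lebesgue_measure n ((fun x => c + t *: x) @^-1` A) =
  ((t^-1 ^+ n)%:E * row_lebesgue_measure n A)%E.
Proof.
move=> t0; elim: n c A => [|n ih] c A mA.
  rewrite expr0 mul1e /= !diracE; congr (_%:R%:E); congr (nat_of_bool _).
  by apply/idP/idP; rewrite !inE /= (_ : c + _ = 0)//; apply/rowP => -[].
rewrite /= /row_lebesgue_step /pushforward /product_measure1.
have mG : measurable (@row_cons R n @^-1` A).
  by rewrite -[X in measurable X]setTI; exact: measurable_row_cons.
set G := @row_cons R n @^-1` A in mG *.
pose phi : measurableTypeR R -> measurableTypeR R := fun a => c 0 ord0 + t * a.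
have mphi : measurable_fun setT phi.
  by apply: measurable_funD; [exact: measurable_cst|exact: measurable_funM].
pose nu : {measure set (measurableTypeR R) -> \bar R} :=
  measure_function_pushforward__canonical__measure_function_Measure
    (@lebesgue_measure R) mphi.
pose g := row_lebesgue_measure n \o xsection G.
have mg : measurable_fun setT g by exact: measurable_fun_xsection.
have t'0 : 0 <= t^-1 by rewrite invr_ge0 ltW.
transitivity (\int[lebesgue_measure]_a ((t^-1 ^+ n)%:E * (g \o phi) a))%E.
  apply: eq_integral => a _ /=.
  rewrite /g /= -(ih (row_uncons c).2); last exact: measurable_xsection.
  congr (row_lebesgue_measure n _); apply/seteqP.
  by split=> y; rewrite /xsection /G /= !inE /= row_cons_affine.
rewrite ge0_integralZl//; last 2 first.
- exact: measurableT_comp.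
- by rewrite lee_fin exprn_ge0.
transitivity ((t^-1 ^+ n)%:E * \int[nu]_a g a)%E.
  by rewrite ge0_integral_pushforward.
rewrite (@eq_measure_integral _ _ _ _ (mscale (NngNum t'0) lebesgue_measure)); last first.
  by move=> B mB _; rewrite /nu/= /pushforward lebesgue_measure_affine.
rewrite ge0_integral_mscale//= muleA -EFinM; congr (_ * _)%E.
by congr EFin; rewrite exprS mulrC.
Qed.

(** * Euclidean balls and their volume *)

Section euclidean_balls.
Context {R : realType} {n : nat}.
Local Notation mu := (@row_lebesgue_measure R n).
Implicit Types (x c : 'rV[R]_n).

(** A polynomial in the coordinates, hence smooth everywhere, unlike [enorm]; all conditions on
    balls are converted to it. *)
Definition sqdist c x : R := \sum_j (x 0 j - c 0 j) ^+ 2.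

Lemma sqdist_ge0 c x : 0 <= sqdist c x.
Proof. by apply: sumr_ge0 => j _; exact: sqr_ge0. Qed.

Lemma enormB x c : enorm (x - c) = Num.sqrt (sqdist c x).
Proof. by congr Num.sqrt; apply: eq_bigr => j _; rewrite !mxE. Qed.

Lemma enormB_lt x c s : 0 <= s -> (enorm (x - c) < s) = (sqdist c x < s ^+ 2).
Proof.
move=> s0; rewrite enormB -[LHS](@ltr_pXn2r R 2 isT) ?nnegrE ?sqrtr_ge0//.
by rewrite sqr_sqrtr ?sqdist_ge0.
Qed.

Lemma enormB_gt x c s : 0 <= s -> (s < enorm (x - c)) = (s ^+ 2 < sqdist c x).
Proof.
move=> s0; rewrite enormB -[LHS](@ltr_pXn2r R 2 isT) ?nnegrE ?sqrtr_ge0//.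
by rewrite sqr_sqrtr ?sqdist_ge0.
Qed.

Lemma sqr_coord_le_sqdist c x j : (x 0 j - c 0 j) ^+ 2 <= sqdist c x.
Proof.
by rewrite /sqdist (bigD1 j)//= lerDl sumr_ge0// => i _; exact: sqr_ge0.
Qed.

Lemma coord_le_enorm x j : `|x 0 j| <= enorm x.
Proof.
rewrite /enorm -(sqrtr_sqr (x 0 j)) ler_wsqrtr//.
by rewrite (bigD1 j)//= lerDl sumr_ge0// => i _; exact: sqr_ge0.
Qed.

Lemma continuous_sqdist c : continuous (sqdist c).
Proof.
rewrite /sqdist; elim: (index_enum _) => [|j s ih] x.
  by under eq_fun do rewrite big_nil; exact: cst_continuous.
rewrite (_ : (fun y : 'rV[R]_n => _) =
    (fun y : 'rV[R]_n => (y 0 j - c 0 j) * (y 0 j - c 0 j)) \+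
    (fun y : 'rV[R]_n => \sum_(j <- s) (y 0 j - c 0 j) ^+ 2)); last first.
  by apply/funext => y; rewrite big_cons expr2.
have cj : {for x, continuous (fun y : 'rV[R]_n => y 0 j - c 0 j)}.
  by apply: continuousB; [exact: coord_continuous|exact: cst_continuous].
by apply: continuousD; [exact: (continuousM cj cj)|exact: ih].
Qed.

Lemma open_enorm_ball c s : open [set x | enorm (x - c) < s].
Proof.
have [s0|s0] := leP 0 s; last first.
  rewrite (_ : [set x | _] = set0); first exact: open0.
  apply/seteqP; split=> x //= h; have := lt_trans h s0.
  by rewrite ltNge sqrtr_ge0.
under eq_set do rewrite enormB_lt//.
have /continuousP/(_ _ (@open_lt _ (s ^+ 2))) := @continuous_sqdist c.
exact.
Qed.

Lemma open_enorm_shell c s t : 0 <= s -> open [set x | s < enorm (x - c) < t].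
Proof.
move=> s0; rewrite (_ : [set x | _] =
    [set x | s < enorm (x - c)] `&` [set x | enorm (x - c) < t]); last first.
  by apply/seteqP; split=> x /= [] => [/andP[]|->].
apply: openI; last exact: open_enorm_ball.
under eq_set do rewrite enormB_gt//.
have /continuousP/(_ _ (@open_gt _ (s ^+ 2))) := @continuous_sqdist c.
exact.
Qed.

Lemma measurable_unit_ball : measurable [set x : 'rV[R]_n | enorm x < 1].
Proof.
rewrite (_ : [set x | _] = [set x : 'rV[R]_n | enorm (x - 0) < 1]).
  by apply: open_row_measurable; apply: open_enorm_ball.
by apply/seteqP; split=> x /=; rewrite subr0.
Qed.

Lemma row_lebesgue_measure_ball c s : 0 < s ->
  mu [set x | enorm (x - c) < s] = ((s ^+ n)%:E * mu [set x | (enorm x < 1)%R])%E.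
Proof.
move=> s0; have s'0 : 0 < s^-1 by rewrite invr_gt0.
have mB := measurable_unit_ball.
rewrite -[in RHS](invrK s) -(row_lebesgue_measure_affine (s^-1 *: - c))//.
congr (mu _); apply/seteqP.
have E x : (enorm (x - c) < s) = (enorm (s^-1 *: - c + s^-1 *: x) < 1).
  rewrite -scalerDr [- c + x]addrC enormB_lt ?ltW//.
  rewrite -[_ *: _]subr0 enormB_lt ?ler01// expr1n.
  rewrite (_ : sqdist 0 _ = s^-1 ^+ 2 * sqdist c x).
    by rewrite exprVn mulrC ltr_pdivrMr ?exprn_gt0// mul1r.
  by rewrite mulr_sumr; apply: eq_bigr => j _; rewrite !mxE subr0 -exprMn.
by split=> x /=; rewrite E.
Qed.

End euclidean_balls.

Lemma normr_lt_itv (R : realType) (r : R) :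
  [set a : measurableTypeR R | `|a| < r] = `]-r, r[%classic.
Proof. by apply/seteqP; split=> a /=; rewrite in_itv/= ltr_norml. Qed.

Lemma measurable_cube (R : realType) n (r : R) :
  measurable [set x : 'rV[R]_n | forall j, `|x 0 j| < r].
Proof.
rewrite (_ : [set x | _] = \bigcap_(j in [set: 'I_n])
    (@row_coord R n j @^-1` [set a : measurableTypeR R | `|a| < r])).
  apply: fin_bigcap_measurable => // j _.
  have mI : measurable [set a : measurableTypeR R | `|a| < r] by rewrite normr_lt_itv.
  by have := @measurable_row_coord R n j measurableT _ mI; rewrite setTI.
by apply/seteqP; split=> x /= h j; [move=> _; exact: h|exact: (h j I)].
Qed.

Lemma row_lebesgue_measure_cube (R : realType) n (r : R) : 0 < r ->
  row_lebesgue_measure n [set x : 'rV[R]_n | forall j, `|x 0 j| < r] =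
  ((2 * r) ^+ n)%:E.
Proof.
move=> r0; elim: n => [|n ih].
  by rewrite /= diracE expr0 mem_set//= => -[].
rewrite /= /row_lebesgue_step /pushforward.
rewrite (_ : _ @^-1` _ = [set a : measurableTypeR R | `|a| < r] `*`
    [set x : 'rV[R]_n | forall j, `|x 0 j| < r]).
  rewrite product_measure1E//; last exact: measurable_cube.
    rewrite ih exprS EFinM; congr (_ * _)%E; rewrite normr_lt_itv.
    transitivity (lebesgue_measure `]-r, r[%classic) => //.
    rewrite lebesgue_measure_itv/= lte_fin gtrN// -EFinB; congr EFin; ring.
  by rewrite normr_lt_itv.
apply/seteqP; split=> -[a x] /=.
  move=> h; split => [|j].
    by have := h ord0; rewrite mxE unlift_none.
  by have := h (lift ord0 j); rewrite mxE liftK.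
by move=> [ha hx] j; rewrite mxE; case: unliftP => [k _|_]; [exact: hx|exact: ha].
Qed.

(** The unit ball lies in a cube, so its measure is finite and [fine] does not return its default
    value. *)
Lemma unit_ball_volumeE (R : realType) n :
  row_lebesgue_measure n [set x : 'rV[R]_n | enorm x < 1] =
  (unit_ball_volume n : R)%:E.
Proof.
rewrite /unit_ball_volume fineK// ge0_fin_numE//.
apply: (@le_lt_trans _ _ (row_lebesgue_measure n [set x : 'rV[R]_n | forall j, `|x 0 j| < 1])).
  apply: le_measure; rewrite ?inE; [exact: measurable_unit_ball|exact: measurable_cube|].
  by move=> x /= h j; exact: le_lt_trans (coord_le_enorm _ _) h.
by rewrite row_lebesgue_measure_cube// ltry.
Qed.

(** The ball contains a cube of half-side 1 / (n + 1): each squared coordinate is at most 1 / (n +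
    1), and n such terms add up to less than 1, also for n = 0. *)
Lemma unit_ball_volume_gt0 (R : realType) n : 0 < unit_ball_volume n :> R.
Proof.
have n0 : 0 < n.+1%:R^-1 :> R by rewrite invr_gt0.
rewrite -lte_fin -unit_ball_volumeE.
apply: (@lt_le_trans _ _ (row_lebesgue_measure n
  [set x : 'rV[R]_n | forall j, `|x 0 j| < n.+1%:R^-1])).
  by rewrite row_lebesgue_measure_cube// lte_fin exprn_gt0// mulr_gt0.
apply: le_measure; rewrite ?inE; [exact: measurable_cube|exact: measurable_unit_ball|].
move=> x /= h; rewrite -[x]subr0 enormB_lt ?ler01// expr1n.
apply: (@le_lt_trans _ _ (\sum_(j < n) n.+1%:R^-1)).
  apply: ler_sum => j _; rewrite mxE subr0 -real_normK ?num_real//.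
  have hj := ltW (h j); rewrite expr2 (le_trans (ler_pM _ _ hj hj))// -[leRHS]mulr1.
  by rewrite ler_wpM2l ?(ltW n0)// invf_le1 ?ler1n.
rewrite sumr_const card_ord -[_ *+ _]mulr_natr mulrC.
by rewrite ltr_pdivrMr// mul1r ltr_nat.
Qed.

(** * Smooth functions *)

Section flat_exponential.
Context {R : realType}.
Implicit Types (k : nat) (t : R).

(** The function t^-k exp(-1/t) extended by 0. The index is there because the derivatives of
    exp(-1/t) are combinations of these functions, so the family as a whole is stable under
    differentiation. *)
Definition flat_exp k t : R := if 0 < t then t^-1 ^+ k * expR (- t^-1) else 0.

Lemma flat_exp_le0 k t : t <= 0 -> flat_exp k t = 0.
Proof. by rewrite /flat_exp leNgt => /negbTE ->. Qed.

Lemma flat_exp_ge0 k t : 0 <= flat_exp k t.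
Proof.
rewrite /flat_exp; case: ifPn => // t0.
by rewrite mulr_ge0 ?expR_ge0// exprn_ge0// invr_ge0 ltW.
Qed.

(** The bound exp y >= y^N / N! at y = 1 / t, with N = k + n + 1. It makes every member of the
    family vanish at 0 to any order; n = 0 already gives continuity there. *)
Lemma flat_exp_le k n t : 0 < t -> flat_exp k t <= (k + n.+1)`!%:R * t ^+ n.+1.
Proof.
move=> t0; rewrite /flat_exp t0 expRN.
have y0 : 0 < t^-1 by rewrite invr_gt0.
have := expR_ge1Dxn (k + n) (ltW y0); rewrite -addnS => h.
have f0 : 0 < (k + n.+1)`!%:R :> R by rewrite ltr0n fact_gt0.
rewrite ler_pdivrMr ?expR_gt0//.
have h' : t^-1 ^+ (k + n.+1) / (k + n.+1)`!%:R <= expR t^-1 by lra.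
apply: le_trans (ler_wpM2l _ h'); last by rewrite mulr_ge0 ?ltW// exprn_gt0.
rewrite exprD [X in _ <= X](_ : _ = t^-1 ^+ k * (t ^+ n.+1 * t^-1 ^+ n.+1)).
  by rewrite -exprMn divff ?gt_eqF// expr1n mulr1.
by field; rewrite gt_eqF.
Qed.

Lemma flat_exp0_homo : {homo flat_exp 0 : s t / s <= t}.
Proof.
move=> s t st; have [s0|s0] := leP s 0; first by rewrite flat_exp_le0 ?flat_exp_ge0.
have t0 := lt_le_trans s0 st.
by rewrite /flat_exp s0 t0 !expr0 !mul1r ler_expR lerN2 lef_pV2.
Qed.

Lemma flat_exp0_gt0 t : 0 < t -> 0 < flat_exp 0 t.
Proof. by rewrite /flat_exp => t0; rewrite t0 expr0 mul1r expR_gt0. Qed.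

(** [flat_exp 2] is the derivative of [flat_exp 0], so this bounds the slope of the bumps. It comes
    from exp y >= 1 + y^2 / 2 at y = 1 / t. *)
Lemma flat_exp2_le2 t : flat_exp 2 t <= 2.
Proof.
have [t0|t0] := leP t 0; first by rewrite flat_exp_le0.
rewrite /flat_exp t0 expRN ler_pdivrMr ?expR_gt0//.
have y0 : 0 < t^-1 by rewrite invr_gt0.
have := expR_ge1Dxn 1 (ltW y0); rewrite (_ : 2`!%:R = 2 :> R) //.
move: (t^-1 ^+ 2) (expR _) => a b; lra.
Qed.

Lemma is_derive_flat_exp k t :
  is_derive t 1 (flat_exp k) (flat_exp k.+2 t - k%:R * flat_exp k.+1 t).
Proof.
have [t0|t0|t0] := ltgtP t 0.
- rewrite !flat_exp_le0 ?ltW// mulr0 subr0.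
  apply: (@near_eq_is_derive _ _ _ (cst 0)).
  near=> s; rewrite flat_exp_le0//; apply/ltW; near: s; exact: lt_nbhsl.
- suff : is_derive t 1 (fun s => s^-1 ^+ k * expR (- s^-1))
      (flat_exp k.+2 t - k%:R * flat_exp k.+1 t).
    apply: near_eq_is_derive.
    near=> s; rewrite /flat_exp ifT//; near: s.
    exists t => // z /=; rewrite ltr_norml => /andP[_]; lra.
  have tn0 : t != 0 by rewrite gt_eqF.
  have d1 : is_derive t 1 (fun s : R => s^-1) (- t ^- 2).
    by apply: is_derive_eq (is_deriveV tn0 _) _; rewrite /= scaler1.
  have d2 : is_derive t 1 (fun s : R => expR (- s^-1)) (expR (- t^-1) * t ^- 2).
    apply: is_derive_eq (@is_derive1_comp _ expR (fun s => - s^-1) t _ _ _ _) _.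
    by rewrite /= opprK.
  have d3 : is_derive t 1 (fun s : R => s^-1 ^+ k) (k%:R * t^-1 ^+ k.-1 * - t ^- 2).
    by have := is_deriveX k d1; rewrite exprfctE.
  apply: is_derive_eq (is_deriveM d3 d2) _.
  rewrite /= /flat_exp t0 /GRing.scale/=.
  case: k {d3} => [|k]; first by rewrite !mul0r mulr0 addr0 subr0 expr0 mul1r mulrC -exprVn.
  by rewrite /= -exprVn !exprS; ring.
- rewrite t0 !flat_exp_le0// mulr0 subr0.
  (* At the origin flat_exp k z = z flat_exp (k + 1) z, so [flat_exp k.+1] is the Caratheodory
     slope; it is continuous at 0 by [flat_exp_le]. *)
  apply/is_derive1_caratheodory; exists (flat_exp k.+1); split.
  + move=> z; rewrite [flat_exp k 0]flat_exp_le0// !subr0 /flat_exp.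
    case: ifPn => z0; last by rewrite mul0r.
    by rewrite exprSr [RHS]mulrAC -[_ * z]mulrA mulVf ?gt_eqF// mulr1.
  + pose C : R := (k.+1 + 1)`!%:R.
    have C0 : 0 < C by rewrite ltr0n fact_gt0.
    apply/cvgrPdist_lt => e e0; near=> z.
    rewrite (flat_exp_le0 _ (lexx 0)) sub0r normrN ger0_norm ?flat_exp_ge0//.
    have [z0|z0] := leP z 0; first by rewrite flat_exp_le0.
    apply: (le_lt_trans (flat_exp_le k.+1 0 z0)); rewrite expr1 -/C.
    rewrite mulrC -ltr_pdivlMr//; near: z; apply: lt_nbhsl.
    by rewrite divr_gt0.
  + exact: flat_exp_le0.
Unshelve. all: by end_near. Qed.

End flat_exponential.

(** * An explicit class of smooth functions *)

Section smooth_functions.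
Context {R : realType} {n : nat}.
Local Notation E := 'rV[R]_n.
Implicit Types (f g w : E -> R) (x : E).

Lemma smooth_differentiable w x : smooth w -> differentiable w x.
Proof. by move=> /(_ [::] x). Qed.

Lemma smooth_partial w j : smooth w -> smooth (partial j w).
Proof. by move=> sw s x; have := sw (rcons s j) x; rewrite foldr_rcons. Qed.

(** With this principle smoothness only requires exhibiting a stable class. [foldr] applies the last
    index of the list first, hence the induction from its end. *)
Lemma smooth_coind (C : (E -> R) -> Prop) :
  (forall f, C f -> forall x, differentiable f x) ->
  (forall f j, C f -> C (partial j f)) ->
  forall f, C f -> smooth f.
Proof.
move=> Cd Cp f Cf s; elim/last_ind: s f Cf => [|s j ih] f Cf x /=; first exact: Cd.
by rewrite foldr_rcons; apply: ih; exact: Cp.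
Qed.

Lemma partial_cst j (a : R) : partial j (fun=> a) = (fun=> 0) :> (E -> R).
Proof. by apply/funext => x; rewrite /partial derive_cst. Qed.

Lemma partial_coord j k : partial j (fun x : E => x 0 k) = (fun=> (k == j)%:R).
Proof.
apply/funext => x; rewrite /partial deriveE; last exact: differentiable_coord.
have @f : {linear E -> R}.
  by exists (fun N : E => N 0 k); do 2![eexists]; do ?[constructor];
    rewrite ?mxE// => ? *; rewrite ?mxE//; move=> ?; rewrite !mxE.
rewrite (_ : (fun x : E => x 0 k) = f) // diff_lin ?mxE ?eqxx//=.
  by rewrite mxE eqxx /=.
exact: coord_continuous.
Qed.

Lemma partialD j f g x : differentiable f x -> differentiable g x ->
  partial j (fun y => f y + g y) x = partial j f x + partial j g x.
Proof. by move=> df dg; rewrite /partial deriveD//; exact: diff_derivable. Qed.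

Lemma partialM j f g x : differentiable f x -> differentiable g x ->
  partial j (fun y => f y * g y) x = f x * partial j g x + g x * partial j f x.
Proof. by move=> df dg; rewrite /partial deriveM//; exact: diff_derivable. Qed.

Lemma partial_comp j (h : R -> R) dh f x : is_derive (f x) 1 h dh ->
  differentiable f x -> partial j (fun y => h (f y)) x = dh * partial j f x.
Proof.
move=> hh df; have dhf : differentiable h (f x) by apply/derivable1_diffP; case: hh.
rewrite /partial deriveE; last exact: (differentiable_comp df dhf).
rewrite (diff_comp df dhf) /= deriveE//.
rewrite -[X in 'd h _ X]mulr1 [X in 'd h _ X](_ : _ = 'd f x (delta_mx 0 j) *: (1 : R))//.
by rewrite linearZ /= -deriveE// -deriveE//; case: hh => _ ->; rewrite mulrC.
Qed.

(** The constructor [flat_comp] takes every [k] because differentiation raises the index. Quotients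
    are left out, so membership never depends on a nonvanishing denominator. *)
Inductive flat_elementary : (E -> R) -> Prop :=
| flat_cst a : flat_elementary (fun=> a)
| flat_coord j : flat_elementary (fun x => x 0 j)
| flat_add f g : flat_elementary f -> flat_elementary g ->
    flat_elementary (fun x => f x + g x)
| flat_mul f g : flat_elementary f -> flat_elementary g ->
    flat_elementary (fun x => f x * g x)
| flat_comp k f : flat_elementary f -> flat_elementary (fun x => flat_exp k (f x)).

Lemma flat_elementary_differentiable f x : flat_elementary f -> differentiable f x.
Proof.
elim=> {f} [a|j|f g _ df _ dg|f g _ df _ dg|k f _ df].
- exact: differentiable_cst.
- exact: differentiable_coord.
- exact: differentiableD.
- exact: differentiableM.
- apply: (differentiable_comp df); apply/derivable1_diffP.
  by have [] := is_derive_flat_exp k (f x).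
Qed.

Lemma flat_elementary_partial j f : flat_elementary f -> flat_elementary (partial j f).
Proof.
elim=> {f} [a|k|f g ff pf fg pg|f g ff pf fg pg|k f ff pf].
- by rewrite partial_cst; exact: flat_cst.
- by rewrite partial_coord; exact: flat_cst.
- rewrite (_ : partial j _ = fun x => partial j f x + partial j g x).
    exact: flat_add.
  by apply/funext => x; rewrite partialD//; exact: flat_elementary_differentiable.
- rewrite (_ : partial j _ = fun x => f x * partial j g x + g x * partial j f x).
    by apply: flat_add; exact: flat_mul.
  by apply/funext => x; rewrite partialM//; exact: flat_elementary_differentiable.
- rewrite (_ : partial j _ = fun x =>
    (flat_exp k.+2 (f x) + - k%:R * flat_exp k.+1 (f x)) * partial j f x).
    apply: flat_mul => //; apply: flat_add; first exact: flat_comp.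
    by apply: flat_mul; [exact: flat_cst|exact: flat_comp].
  apply/funext => x; rewrite (partial_comp _ (is_derive_flat_exp k (f x))) ?mulNr//.
  exact: flat_elementary_differentiable.
Qed.

Lemma flat_elementary_smooth f : flat_elementary f -> smooth f.
Proof.
apply: smooth_coind => [{}f ff x|{}f j]; first exact: flat_elementary_differentiable.
exact: flat_elementary_partial.
Qed.

Lemma sqdistE c : sqdist c = \sum_(j < n)
  (fun x : E => (x 0 j + - c 0 j) * (x 0 j + - c 0 j)).
Proof.
by apply/funext => x; rewrite fct_sumE; apply: eq_bigr => j _; rewrite expr2.
Qed.

Let flat_sqr (c : E) k :
  flat_elementary (fun x : E => (x 0 k + - c 0 k) * (x 0 k + - c 0 k)).
Proof.
by apply: flat_mul; apply: flat_add; by [exact: flat_coord|exact: flat_cst].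
Qed.

Lemma flat_elementary_sqdist c : flat_elementary (sqdist c).
Proof.
rewrite sqdistE; elim/big_ind: _ => [|f g ff fg|j _]; first exact: flat_cst.
- exact: flat_add.
- exact: flat_sqr.
Qed.

Lemma partial_sqdist j c x : partial j (sqdist c) x = 2 * (x 0 j - c 0 j).
Proof.
have dk k : differentiable (fun y : E => y 0 k + - c 0 k) x.
  by apply: differentiableD; [exact: differentiable_coord|exact: differentiable_cst].
rewrite /partial sqdistE derive_sum => [|k]; last first.
  by apply: diff_derivable; exact: differentiableM.
rewrite (eq_bigr (fun k => (k == j)%:R * (2 * (x 0 k - c 0 k)))) => [|k _].
  rewrite (bigD1 j)//= eqxx mul1r big1 ?addr0// => k /negbTE ->.
  by rewrite mul0r.
rewrite -/(partial _ _ _) partialM// partialD;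
  [|exact: differentiable_coord|exact: differentiable_cst].
rewrite partial_cst partial_coord; ring.
Qed.

End smooth_functions.

(** * The radial bump of one cell *)

Section bump.
Context {R : realType} {n : nat}.
Variables (c : 'rV[R]_n) (s d : R).
Hypothesis d0 : 0 < d.
Hypothesis ds : d < s.
Local Notation E := 'rV[R]_n.
Implicit Types (x : E).

(* [bump_level] is at most [0] on the core and at least [1] outside the ball.
   As [flat_exp 0] is increasing and vanishes on the negative half-line,
   [flat_exp 0 (flat_exp 0 1 - flat_exp 0 t)] is constant for [t <= 0] and
   vanishes for [1 <= t]: a plateau function obtained without division. *)
Definition bump_level x : R :=
  1 + - ((s ^+ 2 + - 1 * sqdist c x) * (s ^+ 2 - (s - d) ^+ 2)^-1).

Definition radial_bump x : R := flat_exp 0 (flat_exp 0 1 + -1 * flat_exp 0 (bump_level x)).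

Definition bump_height : R := flat_exp 0 (flat_exp 0 1).

Let w0 : 0 < s ^+ 2 - (s - d) ^+ 2.
Proof.
have -> : s ^+ 2 - (s - d) ^+ 2 = d * (2 * s - d) by ring.
by apply: mulr_gt0 => //; move: d0 ds; lra.
Qed.

Let bump_level_flat : flat_elementary bump_level.
Proof.
rewrite (_ : bump_level = fun x => 1 +
  (s ^+ 2 + - 1 * sqdist c x) * - (s ^+ 2 - (s - d) ^+ 2)^-1); last first.
  by apply/funext => x; rewrite mulrN.
apply: flat_add; first exact: flat_cst.
apply: flat_mul; last exact: flat_cst.
apply: flat_add; first exact: flat_cst.
by apply: flat_mul; [exact: flat_cst|exact: flat_elementary_sqdist].
Qed.

Let inner_flat : flat_elementary (fun x => flat_exp 0 1 + -1 * flat_exp 0 (bump_level x)).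
Proof.
apply: flat_add; first exact: flat_cst.
by apply: flat_mul; [exact: flat_cst|exact: flat_comp].
Qed.

Lemma radial_bump_flat : flat_elementary radial_bump.
Proof. exact: flat_comp. Qed.

Lemma bump_height_gt0 : 0 < bump_height.
Proof. by do 2 apply: flat_exp0_gt0. Qed.

Let level_out x : (s ^+ 2 <= sqdist c x) = (1 <= bump_level x).
Proof.
rewrite /bump_level lerDl oppr_ge0 pmulr_lle0 ?invr_gt0//; apply/idP/idP; lra.
Qed.

Let level_core x : (sqdist c x <= (s - d) ^+ 2) = (bump_level x <= 0).
Proof.
rewrite /bump_level subr_le0 -[X in _ = (X <= _)]mul1r ler_pdivlMr// mulr1 mul1r.
by apply/idP/idP; lra.
Qed.

Lemma radial_bump_out x : s ^+ 2 <= sqdist c x -> radial_bump x = 0.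
Proof.
rewrite level_out => h; rewrite /radial_bump flat_exp_le0// mulN1r subr_le0.
exact: flat_exp0_homo.
Qed.

Lemma radial_bump_core x : sqdist c x <= (s - d) ^+ 2 -> radial_bump x = bump_height.
Proof.
by rewrite level_core => h; rewrite /radial_bump (flat_exp_le0 _ h) mulr0 addr0.
Qed.

Lemma radial_bump_partialE j x : partial j radial_bump x =
  flat_exp 2 (flat_exp 0 1 + -1 * flat_exp 0 (bump_level x)) *
  - (flat_exp 2 (bump_level x) *
     (2 * (x 0 j - c 0 j) / (s ^+ 2 - (s - d) ^+ 2))).
Proof.
have fe (t : R) : is_derive t (1 : R) (flat_exp 0 : R -> R) (flat_exp 2 t).
  by have := is_derive_flat_exp 0 t; rewrite mul0r subr0.
have dS y : differentiable (sqdist c) y.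
  exact: flat_elementary_differentiable (flat_elementary_sqdist c).
rewrite /radial_bump (partial_comp _ (fe _)); last exact: flat_elementary_differentiable.
congr (_ * _).
rewrite partialD; last 2 first.
- exact: differentiable_cst.
- apply: flat_elementary_differentiable; apply: flat_mul; first exact: flat_cst.
  exact: flat_comp.
rewrite partial_cst add0r partialM; last 2 first.
- exact: differentiable_cst.
- by apply: flat_elementary_differentiable; exact: flat_comp.
rewrite partial_cst mulr0 addr0 mulN1r (partial_comp _ (fe _)); last first.
  exact: flat_elementary_differentiable.
congr (- (_ * _)).
rewrite (_ : bump_level = fun x => 1 +
  (s ^+ 2 + - 1 * sqdist c x) * - (s ^+ 2 - (s - d) ^+ 2)^-1); last first.
  by apply/funext => y; rewrite mulrN.
have f2 : flat_elementary (fun y => s ^+ 2 + -1 * sqdist c y).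
  apply: flat_add; first exact: flat_cst.
  by apply: flat_mul; [exact: flat_cst|exact: flat_elementary_sqdist].
rewrite partialD; last 2 first.
- exact: differentiable_cst.
- apply: flat_elementary_differentiable; apply: flat_mul => //; exact: flat_cst.
rewrite partial_cst add0r partialM; last 2 first.
- exact: flat_elementary_differentiable.
- exact: differentiable_cst.
rewrite partial_cst mulr0 add0r partialD; last 2 first.
- exact: differentiable_cst.
- by apply: differentiableM => //; exact: differentiable_cst.
rewrite partial_cst add0r partialM//.
rewrite partial_cst partial_sqdist; ring.
Qed.

(** The derivative has two [flat_exp 2] factors: the inner one vanishes on the core, where the level
    is at most 0, and the outer one outside the ball, where the level is at least 1. *)
Lemma radial_bump_partial_out j x :
  ~~ ((s - d) ^+ 2 < sqdist c x < s ^+ 2) -> partial j radial_bump x = 0.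
Proof.
rewrite negb_and -!leNgt radial_bump_partialE level_core level_out => /orP[h|h].
  by rewrite [flat_exp 2 (bump_level x)]flat_exp_le0// mul0r oppr0 mulr0.
rewrite [flat_exp 2 (_ + _)]flat_exp_le0 ?mul0r// mulN1r subr_le0.
exact: flat_exp0_homo.
Qed.

(** Both [flat_exp 2] factors are at most 2, which gives 16 after squaring. What remains is 4 |x -
    c|^2 / w^2 with |x - c| < s and w = d (2 s - d) >= d s, hence at most 4 / d^2. *)
Lemma radial_bump_gradient_le x : \sum_j (partial j radial_bump x) ^+ 2 <= 64 / d ^+ 2.
Proof.
have [h|h] := boolP ((s - d) ^+ 2 < sqdist c x < s ^+ 2); last first.
  rewrite big1 => [|j _]; last by rewrite radial_bump_partial_out// expr0n.
  by rewrite divr_ge0// ?sqr_ge0.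
have /andP[_ /ltW hs] := h.
under eq_bigr do rewrite radial_bump_partialE.
have w1 := w0.
set a := flat_exp 2 _; set b := flat_exp 2 _; set w := (_ - _ : R) in w1 *.
have a0 : 0 <= a by exact: flat_exp_ge0.
have b0 : 0 <= b by exact: flat_exp_ge0.
have a2 : a <= 2 by exact: flat_exp2_le2.
have b2 : b <= 2 by exact: flat_exp2_le2.
have -> : \sum_j (a * - (b * (2 * (x 0 j - c 0 j) / w))) ^+ 2 =
    (a ^+ 2 * b ^+ 2) * (4 * sqdist c x / w ^+ 2).
  rewrite /sqdist mulr_sumr mulr_suml mulr_sumr; apply: eq_bigr => j _.
  by field; rewrite gt_eqF.
have ab : a ^+ 2 * b ^+ 2 <= 16.
  have -> : (16 : R) = 2 ^+ 2 * 2 ^+ 2 by ring.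
  by apply: ler_pM; rewrite ?sqr_ge0// lerXn2r ?nnegrE.
have sw : 4 * sqdist c x / w ^+ 2 <= 4 / d ^+ 2.
  have s0 : 0 < s by exact: lt_trans ds.
  rewrite ler_pdivrMr ?exprn_gt0// mulrAC ler_pdivlMr ?exprn_gt0//.
  rewrite -!mulrA ler_pM2l//.
  apply: (@le_trans _ _ ((s * d) ^+ 2)).
    by rewrite exprMn ler_wpM2r ?sqr_ge0.
  have wE : w = d * (2 * s - d) by rewrite /w; ring.
  rewrite lerXn2r ?nnegrE ?(ltW w1) ?mulr_ge0 ?(ltW s0) ?(ltW d0)//.
  rewrite wE mulrC ler_pM2l//; move: ds; lra.
apply: (@le_trans _ _ (16 * (4 / d ^+ 2))).
  apply: ler_pM => //; first by rewrite mulr_ge0 ?sqr_ge0.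
  by rewrite divr_ge0 ?sqr_ge0// mulr_ge0// sqdist_ge0.
by rewrite mulrA; lra.
Qed.

End bump.

(** * Integration by parts *)

Section compact_support.
Context {R : realType} {n : nat}.
Local Notation E := 'rV[R]_n.
Local Notation mu := (@row_lebesgue_measure R n).
Implicit Types (F : E -> R) (K D : set E) (x : E).

Lemma coord_le_norm x j : `|x 0 j| <= `|x|.
Proof.
rewrite [X in _ <= X]/Num.norm/= mx_normrE.
exact: (le_bigmax _ (fun i => `|x i.1 i.2|) (0, j)).
Qed.

Lemma compact_sub_cube K : compact K ->
  exists2 r : R, 0 < r & K `<=` [set x | forall j, `|x 0 j| < r].
Proof.
move=> /compact_bounded [M [_ hM]]; exists (`|M| + 2).
  by rewrite ltr_wpDl.
move=> x Kx j; apply: (le_lt_trans (coord_le_norm _ _)).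
have h1 : M < `|M| + 1 by rewrite (le_lt_trans (ler_norm M))// ltrDl.
by have := hM _ h1 x Kx; rewrite /=; lra.
Qed.

Lemma norm_le_coord x r : 0 <= r -> (forall j, `|x 0 j| <= r) -> `|x| <= r.
Proof.
move=> r0 h; rewrite [X in X <= _]/Num.norm/= mx_normrE.
by apply: bigmax_le => // -[i j] _ /=; rewrite ord1.
Qed.

Lemma compact_sqdist_le c r : compact [set x : E | sqdist c x <= r].
Proof.
apply: bounded_closed_compact; last first.
  have /continuous_closedP/(_ _ (@closed_le _ r)) := @continuous_sqdist R n c.
  exact.
exists (`|c| + (`|r| + 1)); split; first exact: num_real.
move=> M cM x /= xr; apply: le_trans (ltW cM).
rewrite -[x](subrK c) addrC (le_trans (ler_normD _ _))// lerD2l.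
apply: norm_le_coord => [|j]; first exact: addr_ge0.
rewrite leNgt; apply/negP => h.
have : (`|r| + 1) ^+ 2 < sqdist c x.
  apply: lt_le_trans (sqr_coord_le_sqdist c x j).
  rewrite -[ltRHS]real_normK ?num_real// ltrXn2r ?nnegrE ?normr_ge0 ?addr_ge0//.
  by move: h; rewrite !mxE.
apply/negP; rewrite -leNgt; apply: (le_trans xr); apply: (le_trans (ler_norm r)).
rewrite expr2 mulrDl mul1r mulrDr mulr1; have := normr_ge0 r.
have := mulr_ge0 (normr_ge0 r) (normr_ge0 r); lra.
Qed.

Lemma compact_support_bounded F K : continuous F -> compact K ->
  (forall x, ~ K x -> F x = 0) -> exists2 M : R, 0 <= M & forall x, `|F x| <= M.
Proof.
move=> cF cK F0.
have : compact (F @` K).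
  by apply: continuous_compact => //; exact: continuous_subspaceT.
move=> /compact_bounded [M [_ hM]]; exists (`|M| + 1); first by rewrite addr_ge0.
have h1 : M < `|M| + 1 by rewrite (le_lt_trans (ler_norm M))// ltrDl.
move=> x; have [Kx|Kx] := pselect (K x).
  by apply: (hM _ h1 (F x)); exists x.
by rewrite F0// normr0 addr_ge0.
Qed.

Lemma integrable_cst_cube (M r : R) : 0 < r ->
  mu.-integrable setT (fun x : E => (M * \1_[set x | forall j, `|x 0 j| < r] x)%:E).
Proof.
move=> r0; rewrite (_ : (fun x => _) = (fun x =>
  M%:E * (\1_[set x : E | forall j, `|x 0 j| < r] x)%:E)%E).
  apply: integrableZl => //; apply: integrable_indic_lty => //.
    exact: measurable_cube.
  have : (mu [set x : E | forall j, (`|x 0 j| < r)%R] < +oo)%E; last exact.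
  by rewrite row_lebesgue_measure_cube// ltry.
by apply/funext => x; rewrite EFinM.
Qed.

Lemma integrable_compact_support F K D : continuous F -> compact K ->
  (forall x, ~ K x -> F x = 0) -> measurable D -> mu.-integrable D (EFin \o F).
Proof.
move=> cF cK F0 mD.
have [M M0 hM] := compact_support_bounded cF cK F0.
have [r r0 Kr] := compact_sub_cube cK.
apply: (@integrableS _ _ _ _ setT) => //.
apply: (le_integrable _ _ _ (integrable_cst_cube M r0)) => //.
  by apply/measurable_EFinP; exact: continuous_row_measurable.
move=> x _ /=; rewrite lee_fin.
have [Kx|Kx] := pselect (K x).
  by rewrite indicE mem_set ?mulr1 ?(ger0_norm M0)//; exact: Kr.
by rewrite F0// normr0.
Qed.

Section translation.
Variables (F : E -> R) (a : E).
Hypotheses (cF : continuous F) (iF : mu.-integrable setT (EFin \o F)).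

Let phi : E -> E := fun x => a + x.

Let mphi : measurable_fun setT phi.
Proof.
apply: measurable_fun_row => i; rewrite (_ : (fun t => _) = fun x : E => a 0 i + x 0 i).
  by apply: measurable_funD; [exact: measurable_cst|exact: measurable_row_coord].
by apply/funext => x; rewrite mxE.
Qed.

Let nu : {measure set E -> \bar R} :=
  measure_function_pushforward__canonical__measure_function_Measure mu mphi.

Let nuE A : measurable A -> nu A = mu A.
Proof.
move=> mA; have := row_lebesgue_measure_affine a ltr01 mA.
rewrite invr1 expr1n mul1e => <-; rewrite /nu/= /pushforward.
by congr (mu _); apply/seteqP; split=> x /=; rewrite /phi scale1r.
Qed.

Let mF : measurable_fun setT F.
Proof. exact: continuous_row_measurable. Qed.

Lemma integrable_translate : mu.-integrable setT (fun x => (F (a + x))%:E).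
Proof.
apply/integrableP; split.
  by apply/measurable_EFinP; exact: measurableT_comp.
have := iF => /integrableP[_]; congr (_ < _)%E.
transitivity (\int[nu]_x `|(F x)%:E|)%E.
  by apply: eq_measure_integral => A mA _; rewrite nuE.
rewrite /nu/= ge0_integral_pushforward ?preimage_setT//.
by apply/measurable_EFinP; exact: measurableT_comp.
Qed.

Lemma integral_translate : (\int[mu]_x (F (a + x))%:E = \int[mu]_x (F x)%:E)%E.
Proof.
transitivity (\int[nu]_x (F x)%:E)%E; last by apply: eq_measure_integral => A mA _; exact: nuE.
rewrite /nu /= integral_pushforward ?preimage_setT//; first exact/measurable_EFinP.
exact: integrable_translate.
Qed.

End translation.

Lemma partial_out F K j x : compact K -> (forall x, ~ K x -> F x = 0) ->
  ~ K x -> partial j F x = 0.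
Proof.
move=> cK F0 Kx.
have oK : open (~` K).
  by apply: closed_openC; apply: compact_closed => //; exact: norm_hausdorff.
rewrite /partial (@near_eq_derive _ _ _ _ (cst 0)) ?derive_cst//.
by apply: filterS (open_nbhs_nbhs (conj oK Kx)) => y; exact: F0.
Qed.

(* The difference quotients have integral [0] by translation invariance, and
   converge dominatedly to the partial derivative. *)
Lemma integral_partial_eq0 F K (j : 'I_n) :
  (forall x, differentiable F x) -> continuous (partial j F) -> compact K ->
  (forall x, ~ K x -> F x = 0) -> (\int[mu]_x (partial j F x)%:E = 0)%E.
Proof.
move=> dF cpF cK F0; pose v : E := delta_mx 0 j.
have cF : continuous F by move=> x; exact: differentiable_continuous.
have pF0 x : ~ K x -> partial j F x = 0 by exact: partial_out.
have [M M0 hM] := compact_support_bounded cpF cK pF0.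
have [r r0 Kr] := compact_sub_cube cK.
have iF := integrable_compact_support cF cK F0 (@measurableT _ E).
pose D k x : R := k.+1%:R * (F (k.+1%:R^-1 *: v + x) - F x).
have Dmean k x : exists y : E, D k x = partial j F y /\
    exists2 t : R, 0 <= t <= 1 & y = t *: v + x.
  have k0 : 0 < k.+1%:R^-1 :> R by rewrite invr_gt0.
  have der (t : R) : is_derive t (1 : R) (fun t : R => F (t *: v + x)) (partial j F (t *: v + x)).
    have dl : differentiable (fun t : R => t *: v + x) t by [].
    have dc : differentiable (fun t : R => F (t *: v + x)) t.
      by apply: (differentiable_comp dl (dF _)).
    apply: DeriveDef; first exact/derivable1_diffP.
    have e : (fun h : R => h^-1 *: (F ((h *: (1 : R) + t) *: v + x) - F (t *: v + x))) =
        (fun h => h^-1 *: (F (h *: v + (t *: v + x)) - F (t *: v + x))).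
      by apply/funext => h; rewrite [h *: _]mulr1 scalerDl addrA.
    exact: (congr1 (fun g : R -> R => lim (g @ 0^')) e).
  have [t] := @MVT R (fun t => F (t *: v + x)) _ 0 _ k0 (fun t _ => der t)
    (continuous_subspaceT (fun t => differentiable_continuous
      (proj1 (derivable1_diffP _ _) (@ex_derive _ _ _ _ _ _ _ (der t))))).
  rewrite in_itv/= => /andP[t0 t1]; rewrite scale0r add0r subr0 => h.
  exists (t *: v + x); split.
    by rewrite /D h mulrC divfK.
  exists t => //; rewrite (ltW t0)/= (le_trans (ltW t1))//.
  by rewrite invf_le1 ?ler1n.
(* By the mean value theorem the quotient is a value of the partial derivative at a point whose
   coordinates differ from those of [x] by at most 1. The cube around the support, enlarged by 1,
   therefore dominates all quotients at once. *)
have Dle k x : `|D k x| <= M * \1_[set x : E | forall j, `|x 0 j| < r + 1] x.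
  have [y [-> [t /andP[t0 t1] yE]]] := Dmean k x.
  have [h|h] := pselect (forall i, `|x 0 i| < r + 1).
    by rewrite indicE mem_set// mulr1.
  rewrite pF0 ?normr0 ?mulr_ge0 ?indicE//.
  move=> /Kr /= yr; apply: h => i.
  have xE : x 0 i = y 0 i - t * v 0 i by rewrite yE !mxE; ring.
  have v0 : 0 <= v 0 i <= 1 by rewrite /v mxE eqxx /=; case: (i == j); rewrite ?lexx ?ler01.
  have tv : `|t * v 0 i| <= 1.
    case/andP: v0 => v0 v1; rewrite ger0_norm ?mulr_ge0//.
    by rewrite -[1]mulr1 ler_pM.
  by rewrite xE (le_lt_trans (ler_normB _ _))// ltr_leD.
have mD k : measurable_fun setT (D k).
  apply: measurable_funM; first exact: measurable_cst.
  apply: measurable_funB; last exact: continuous_row_measurable.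
  apply/measurable_EFinP; exact: measurable_int (integrable_translate _ cF iF).
have hk : (fun k => k.+1%:R^-1 : R) @ \oo --> (0 : R)^'.
  move=> A; rewrite /dnbhs /within /= => hA.
  have H : \forall k \near \oo, @harmonic R k != 0 -> A (harmonic k) := cvg_harmonic hA.
  by apply: filterS H => k; apply; rewrite invr_eq0 pnatr_eq0.
have D_cvg x : (D k x)%:E @[k --> \oo] --> (partial j F x)%:E.
  apply: cvg_EFin; first exact: nearW.
  have /cvg_ex[l hl] := (@diff_derivable _ _ _ F x v (dF x)).
  have pE : partial j F x = l by apply/cvg_lim.
  rewrite pE; have := cvg_comp _ _ hk hl.
  apply: cvg_trans; apply: near_eq_cvg; apply: nearW => k /=.
  by rewrite /D invrK.
have intD k : (\int[mu]_x (D k x)%:E = 0)%E.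
  under eq_integral do rewrite /D EFinM EFinB.
  have iT := integrable_translate (k.+1%:R^-1 *: v) cF iF.
  rewrite integralZl//; last exact: integrableB.
  by rewrite integralB// integral_translate// subee ?mule0//; exact: integrable_fin_num.
have [||||| _ _] := @dominated_convergence _ E R mu setT measurableT
  (fun k x => (D k x)%:E) (fun x => (partial j F x)%:E)
  (fun x => (M * \1_[set x : E | forall j, `|x 0 j| < r + 1] x)%:E).
- by move=> k; apply/measurable_EFinP; exact: mD.
- by apply/measurable_EFinP; exact: continuous_row_measurable.
- by apply: aeW => x _; exact: D_cvg.
- by apply: integrable_cst_cube; rewrite addr_gt0.
- by apply: aeW => x k _ /=; rewrite lee_fin; exact: Dle.
rewrite (_ : [sequence _]_n = cst 0%E); last by apply/funext => k; exact: intD.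
by move=> h; apply: (cvg_unique _ h); [exact: ereal_hausdorff|exact: cvg_cst].
Qed.

End compact_support.

(** * Weighted inner products *)

Section complex_integral.
Context {R : realType} {n : nat}.
Local Notation E := 'rV[R]_n.
Local Notation mu := (@row_lebesgue_measure R n).
Local Notation Re := complex.Re.
Local Notation Im := complex.Im.
Variable D : set E.
Hypothesis mD : measurable D.
Implicit Types (f g u v : E -> R[i]) (z : R[i]).

Lemma cReM z (w : R[i]) : Re (z * w) = Re z * Re w - Im z * Im w.
Proof. by case: z => ? ?; case: w. Qed.

Lemma cImM z (w : R[i]) : Im (z * w) = Re z * Im w + Im z * Re w.
Proof. by case: z => ? ?; case: w. Qed.

Lemma cReD z (w : R[i]) : Re (z + w) = Re z + Re w.
Proof. by case: z => ? ?; case: w. Qed.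

Lemma cImD z (w : R[i]) : Im (z + w) = Im z + Im w.
Proof. by case: z => ? ?; case: w. Qed.

Lemma cReN z : Re (- z) = - Re z. Proof. by case: z. Qed.

Lemma cImN z : Im (- z) = - Im z. Proof. by case: z. Qed.

Lemma cReJ z : Re (z^*)%C = Re z. Proof. by case: z. Qed.

Lemma cImJ z : Im (z^*)%C = - Im z. Proof. by case: z. Qed.

Lemma complex_eqP z (w : R[i]) : Re z = Re w -> Im z = Im w -> z = w.
Proof. by case: z w => ? ? [? ?] /= -> ->. Qed.

Definition cplxE := (cReM, cImM, cReD, cImD, cReN, cImN, cReJ, cImJ).

Definition cintegrable f : Prop :=
  mu.-integrable D (EFin \o (fun x => Re (f x))) /\
  mu.-integrable D (EFin \o (fun x => Im (f x))).

Lemma integrable_comb (a b : R) (f g : E -> R) :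
  mu.-integrable D (EFin \o f) -> mu.-integrable D (EFin \o g) ->
  mu.-integrable D (EFin \o (fun x => a * f x + b * g x)).
Proof.
move=> iF ig; rewrite (_ : EFin \o _ = (fun x => (a%:E * (f x)%:E + b%:E * (g x)%:E)%E)).
  by apply: integrableD => //; exact: integrableZl.
by apply/funext => x /=; rewrite -!EFinM -EFinD.
Qed.

Lemma Rintegral_comb (a b : R) (f g : E -> R) :
  mu.-integrable D (EFin \o f) -> mu.-integrable D (EFin \o g) ->
  (\int[mu]_(x in D) (a * f x + b * g x))%R =
  a * (\int[mu]_(x in D) f x)%R + b * (\int[mu]_(x in D) g x)%R.
Proof.
move=> iF ig.
have iz (c : R) h : mu.-integrable D (EFin \o h) ->
    mu.-integrable D (EFin \o (fun x => c * h x)).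
  move=> ih; rewrite (_ : EFin \o _ = (fun x => (c%:E * (h x)%:E)%E)).
    exact: integrableZl.
  by apply/funext => x /=; rewrite -!EFinM.
by rewrite RintegralD ?RintegralZl//; exact: iz.
Qed.

Lemma Rintegral_eq (f g : E -> R) : (forall x, D x -> f x = g x) ->
  (\int[mu]_(x in D) f x)%R = (\int[mu]_(x in D) g x)%R.
Proof. by move=> fg; apply: eq_Rintegral => x /[!inE]; exact: fg. Qed.

Lemma eq_cintegral f g : (forall x, D x -> f x = g x) ->
  cintegral D f = cintegral D g.
Proof.
by move=> fg; congr Complex; apply: Rintegral_eq => x Dx; rewrite fg.
Qed.

Lemma cintegral_comb z f g : cintegrable f -> cintegrable g ->
  cintegral D (fun x => z * f x + g x) = z * cintegral D f + cintegral D g.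
Proof.
move=> [rf jf] [rg jg]; have := integrable_comb (Re z) (- Im z) rf jf.
have := integrable_comb (Re z) (Im z) jf rf => ij ir.
apply: complex_eqP; rewrite !cplxE /=.
  rewrite -mulNr -Rintegral_comb// -[X in _ = _ + X]mul1r -[X in X + _]mul1r -Rintegral_comb//.
  by apply: Rintegral_eq => x _; rewrite !cplxE; ring.
rewrite -Rintegral_comb// -[X in _ = _ + X]mul1r -[X in X + _]mul1r -Rintegral_comb//.
by apply: Rintegral_eq => x _; rewrite !cplxE; ring.
Qed.

Lemma cintegral_conj f : cintegrable f ->
  cintegral D (fun x => (f x)^*)%C = ((cintegral D f)^*)%C.
Proof.
move=> [rf jf]; apply: complex_eqP; rewrite !cplxE /=.
  by apply: Rintegral_eq => x _; rewrite cplxE.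
rewrite -[RHS]mulN1r -RintegralZl//.
by apply: Rintegral_eq => x _; rewrite cplxE mulN1r.
Qed.

Lemma L2P u : L2 D u <->
  sqint mu D (fun x => Re (u x)) /\ sqint mu D (fun x => Im (u x)).
Proof.
split=> [[mr mi fi]|[[mr ir] [mi ii]]].
  have m2 : measurable_fun D (fun x => (abs2 (u x))%:E).
    by apply/measurable_EFinP/measurable_funD; exact: measurable_funX.
  split; apply/sqintP => //; split=> //; apply: le_lt_trans fi;
    apply: ge0_le_integral => //; rewrite ?lee_fin.
  - by move=> x _; rewrite lee_fin sqr_ge0.
  - by apply/measurable_EFinP/measurable_funX.
  - by move=> x _; rewrite lee_fin lerDl sqr_ge0.
  - by move=> x _; rewrite lee_fin sqr_ge0.
  - by apply/measurable_EFinP/measurable_funX.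
  - by move=> x _; rewrite lee_fin lerDr sqr_ge0.
split=> //; have := integrableD mD ir ii => /integrable_lty; apply.
exact: mD.
Qed.

Lemma L2_comb z u v : L2 D u -> L2 D v -> L2 D (fun x => z * u x + v x).
Proof.
move=> /L2P[ru iu] /L2P[rv iv]; apply/L2P; split.
  rewrite (_ : (fun x => _) = (fun x => Re z * Re (u x) + (- Im z * Im (u x) + Re (v x)))).
    by do 2 apply: sqint_comb => //.
  by apply/funext => x; rewrite !cplxE; ring.
rewrite (_ : (fun x => _) = (fun x => Re z * Im (u x) + (Im z * Re (u x) + Im (v x)))).
  by do 2 apply: sqint_comb => //.
by apply/funext => x; rewrite !cplxE; ring.
Qed.

Lemma L2_0 : L2 D (fun=> 0).
Proof. by apply/L2P; split; exact: sqint0. Qed.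

Lemma L2Z z u : L2 D u -> L2 D (fun x => z * u x).
Proof.
move=> hu; rewrite (_ : (fun x => _) = (fun x => z * u x + 0)).
  exact: L2_comb L2_0.
by apply/funext => x; rewrite addr0.
Qed.

Lemma L2_sum (I : Type) (s : seq I) (F : I -> E -> R[i]) :
  (forall i, L2 D (F i)) -> L2 D (fun x => \sum_(i <- s) F i x).
Proof.
move=> hF; elim: s => [|i s ih].
  rewrite (_ : (fun x => _) = fun=> 0); first exact: L2_0.
  by apply/funext => x; rewrite big_nil.
rewrite (_ : (fun x => _) = fun x => 1 * F i x + \sum_(i <- s) F i x).
  exact: L2_comb.
by apply/funext => x; rewrite big_cons mul1r.
Qed.

Section weight.
Variables (b : E -> R) (lo hi : R).
Hypothesis mb : measurable_fun D b.
Hypothesis lo0 : 0 < lo.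
Hypothesis bb : forall x, D x -> lo <= b x <= hi.

Lemma integrable_weight (f : E -> R) : mu.-integrable D (EFin \o f) ->
  mu.-integrable D (EFin \o (fun x => b x * f x)).
Proof.
move=> iF; have /integrableP[mf _] := iF.
have hi0 : 0 <= `|hi| by [].
have ih : mu.-integrable D (fun x => (`|hi|%:E * (f x)%:E)%E) by exact: integrableZl.
apply: (le_integrable mD _ _ ih).
  by apply/measurable_EFinP; apply: measurable_funM => //; exact/measurable_EFinP.
move=> x Dx /=; rewrite lee_fin !normrM normr_id ler_wpM2r//.
have /andP[h1 h2] := bb Dx; rewrite ger0_norm ?(le_trans h2) ?ler_norm//.
by apply: le_trans h1; exact: ltW.
Qed.

Lemma cintegrable_inner u v : L2 D u -> L2 D v ->
  cintegrable (fun x => u x * (v x)^* * (b x)%:C)%C.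
Proof.
move=> /L2P[ru iu] /L2P[rv iv]; split.
  rewrite (_ : EFin \o _ = EFin \o (fun x =>
      b x * (1 * (Re (u x) * Re (v x)) + 1 * (Im (u x) * Im (v x))))).
    by apply: integrable_weight; apply: integrable_comb; exact: sqintM.
  by apply/funext => x /=; rewrite !cplxE /=; congr EFin; ring.
rewrite (_ : EFin \o _ = EFin \o (fun x =>
      b x * (1 * (Im (u x) * Re (v x)) + -1 * (Re (u x) * Im (v x))))).
  by apply: integrable_weight; apply: integrable_comb; exact: sqintM.
by apply/funext => x /=; rewrite !cplxE /=; congr EFin; ring.
Qed.

Local Notation inner := (weighted_inner D b).

Lemma inner_comb z u v w : L2 D u -> L2 D v -> L2 D w ->
  inner (fun x => z * u x + v x) w = z * inner u w + inner v w.
Proof.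
move=> hu hv hw; rewrite /weighted_inner -cintegral_comb; try exact: cintegrable_inner.
by apply: eq_cintegral => x _; ring.
Qed.

Lemma inner_conj u v : L2 D u -> L2 D v -> inner u v = (inner v u)^*%C.
Proof.
move=> hu hv; rewrite /weighted_inner -cintegral_conj; last exact: cintegrable_inner.
by apply: eq_cintegral => x _; apply: complex_eqP; rewrite !cplxE /=; ring.
Qed.

Lemma inner_sum (I : Type) (s : seq I) (c : I -> R[i]) (F : I -> E -> R[i]) w :
  (forall i, L2 D (F i)) -> L2 D w ->
  inner (fun x => \sum_(i <- s) c i * F i x) w = \sum_(i <- s) c i * inner (F i) w.
Proof.
move=> hF hw; elim: s => [|i s ih].
  rewrite big_nil (_ : (fun x => _) = (fun x => -1 * 0 + 0)); last first.
    by apply/funext => x; rewrite big_nil mulr0 addr0.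
  rewrite (@inner_comb _ (fun=> 0) (fun=> 0)) ?mulN1r ?addNr//; exact: L2_0.
rewrite big_cons -ih -inner_comb//; last by apply: L2_sum => j; exact: L2Z.
by congr (inner _ w); apply/funext => x; rewrite big_cons.
Qed.

Lemma weighted_sqnormE u : L2 D u ->
  weighted_sqnorm D b u = (\int[mu]_(x in D) (b x * abs2 (u x)))%R.
Proof.
move=> hu; apply: Rintegral_eq => x _.
by rewrite !cplxE /= /abs2; ring.
Qed.

(** The complex function space is used as a real one, with real coefficients and the real part of
    the weighted product as form; the abstract results on symmetric operators then apply to it. *)
Definition rcomb (a : R) u v : E -> R[i] := fun x => (a%:C)%C * u x + v x.

Definition real_inner u v : R := Re (inner u v).

Lemma rinner_psd (K : (E -> R[i]) -> Prop) : (forall u, K u -> L2 D u) ->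
  psd_form rcomb K real_inner.
Proof.
move=> KL; split=> [u v /KL hu /KL hv|a u v w /KL hu /KL hv /KL hw|u /KL hu].
- by rewrite /real_inner inner_conj// cReJ.
- by rewrite /real_inner inner_comb// !cplxE /= mul0r subr0.
- rewrite -[real_inner u u]/(weighted_sqnorm D b u) weighted_sqnormE//.
  apply: Rintegral_ge0 => x Dx; have /andP[h1 _] := bb Dx.
  apply: mulr_ge0; first exact: le_trans (ltW lo0) h1.
  by rewrite /abs2 addr_ge0 ?sqr_ge0.
Qed.

End weight.

End complex_integral.

(** * The weighted L^2 space as a complete space *)

Section weighted_space.
Context {R : realType} {n : nat}.
Local Notation E := 'rV[R]_n.
Local Notation mu := (@row_lebesgue_measure R n).
Local Notation Re := complex.Re.
Local Notation Im := complex.Im.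
Variable D : set E.
Hypothesis mD : measurable D.
Variables (b : E -> R) (lo hi : R).
Hypothesis mb : measurable_fun D b.
Hypothesis lo0 : 0 < lo.
Hypothesis bb : forall x, D x -> lo <= b x <= hi.
Implicit Types (f g u v w : E -> R[i]) (z : R[i]).
Local Notation inner := (weighted_inner D b).
Local Notation rinner := (real_inner D b).

Let psd : psd_form (@rcomb R n) (L2 D) rinner.
Proof. exact: (rinner_psd mD mb lo0 bb). Qed.

Lemma integrable_abs2 u : L2 D u -> mu.-integrable D (EFin \o (fun x => abs2 (u x))).
Proof. by move=> /(L2P mD)[[_ ru] [_ iu]]; exact: (integrableD mD ru iu). Qed.

Lemma rinner_ge u : L2 D u ->
  lo * (\int[mu]_(x in D) abs2 (u x))%R <= rinner u u.
Proof.
move=> hu; have ha := integrable_abs2 hu.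
rewrite -[leRHS]/(weighted_sqnorm D b u) weighted_sqnormE// -RintegralZl//.
apply: le_Rintegral => //.
- have := integrable_comb mD lo 0 ha ha; congr (_.-integrable D _).
  by apply/funext => x /=; rewrite mul0r addr0.
- exact: (integrable_weight mD mb lo0 bb).
- move=> x Dx; have /andP[h1 _] := bb Dx.
  by rewrite ler_wpM2r// /abs2 addr_ge0 ?sqr_ge0.
Qed.

Lemma rinner_le u : L2 D u ->
  rinner u u <= hi * (\int[mu]_(x in D) abs2 (u x))%R.
Proof.
move=> hu; have ha := integrable_abs2 hu.
rewrite -[leLHS]/(weighted_sqnorm D b u) weighted_sqnormE// -RintegralZl//.
apply: le_Rintegral => //.
- exact: (integrable_weight mD mb lo0 bb).
- have := integrable_comb mD hi 0 ha ha; congr (_.-integrable D _).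
  by apply/funext => x /=; rewrite mul0r addr0.
- move=> x Dx; have /andP[_ h1] := bb Dx.
  by rewrite ler_wpM2r// /abs2 addr_ge0 ?sqr_ge0.
Qed.

Lemma Rintegral_abs2 u : L2 D u -> (\int[mu]_(x in D) abs2 (u x))%R =
  (\int[mu]_(x in D) (Re (u x) ^+ 2))%R + (\int[mu]_(x in D) (Im (u x) ^+ 2))%R.
Proof. by move=> /(L2P mD)[[_ ru] [_ iu]]; rewrite RintegralD. Qed.

Lemma innerZ z u w : L2 D u -> L2 D w -> inner (fun x => z * u x) w = z * inner u w.
Proof.
move=> hu hw; rewrite (_ : (fun x => _) = (fun x => (z - 1) * u x + u x)).
  by rewrite (inner_comb mD mb lo0 bb)//; ring.
by apply/funext => x; ring.
Qed.

(** The product is conjugate linear in its second argument, so i comes out as -i and turns the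
    imaginary part into a real one. Statements on [rinner] against all vectors thus carry over to
    the complex product. *)
Lemma Im_inner u w : L2 D u -> L2 D w ->
  Im (inner u w) = rinner u (fun x => 'i%C * w x).
Proof.
move=> hu hw; have hiw := L2Z mD 'i%C hw.
rewrite /rinner (inner_conj mD mb lo0 bb hu hiw) cReJ innerZ//.
by rewrite (inner_conj mD mb lo0 bb hu hw) !cplxE /=; ring.
Qed.

Lemma inner_eq0 u w : L2 D u -> L2 D w -> rinner u u = 0 -> inner u w = 0.
Proof.
move=> hu hw u0.
have cs v : L2 D v -> rinner u v = 0.
  move=> hv; apply/eqP; rewrite -sqrf_eq0 eq_le sqr_ge0 andbT.
  have := psd_cauchy_schwarz (fun a u v => @L2_comb R n D mD (a%:C)%C u v) psd hu hv.
  by rewrite u0 mul0r.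
by apply: complex_eqP; [exact: cs|rewrite Im_inner// cs//; exact: L2Z].
Qed.

Lemma rinner_eq0_ae u : L2 D u -> rinner u u = 0 -> ae_eq_on D u (fun=> 0).
Proof.
move=> hu u0.
have ha := integrable_abs2 hu.
have i0 : (\int[mu]_(x in D) abs2 (u x))%R = 0.
  have := rinner_ge hu; rewrite u0 pmulr_rle0// => h.
  apply/eqP; rewrite eq_le h/=; apply: Rintegral_ge0 => x _.
  by rewrite /abs2 addr_ge0 ?sqr_ge0.
have : (\int[mu]_(x in D) `|(abs2 (u x))%:E| = 0)%E.
  under eq_integral do rewrite gee0_abs ?lee_fin ?addr_ge0 ?sqr_ge0//.
  by rewrite -[LHS]fineK ?integrable_fin_num//; congr EFin.
move/ae_eq_integral_abs => -/(_ mD) h.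
have /h : measurable_fun D (fun x => (abs2 (u x))%:E) by case/integrableP : ha.
apply: filterS => x /= + Dx => /(_ Dx) [] /eqP.
rewrite paddr_eq0 ?sqr_ge0// !sqrf_eq0 => /andP[/eqP r0 /eqP im0].
exact: complex_eqP.
Qed.

Lemma ae_eq_inner u v w : L2 D u -> L2 D v -> L2 D w -> ae_eq_on D u v ->
  inner u w = inner v w.
Proof.
move=> hu hv hw uv.
have [/integrableP[m1 _] /integrableP[m2 _]] := cintegrable_inner mD mb lo0 bb hu hw.
have [/integrableP[m3 _] /integrableP[m4 _]] := cintegrable_inner mD mb lo0 bb hv hw.
rewrite /weighted_inner /cintegral /Rintegral; congr Complex; congr fine.
  by apply: ae_eq_integral => //; apply: filterS uv => x /= h Dx; rewrite h.
by apply: ae_eq_integral => //; apply: filterS uv => x /= h Dx; rewrite h.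
Qed.

(** The bounds on the weight make the weighted and the plain norm comparable, so real and imaginary
    parts converge by [sqint_geometric_cauchy]. Orthogonality passes to the limit by
    Cauchy-Schwarz. *)
Lemma orthogonal_complete (I : Type) (W : I -> E -> R[i]) :
  (forall i, L2 D (W i)) ->
  let K u := L2 D u /\ forall i, inner u (W i) = 0 in
  forall (u : nat -> E -> R[i]) (C q : R),
  0 <= C -> 0 <= q < 1 -> (forall k, K (u k)) ->
  (forall k, rinner (rcomb (-1) (u k) (u k.+1)) (rcomb (-1) (u k) (u k.+1)) <= C * q ^+ k) ->
  exists2 v, K v &
    forall e, 0 < e -> exists M, forall k, (M <= k)%N ->
      rinner (rcomb (-1) (u k) v) (rcomb (-1) (u k) v) < e.
Proof.
move=> hW K u C q C0 q01 Ku du.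
have hu k : L2 D (u k) by case: (Ku k).
have hd k : L2 D (rcomb (-1) (u k) (u k.+1)) by exact: L2_comb.
have ab k : (\int[mu]_(x in D) abs2 (rcomb (-1) (u k) (u k.+1) x))%R <= C / lo * q ^+ k.
  rewrite mulrAC ler_pdivlMr// mulrC; exact: le_trans (rinner_ge (hd k)) (du k).
have part (P : R[i] -> R) : (forall k, sqint mu D (fun x => P (u k x))) ->
   (forall k x, (P (u k.+1 x) - P (u k x)) ^+ 2 <= abs2 (rcomb (-1) (u k) (u k.+1) x)) ->
   exists2 g : E -> R, sqint mu D g & exists C' q' : R, [/\ 0 <= C', 0 < q' < 1 &
    forall k, \int[mu]_(x in D) ((P (u k x) - g x) ^+ 2) <= C' * q' ^+ k].
  move=> sP hP; apply: (@sqint_geometric_cauchy _ _ _ mu D mD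
    (fun k x => P (u k x)) (C / lo) q) => //.
    by rewrite divr_ge0// ltW.
  move=> k; apply: le_trans (ab k); apply: le_Rintegral => //; last exact: integrable_abs2.
  have := sqint_comb mD (-1) (sP k) (sP k.+1) => -[_]; congr (_.-integrable D _).
  by apply/funext => x /=; congr EFin; ring.
have sR k : sqint mu D (fun x => Re (u k x)) by have /(L2P mD)[] := hu k.
have sI k : sqint mu D (fun x => Im (u k x)) by have /(L2P mD)[] := hu k.
have [|gr sgr [C1 [q1 [C10 /andP[q10 q11] h1]]]] := part (@complex.Re R) sR.
  move=> k x; rewrite /abs2 /rcomb !cplxE /=.
  by rewrite mul0r subr0 mulN1r addrC lerDl sqr_ge0.
have [|gi sgi [C2 [q2 [C20 /andP[q20 q21] h2]]]] := part (@complex.Im R) sI.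
  move=> k x; rewrite /abs2 /rcomb !cplxE /=.
  by rewrite !mul0r !subr0 !addr0 !mulN1r [- Im _ + _]addrC lerDr sqr_ge0.
pose v x := (gr x +i* gi x)%C.
have hv : L2 D v by apply/(L2P mD).
have hc k : L2 D (rcomb (-1) (u k) v) by exact: L2_comb.
have hi0 : 0 <= `|hi| by [].
have lim k : rinner (rcomb (-1) (u k) v) (rcomb (-1) (u k) v) <=
    `|hi| * (C1 * q1 ^+ k + C2 * q2 ^+ k).
  apply: (le_trans (rinner_le (hc k))).
  apply: (@le_trans _ _ (`|hi| * (\int[mu]_(x in D) abs2 (rcomb (-1) (u k) v x))%R)).
    by rewrite ler_wpM2r ?ler_norm// Rintegral_ge0// => x _; rewrite /abs2 addr_ge0 ?sqr_ge0.
  rewrite ler_wpM2l// Rintegral_abs2//; apply: lerD.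
    rewrite (le_trans _ (h1 k))// le_eqVlt; apply/orP; left; apply/eqP.
    by apply: Rintegral_eq => x _; rewrite /rcomb !cplxE /=; ring.
  rewrite (le_trans _ (h2 k))// le_eqVlt; apply/orP; left; apply/eqP.
  by apply: Rintegral_eq => x _; rewrite /rcomb !cplxE /=; ring.
have lim0 : forall e, 0 < e -> exists M, forall k, (M <= k)%N ->
    rinner (rcomb (-1) (u k) v) (rcomb (-1) (u k) v) < e.
  move=> e e0.
  have /cvgrPdist_lt /(_ _ e0) [M _ hM] :
      `|hi| * (C1 * q1 ^+ k + C2 * q2 ^+ k) @[k --> \oo] --> 0.
    rewrite -[X in _ --> X](mulr0 `|hi|); apply: cvgM; first exact: cvg_cst.
    rewrite -[X in _ --> X](addr0 0); apply: cvgD.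
      rewrite -[X in _ --> X](mulr0 C1); apply: cvgM; first exact: cvg_cst.
      by apply: cvg_expr; rewrite ger0_norm// ltW.
    rewrite -[X in _ --> X](mulr0 C2); apply: cvgM; first exact: cvg_cst.
    by apply: cvg_expr; rewrite ger0_norm// ltW.
  exists M => k Mk; apply: (le_lt_trans (lim k)).
  have := hM k Mk; rewrite /= sub0r normrN; exact: le_lt_trans (ler_norm _).
exists v => //; split=> // i.
have key w : L2 D w -> (forall k, rinner (u k) w = 0) -> rinner v w = 0.
  move=> hw uw; apply/eqP; rewrite -sqrf_eq0 eq_le sqr_ge0 andbT.
  apply/ler_addgt0Pl => e e0; rewrite addr0.
  have N0 : 0 <= rinner w w by case: psd => _ _; exact.
  (* The added 1 keeps the denominator positive when [w] is null. *)
  have e1 : 0 < e / (rinner w w + 1) by rewrite divr_gt0// ltr_wpDl.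
  have [M /(_ M (leqnn _)) hM] := lim0 _ e1.
  have := psd_cauchy_schwarz (fun a u v => @L2_comb R n D mD (a%:C)%C u v) psd (hc M) hw.
  have -> : rinner (rcomb (-1) (u M) v) w = rinner v w.
    by case: psd => _ -> // _; rewrite uw mulr0 add0r.
  move=> h; apply: (le_trans h); apply: (le_trans (ler_wpM2r N0 (ltW hM))).
  rewrite mulrAC ler_pdivrMr ?ltr_wpDl//; lra.
apply: complex_eqP; first by apply: key => // k; rewrite /rinner; case: (Ku k) => _ ->.
rewrite Im_inner//; apply: key; first exact: L2Z.
by move=> k; rewrite -Im_inner//; case: (Ku k) => _ ->.
Qed.

End weighted_space.

(** * Test functions as elements of H^1_0 *)

Section test_functions.
Context {R : realType} {n : nat}.
Local Notation E := 'rV[R]_n.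
Local Notation mu := (@row_lebesgue_measure R n).
Local Notation Re := complex.Re.
Local Notation Im := complex.Im.
Variable D : set E.
Hypothesis mD : measurable D.
Implicit Types (f g w : E -> R) (K : set E).

Lemma smooth_continuous w : smooth w -> continuous w.
Proof. by move=> sw x; apply/differentiable_continuous/smooth_differentiable. Qed.

Lemma sqint_compact_support w K : continuous w -> compact K ->
  (forall x, ~ K x -> w x = 0) -> sqint mu D w.
Proof.
move=> cw cK w0; split; first exact: continuous_row_measurable.
apply: (@integrable_compact_support _ _ (fun x => w x ^+ 2) K) => //.
  by move=> x; apply: (@continuous_comp _ _ _ w (fun y : R => y ^+ 2));
    [exact: cw|exact: exprn_continuous].
by move=> x Kx; rewrite w0// expr0n.
Qed.

(** The product of [f] and [g] has compact support, so its partial derivative has integral 0 over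
    the whole space. As the support lies in [D], the integral over [D] is the same. *)
Lemma partial_by_parts f g K j : smooth f -> smooth g -> compact K -> K `<=` D ->
  (forall x, ~ K x -> f x = 0) ->
  (\int[mu]_(x in D) (f x * partial j g x))%R = - (\int[mu]_(x in D) (partial j f x * g x))%R.
Proof.
move=> sf sg cK KD f0.
have spf := smooth_partial j sf; have spg := smooth_partial j sg.
have cf := smooth_continuous sf; have cg := smooth_continuous sg.
have cpf := smooth_continuous spf; have cpg := smooth_continuous spg.
have pf0 x : ~ K x -> partial j f x = 0 by exact: partial_out.
have pE : partial j (fun x => f x * g x) =
    (fun x => f x * partial j g x + g x * partial j f x).
  by apply/funext => x; rewrite partialM//; exact: smooth_differentiable.
have := @integral_partial_eq0 _ _ (fun x => f x * g x) K j.
rewrite pE => H.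
have c1 : continuous (fun x => f x * partial j g x).
  by move=> x; apply: continuousM; [exact: cf|exact: cpg].
have c2 : continuous (fun x => partial j f x * g x).
  by move=> x; apply: continuousM; [exact: cpf|exact: cg].
have i1 : mu.-integrable D (EFin \o (fun x => f x * partial j g x)).
  by apply: (integrable_compact_support c1 cK) => // x Kx; rewrite f0// mul0r.
have i2 : mu.-integrable D (EFin \o (fun x => partial j f x * g x)).
  by apply: (integrable_compact_support c2 cK) => // x Kx; rewrite pf0// mul0r.
apply/eqP; rewrite -subr_eq0 opprK -RintegralD//; apply/eqP.
rewrite Rintegral_mkcond /Rintegral.
rewrite (_ : (fun x => _) = (fun x => (f x * partial j g x + g x * partial j f x)%:E)).
  rewrite H//.
  - by move=> x; apply: differentiableM; exact: smooth_differentiable.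
  - have c3 : continuous (fun x => g x * partial j f x).
      by move=> x; apply: continuousM; [exact: cg|exact: cpf].
    by move=> x; exact: (continuousD (c1 x) (c3 x)).
  - by move=> x Kx; rewrite f0// mul0r.
apply/funext => x; rewrite patchE; case: ifPn => [_|]; first by rewrite [g x * _]mulrC.
rewrite notin_setE => nDx; have nKx : ~ K x by move=> /KD.
by rewrite f0// pf0// mul0r mulr0 addr0.
Qed.

Lemma test_functionP phi : test_function D phi ->
  exists K, [/\ compact K, K `<=` D,
    smooth (fun x => Re (phi x)) /\ smooth (fun x => Im (phi x)) &
    (forall x, ~ K x -> Re (phi x) = 0) /\ (forall x, ~ K x -> Im (phi x) = 0)].
Proof.
move=> [sr si [K [cK KD K0]]]; exists K; split=> //.
by split=> x Kx; rewrite K0.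
Qed.

Lemma test_function_L2 phi : test_function D phi -> L2 D phi.
Proof.
move=> /test_functionP[K [cK KD [sr si] [r0 i0]]]; apply/(L2P mD); split.
  by apply: sqint_compact_support cK r0; exact: smooth_continuous.
by apply: sqint_compact_support cK i0; exact: smooth_continuous.
Qed.

Lemma test_function_grad_L2 phi j : test_function D phi -> L2 D (cgrad phi j).
Proof.
move=> /test_functionP[K [cK KD [sr si] [r0 i0]]]; apply/(L2P mD); split.
  apply: (sqint_compact_support _ cK); first exact/smooth_continuous/smooth_partial.
  by move=> x; exact: partial_out.
apply: (sqint_compact_support _ cK); first exact/smooth_continuous/smooth_partial.
by move=> x; exact: partial_out.
Qed.

Lemma test_function_weak_gradient phi : test_function D phi ->
  weak_gradient D phi (cgrad phi).
Proof.
move=> tphi j psi tpsi.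
have /(L2P mD)[pr pi] := test_function_L2 tphi.
have /(L2P mD)[qr qi] := test_function_L2 tpsi.
have /(L2P mD)[gpr gpi] := test_function_grad_L2 j tphi.
have /(L2P mD)[gqr gqi] := test_function_grad_L2 j tpsi.
have [K [cK KD [sr si] [r0 i0]]] := test_functionP tphi.
have [_ [_ _ [sr' si'] _]] := test_functionP tpsi.
apply: complex_eqP; rewrite ?cplxE /=.
  transitivity (\int[mu]_(x in D)
    (1 * (Re (phi x) * Re (cgrad psi j x)) + -1 * (Im (phi x) * Im (cgrad psi j x))))%R.
    by apply: Rintegral_eq => x _; rewrite !cplxE mul1r mulN1r.
  transitivity (- \int[mu]_(x in D)
    (1 * (Re (cgrad phi j x) * Re (psi x)) + -1 * (Im (cgrad phi j x) * Im (psi x))))%R; last first.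
    by congr (- _); apply: Rintegral_eq => x _; rewrite !cplxE mul1r mulN1r.
  rewrite !Rintegral_comb//; try exact: sqintM.
  rewrite /= (partial_by_parts j sr sr' cK KD r0) (partial_by_parts j si si' cK KD i0); ring.
transitivity (\int[mu]_(x in D)
    (1 * (Re (phi x) * Im (cgrad psi j x)) + 1 * (Im (phi x) * Re (cgrad psi j x))))%R.
  by apply: Rintegral_eq => x _; rewrite !cplxE !mul1r.
transitivity (- \int[mu]_(x in D)
    (1 * (Re (cgrad phi j x) * Im (psi x)) + 1 * (Im (cgrad phi j x) * Re (psi x))))%R; last first.
  by congr (- _); apply: Rintegral_eq => x _; rewrite !cplxE !mul1r.
rewrite !Rintegral_comb//; try exact: sqintM.
rewrite /= (partial_by_parts j sr si' cK KD r0) (partial_by_parts j si sr' cK KD i0); ring.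
Qed.

Lemma test_function_H10 phi : test_function D phi -> H10 D phi (cgrad phi).
Proof.
move=> tphi; split.
  split; [exact: test_function_L2|by move=> j; exact: test_function_grad_L2|].
  exact: test_function_weak_gradient.
exists (fun=> phi); split=> // .
have z (v : E -> R[i]) : sqnorm D (fun x => v x - v x) = 0%E.
  by apply: integral0_eq => x _; rewrite subrr /abs2 /= expr0n addr0.
rewrite /H1_sqnorm z add0e big1 => [|j _]; last exact: z.
exact: cvg_cst.
Qed.

End test_functions.

(** * The variational principle *)

Section discrete_operator.
Context {R : realType} {n : nat}.
Local Notation E := 'rV[R]_n.
Local Notation Re := complex.Re.
Local Notation Im := complex.Im.
Variable D : set E.
Hypothesis mD : measurable D.
Variables (a : E -> R) (alo ahi : R).
Hypothesis ma : measurable_fun D a.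
Hypothesis alo0 : 0 < alo.
Hypothesis ab : forall x, D x -> alo <= a x <= ahi.
Variables (b : E -> R) (lo hi : R).
Hypothesis mb : measurable_fun D b.
Hypothesis lo0 : 0 < lo.
Hypothesis bb : forall x, D x -> lo <= b x <= hi.
Implicit Types (f u v w : E -> R[i]) (g h : 'I_n -> E -> R[i]) (z : R[i]).
Local Notation inner := (weighted_inner D b).
Local Notation rinner := (real_inner D b).
Local Notation form := Defs.form.
Local Notation operator := (operator D a b).

Let psd : psd_form (@rcomb R n) (L2 D) rinner.
Proof. exact: (rinner_psd mD mb lo0 bb). Qed.

Let L2c (c : R) u v : L2 D u -> L2 D v -> L2 D (rcomb c u v).
Proof. by move=> hu hv; exact: L2_comb. Qed.

Let rl (c : R) u v w : L2 D u -> L2 D v -> L2 D w ->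
  rinner (rcomb c u v) w = c * rinner u w + rinner v w.
Proof. by case: psd => _ + _; exact. Qed.

Let rC u v : L2 D u -> L2 D v -> rinner u v = rinner v u.
Proof. by case: psd => + _ _; exact. Qed.

Let r0 u : L2 D u -> 0 <= rinner u u.
Proof. by case: psd => _ _; exact. Qed.

(** The energy form becomes a sum of weighted products with weight [a], so symmetry, linearity and
    positivity are inherited from the results for a general weight. *)
Lemma formE g h : (forall j, L2 D (g j)) -> (forall j, L2 D (h j)) ->
  form D a g h = \sum_(j < n) weighted_inner D a (g j) (h j).
Proof.
move=> hg hh; rewrite /form (eq_cintegral (g := fun x =>
    \sum_(j < n) g j x * (h j x)^*%C * ((a x)%:C)%C)); last first.
  by move=> x _; rewrite mulrC mulr_suml.
suff H (s : seq 'I_n) : cintegrable D (fun x => \sum_(j <- s) g j x * (h j x)^*%C * ((a x)%:C)%C) /\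
    cintegral D (fun x => \sum_(j <- s) g j x * (h j x)^*%C * ((a x)%:C)%C) =
    \sum_(j <- s) weighted_inner D a (g j) (h j).
  by have [_ ->] := H (index_enum 'I_n).
elim: s => [|j s [[i1 i2] ih]].
  rewrite (_ : (fun x => _) = fun=> 0); last by apply/funext => x; rewrite big_nil.
  rewrite big_nil; split; first by split; exact: integrable0.
  by apply: complex_eqP; rewrite /= /Rintegral integral0.
have ij := cintegrable_inner mD ma alo0 ab (hg j) (hh j).
rewrite (_ : (fun x => _) = (fun x => 1 * (g j x * (h j x)^*%C * ((a x)%:C)%C) +
   \sum_(j <- s) g j x * (h j x)^*%C * ((a x)%:C)%C)); last first.
  by apply/funext => x; rewrite big_cons mul1r.
rewrite big_cons cintegral_comb// mul1r ih; split=> //.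
case: ij => j1 j2; split.
  have := integrable_comb mD 1 1 j1 i1; congr (_.-integrable D _).
  by apply/funext => x /=; rewrite !mul1r cReD.
have := integrable_comb mD 1 1 j2 i2; congr (_.-integrable D _).
by apply/funext => x /=; rewrite !mul1r cImD.
Qed.

Definition vcomb (c : R) g h : 'I_n -> E -> R[i] := fun j => rcomb c (g j) (h j).

Definition rform g h : R := Re (form D a g h).

Lemma rform_psd : psd_form vcomb (fun g => forall j, L2 D (g j)) rform.
Proof.
have [aC al a0] := rinner_psd mD ma alo0 ab (K := L2 D) (fun u hu => hu).
have ReS (F : 'I_n -> R[i]) : Re (\sum_j F j) = \sum_j Re (F j).
  by elim/big_ind2: _ => // x1 x2 y1 y2 <- <-; rewrite cReD.
split=> [u v hu hv|c u v w hu hv hw|u hu].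
- by rewrite /rform !formE// !ReS; apply: eq_bigr => j _; exact: aC.
- have hc j : L2 D (vcomb c u v j) by exact: L2c.
  rewrite /rform !formE// !ReS mulr_sumr -big_split; apply: eq_bigr => j _.
  exact: al.
- by rewrite /rform formE// ReS; apply: sumr_ge0 => j _; exact: a0.
Qed.

Lemma form_conj g h : (forall j, L2 D (g j)) -> (forall j, L2 D (h j)) ->
  form D a g h = (form D a h g)^*%C.
Proof.
move=> hg hh; rewrite !formE// rmorph_sum; apply: eq_bigr => j _.
exact: (inner_conj mD ma alo0 ab).
Qed.

Lemma H10_L2 u g : H10 D u g -> L2 D u /\ forall j, L2 D (g j).
Proof. by move=> [[]]. Qed.

Lemma operator_L2 u f : operator u f -> L2 D u /\ L2 D f.
Proof. by move=> [hf [g [/H10_L2[]]]]. Qed.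

Lemma operator_sym u f v f' : operator u f -> operator v f' ->
  inner f v = (inner f' u)^*%C.
Proof.
move=> [hf [g [hg Hu]]] [hf' [g' [hg' Hv]]].
have [L2u L2g] := H10_L2 hg; have [L2v L2g'] := H10_L2 hg'.
by rewrite -(Hu _ _ hg') -(Hv _ _ hg) form_conj.
Qed.

Lemma operator_rsym u f v f' : operator u f -> operator v f' ->
  rinner f v = rinner f' u.
Proof. by move=> hu hv; rewrite /rinner (operator_sym hu hv) cReJ. Qed.

Lemma operator_ge0 u f : operator u f -> 0 <= rinner f u.
Proof.
move=> [hf [g [hg Hu]]]; have [L2u L2g] := H10_L2 hg.
by rewrite /real_inner -(Hu _ _ hg); case: rform_psd => _ _; exact.
Qed.

Lemma eigenvalue_ge0 (s : R) u : operator u (fun x => s%:C%C * u x) ->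
  0 < rinner u u -> 0 <= s.
Proof.
move=> hu u0; have [Lu _] := operator_L2 hu.
have := operator_ge0 hu; rewrite /real_inner (innerZ mD mb lo0 bb)// cReM /= mul0r subr0.
by rewrite pmulr_lge0.
Qed.

(** Equations derived from the form hold up to null vectors. The weak equation sees the image only
    through its products, so the image may be replaced by an equivalent function. *)
Lemma operator_ae u f f' : operator u f -> L2 D f' ->
  (forall w, L2 D w -> inner f w = inner f' w) -> operator u f'.
Proof.
move=> [hf [g [hg Hu]]] hf' ff'; split=> //; exists g; split=> // v h hv.
by rewrite (Hu _ _ hv) ff'//; case: (H10_L2 hv).
Qed.

(** Here u = (A + 1)^-1 v. The form E of A + 1 satisfies E(u, w) = <v, w>, so E(u + t v, u + t v) >=
    0 reads <u, v> + 2 t |v|^2 + t^2 E(v, v) >= 0, with E(v, v) <= (1 + c) |v|^2. The value t = -1 /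
    (1 + c) gives the bound. *)
Lemma operator_rayleigh (c : R) u v h : 0 <= c ->
  operator u (fun x => -1 * u x + v x) -> H10 D v h ->
  rform h h <= c * rinner v v -> rinner v v / (1 + c) <= rinner u v.
Proof.
move=> c0 hop hv hc; have [Lu Lf] := operator_L2 hop.
have [Lv Lh] := H10_L2 hv; move: hop => [_ [g [hg Hu]]].
have [_ Lg] := H10_L2 hg.
have fE (w : E -> R[i]) : L2 D w ->
    Re (inner (fun x => -1 * u x + v x) w) = - rinner u w + rinner v w.
  by move=> Lw; rewrite (inner_comb mD mb lo0 bb)// mulN1r !cplxE.
have E1 : rform g h = - rinner u v + rinner v v by rewrite /rform (Hu _ _ hv) fE.
have E2 : rform g g = - rinner u u + rinner v u by rewrite /rform (Hu _ _ hg) fE.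
have c1 : 0 < 1 + c by rewrite ltr_pwDl.
pose t := - (1 + c)^-1.
have vK (r : R) g1 g2 : (forall j, L2 D (g1 j)) -> (forall j, L2 D (g2 j)) ->
   (forall j, L2 D (vcomb r g1 g2 j)) by move=> ? ? j; exact: L2c.
have := psd_sqr vK t rform_psd Lh Lg.
have := psd_sqr L2c t psd Lv Lu.
have := r0 (L2c t Lv Lu); case: rform_psd => fC _ f0.
have := f0 _ (vK t _ _ Lh Lg).
rewrite (fC h g)// E1 E2 (rC Lv Lu) => p1 p2 e1 e2.
have p3 : t ^+ 2 * rform h h <= t ^+ 2 * (c * rinner v v) by rewrite ler_wpM2l ?sqr_ge0.
have p4 : 0 <= rinner u v + 2 * t * rinner v v + t ^+ 2 * ((1 + c) * rinner v v).
  rewrite e2 in p1; rewrite e1 in p2; lra.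
have : t ^+ 2 * ((1 + c) * rinner v v) = - t * rinner v v.
  by rewrite /t; field; rewrite gt_eqF.
by move: p4 => /[swap] ->; rewrite /t mulrC; lra.
Qed.

Hypothesis disc : purely_discrete_spectrum D a b.

(** By discreteness a spectral point has an eigenfunction that is not null; at -1 its energy would
    be negative. *)
Lemma resolvent_m1 : resolvent_set D a b (-1).
Proof.
apply: contrapT => /disc [_ [k k0 [w [hw wfree _]]]].
case: k k0 w hw wfree => // k _ w hw wfree.
have := hw ord0; rewrite /eigenspace /= => op.
have [Lw _] := operator_L2 op.
have := operator_ge0 op; rewrite /real_inner (innerZ mD mb lo0 bb)// mulN1r cReN oppr_ge0.
rewrite -[X in X <= 0]/(rinner _ _) => h.
have w0 : rinner (w ord0) (w ord0) = 0 by apply/eqP; rewrite eq_le h r0.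
have /wfree/(_ ord0) : ae_eq_on D (fun x => \sum_(i < k.+1) (i == ord0)%:R * w i x) (fun=> 0).
  rewrite (_ : (fun x => _) = w ord0); first exact: (rinner_eq0_ae mD mb lo0 bb).
  apply/funext => x; rewrite (bigD1 ord0)//= ?eqxx mul1r big1 ?addr0// => i /negbTE ->.
  by rewrite mul0r.
by move/eqP; rewrite eqxx oner_eq0.
Qed.

Theorem eigenvector_below (I : Type) (W : I -> E -> R[i]) (s : I -> R) (c : R) u0 h :
  0 <= c -> (forall i, operator (W i) (fun x => (s i)%:C%C * W i x)) ->
  (forall i, 0 <= s i) ->
  H10 D u0 h -> (forall i, inner u0 (W i) = 0) -> 0 < rinner u0 u0 ->
  rform h h <= c * rinner u0 u0 ->
  exists2 z : R, z <= c & exists2 v, operator v (fun x => z%:C%C * v x) &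
    0 < rinner v v /\ forall i, inner v (W i) = 0.
Proof.
move=> c0 opW s0 hu0 orth u00 ray.
have [_ [C1 res1]] := resolvent_m1.
(* [T] is a total function; outside L^2 its value is arbitrary. *)
have /choice[T opT] : forall f, exists u, L2 D f -> operator u (fun x => -1 * u x + f x).
  move=> f; have [/res1[u op _]|nf] := pselect (L2 D f); first by exists u.
  by exists f.
have LT f : L2 D f -> L2 D (T f) by move=> /opT /operator_L2[].
have LW i : L2 D (W i) by case: (operator_L2 (opW i)).
have fE (u v w : E -> R[i]) : L2 D u -> L2 D v -> L2 D w ->
    rinner (fun x => -1 * u x + v x) w = - rinner u w + rinner v w.
  by move=> Lu Lv Lw; rewrite /real_inner (inner_comb mD mb lo0 bb)// mulN1r !cplxE.
have Ts u v : L2 D u -> L2 D v -> rinner (T u) v = rinner u (T v).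
  move=> Lu Lv; have := operator_rsym (opT _ Lu) (opT _ Lv).
  rewrite !fE ?(rC (LT _ Lv) (LT _ Lu)); try exact: LT; try by [].
  by move/addrI => ->; rewrite rC//; exact: LT.
have Tb u : L2 D u -> rinner (T u) (T u) <= rinner (T u) u.
  move=> Lu; have := operator_ge0 (opT _ Lu); rewrite fE; try exact: LT; try by [].
  by rewrite (rC Lu (LT _ Lu)); lra.
have Tb2 u : L2 D u -> 0 <= rinner (T u) u <= rinner u u.
  move=> Lu; have LTu := LT _ Lu; have h1 := Tb _ Lu; have h2 := r0 LTu.
  apply/andP; split; first exact: le_trans h1.
  have := r0 (L2c (-1) LTu Lu); rewrite (psd_sqr L2c _ psd)//; lra.
pose K u := L2 D u /\ forall i, inner u (W i) = 0.
have KL u : K u -> L2 D u by case.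
have combK t u v : K u -> K v -> K (rcomb t u v).
  move=> [Lu Ou] [Lv Ov]; split; first exact: L2c.
  by move=> i; rewrite (inner_comb mD mb lo0 bb)// Ou Ov mulr0 addr0.
have KT u : K u -> K (T u).
  move=> [Lu Ou]; split; first exact: LT.
  (* Symmetry against the eigenfunction gives (1 + s i) <T u, W i> = <u, W i> = 0, and 1 + s i >
     0. *)
  move=> i; have := operator_sym (opT _ Lu) (opW i).
  have LTu := LT _ Lu.
  rewrite (inner_comb mD mb lo0 bb)// Ou addr0 mulN1r (innerZ mD mb lo0 bb)//.
  rewrite (inner_conj mD mb lo0 bb (LW i) LTu); set X := inner _ _ => e.
  have : (1 + (s i)%:C)%C * X = 0.
    have := congr1 (@complex.Re R) e; have := congr1 (@complex.Im R) e.
    rewrite !cplxE /= => e1 e2.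
    by apply: complex_eqP; rewrite !cplxE /=; lra.
  move/eqP; rewrite mulf_eq0 => /orP[|/eqP//].
  by rewrite eq_complex /= gt_eqF// ltr_pwDl.
have Kpsd : psd_form (@rcomb R n) K rinner by exact: (rinner_psd mD mb lo0 bb KL).
(* With z = 1 / t - 1, the vector v = T u solves (A - z) v = f for f = u - v / t, and f = -(T - t)u
   / t. Bounding |v| by |f| therefore bounds u = f + v / t by |(T - t)u|. *)
have bbelow (t : R) : 0 < t -> resolvent_set D a b ((t^-1 - 1)%:C)%C ->
    bounded_below (@rcomb R n) K rinner T t.
  move=> t0 [_ [C res]]; set z := t^-1 - 1.
  set y := t^-1; have y0 : 0 < y by rewrite invr_gt0.
  exists ((2 + 2 * `|C| * y ^+ 2) * y ^+ 2).
    apply: mulr_gt0; last exact: exprn_gt0.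
    by rewrite ltr_pwDl// mulr_ge0 ?sqr_ge0// mulr_ge0.
  move=> u [Lu _]; pose v := T u; have Lv := LT _ Lu.
  pose f := rcomb (- y) v u; have Lf : L2 D f by exact: L2c.
  have opv : operator v (fun x => z%:C%C * v x + f x).
    have := opT _ Lu; congr (operator _ _); apply/funext => x.
    by apply: complex_eqP; rewrite /f /rcomb /z /y !cplxE /=; ring.
  have [v' opv' hv'] := res _ Lf.
  have Lv' : L2 D v' by case: (operator_L2 opv').
  have dual y1 w (r : E -> R[i]) : operator y1 (fun x => z%:C%C * y1 x + w x) -> L2 D w ->
      operator r (fun x => z%:C%C * r x + f x) -> rinner f y1 = rinner w r.
    move=> opy Lw opr; have [Ly _] := operator_L2 opy; have [Lr _] := operator_L2 opr.
    have := operator_rsym opr opy.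
    rewrite -[X in rinner X _]/(rcomb z r f) -[X in _ = rinner X _]/(rcomb z y1 w) !rl//.
    by rewrite (rC Lr Ly) => /addrI.
  (* the solution of the resolvent equation is unique, since by symmetry its
     products with all [w] are determined by the data *)
  have vv' : rinner v v = rinner v' v'.
    have ort w : L2 D w -> rinner w v = rinner w v'.
      move=> Lw; have [y1 opy _] := res _ Lw.
      by rewrite -(dual _ _ _ opy Lw opv) -(dual _ _ _ opy Lw opv').
    by rewrite (ort _ Lv) (rC Lv Lv') (ort _ Lv').
  have Nv : rinner v v <= `|C| * rinner f f.
    rewrite vv'; apply: le_trans hv' _.
    by rewrite ler_wpM2r ?ler_norm//; exact: r0.
  have Nf : rinner f f = y ^+ 2 * rinner (rcomb (- t) u v) (rcomb (- t) u v).
    rewrite /f !(psd_sqr L2c _ psd)// (rC Lu Lv) /y; field.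
    by rewrite gt_eqF.
  have Nu : rinner u u <= 2 * rinner f f + 2 * y ^+ 2 * rinner v v.
    have := r0 (L2c (- y) Lv Lf); rewrite (psd_sqr L2c _ psd)// (rC Lv Lf) rl//.
    by rewrite {2 3 4}/f (psd_sqr L2c _ psd)// (rC Lu Lv); lra.
  apply: (@le_trans _ _ ((2 + 2 * `|C| * y ^+ 2) * rinner f f)); last by rewrite Nf mulrA.
  have := ler_wpM2l (sqr_ge0 y) Nv; lra.
have Ku0 : K u0 by split=> //; case: (H10_L2 hu0).
have tau0 : 0 < (1 + c)^-1 by rewrite invr_gt0 ltr_pwDl.
have alt t : (1 + c)^-1 <= t -> bounded_below (@rcomb R n) K rinner T t \/
    exists2 dl, 0 < dl &
      forall t', 0 < `|t' - t| < dl -> bounded_below (@rcomb R n) K rinner T t'.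
  move=> tt; have t0 : 0 < t by exact: lt_le_trans tt.
  have [sp|/contrapT res] := pselect (spectrum D a b ((t^-1 - 1)%:C)%C); last first.
    by left; exact: bbelow.
  right; have [[dl dl0 iso] _] := disc sp.
  (* The first bound gives t' > t / 2, and with the second |1 / t' - 1 / t| = |t - t'| / (t t') <
     dl, the isolation radius at 1 / t - 1. *)
  exists (Num.min (t / 2) (dl * t ^+ 2 / 2)).
    by rewrite lt_min divr_gt0// divr_gt0// mulr_gt0// exprn_gt0.
  move=> t' /andP[n0]; rewrite lt_min => /andP[h1 h2].
  have t'0 : t / 2 < t' by move: h1; rewrite ltr_norml => /andP[]; lra.
  have t'p : 0 < t' by apply: lt_trans t'0; rewrite divr_gt0.
  apply: bbelow => //; apply: contrapT => sp'.
  have := iso _ sp'.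
  rewrite /abs2 !cplxE /= subrr expr0n addr0.
  have -> : t'^-1 - 1 - (t^-1 - 1) = (t - t') / (t * t').
    by field; rewrite !gt_eqF.
  have -> : ((t - t') / (t * t')) ^+ 2 < dl ^+ 2.
    rewrite -real_normK ?num_real// ltrXn2r ?nnegrE ?normr_ge0 ?(ltW dl0)//.
    rewrite normrM normfV distrC (ger0_norm (ltW (mulr_gt0 t0 t'p))).
    rewrite ltr_pdivrMr ?mulr_gt0//; apply: (lt_trans h2).
    rewrite -mulrA ltr_pM2l// expr2 -mulrA ltr_pM2l//.
  move/(_ isT)/complexI/addIr/invr_inj => e.
  by move: n0; rewrite e subrr normr0 ltxx.
have [||||t tt [u Ku [u1 u2]]] :=
  @top_eigenvector R _ (@rcomb R n) K rinner T combK Kpsd KT _ _ _ (1 + c)^-1 u0 tau0 Ku0 u00 _ alt.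
- by move=> u v /KL Lu /KL Lv; exact: Ts.
- by move=> u /KL; exact: Tb2.
- exact: (orthogonal_complete mD mb lo0 bb LW).
- rewrite mulrC; apply: (operator_rayleigh c0 (opT _ (KL _ Ku0)) hu0 ray).
have t0 : 0 < t by exact: lt_le_trans tt.
have Lu := KL _ Ku; have Lv := LT _ Lu.
exists (t^-1 - 1).
  rewrite lerBlDr addrC -(invrK (1 + c)) lef_pV2// ?posrE//.
have vE w : L2 D w -> inner (T u) w = (t%:C)%C * inner u w.
  move=> Lw; have := inner_eq0 mD mb lo0 bb (L2c (- t) Lu Lv) Lw u2.
  rewrite (inner_comb mD mb lo0 bb)// => e.
  apply/eqP; rewrite -subr_eq0 addrC -e; apply/eqP.
  by apply: complex_eqP; rewrite !cplxE /=; ring.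
have rvE w : L2 D w -> rinner (T u) w = t * rinner u w.
  by move=> Lw; rewrite /real_inner vE// !cplxE /= mul0r subr0.
(* [u] satisfies T u = t u only up to a null vector and is not known to lie in the domain of the
   operator; [T u] does. *)
exists (T u); last first.
  split; last by case: (KT _ Ku).
  by rewrite rvE// (rC Lu Lv) rvE// mulrA mulr_gt0// mulr_gt0.
apply: (operator_ae (opT _ Lu)); first exact: L2Z.
move=> w Lw; rewrite (inner_comb mD mb lo0 bb)// (innerZ mD mb lo0 bb)// vE//.
by apply: complex_eqP; rewrite !cplxE /=; field; rewrite gt_eqF.
Qed.

End discrete_operator.

Lemma row_kernel_neq0 (F : fieldType) k (A : 'M[F]_(k.+1, k)) :
  exists2 c : 'I_k.+1 -> F, exists j, c j != 0 & forall i, \sum_j c j * A j i = 0.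
Proof.
have : kermx A != 0.
  rewrite -mxrank_eq0 mxrank_ker -lt0n subn_gt0.
  by rewrite (leq_ltn_trans (rank_leq_col A)).
case/rowV0Pn => v /sub_kermxP vA v0.
exists (v 0).
  by apply/existsP; apply: contraNT v0 => /existsPn h;
    apply/eqP/rowP => j; rewrite mxE; apply/eqP; rewrite -[_ == _]negbK.
by move=> i; have /rowP/(_ i) := vA; rewrite !mxE.
Qed.

(** * Counting eigenvalues with multiplicity *)

Section counting.
Context {R : realType} {n : nat}.
Local Notation E := 'rV[R]_n.
Variable D : set E.
Hypothesis mD : measurable D.
Variables (a : E -> R) (alo ahi : R).
Hypothesis ma : measurable_fun D a.
Hypothesis alo0 : 0 < alo.
Hypothesis ab : forall x, D x -> alo <= a x <= ahi.
Variables (b : E -> R) (lo hi : R).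
Hypothesis mb : measurable_fun D b.
Hypothesis lo0 : 0 < lo.
Hypothesis bb : forall x, D x -> lo <= b x <= hi.
Local Notation inner := (weighted_inner D b).
Local Notation rinner := (real_inner D b).
Local Notation operator := (operator D a b).
Variable lam : nat -> R.
Hypothesis hlam : eigenvalue_sequence D a b lam.

(** The indices with [lam i = z] are in bijection with a basis of the eigenspace at [z], so each
    index picks one basis vector. If z < lam k, monotonicity puts all these indices below [k], and
    the first [k] vectors span that eigenspace; if there are none, the eigenspace is trivial. *)
Lemma eigenvalue_sequence_basis : exists W : nat -> E -> R[i],
  (forall i, operator (W i) (fun x => (lam i)%:C%C * W i x) /\ 0 < rinner (W i) (W i)) /\
  forall k (z : R), z < lam k -> forall u, operator u (fun x => z%:C%C * u x) ->
    exists c : 'I_k -> R[i], ae_eq_on D u (fun x => \sum_(i < k) c i * W i x).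
Proof.
have [homo dim] := hlam.
have /choice[k hk] : forall z : R, exists k, has_dimension D (Defs.eigenspace D a b z%:C%C) k /\
    ([set i | (lam i)%:C%C = z%:C%C] #= `I_k)%card.
  by move=> z; have [k ? ?] := dim z%:C%C; exists k.
have /choice[f hf] : forall z : R, exists f : nat -> nat,
    set_bij [set i | (lam i)%:C%C = z%:C%C] `I_(k z) f.
  by move=> z; have [_ /card_set_bijP] := hk z.
pose w z := sval (cid (proj1 (hk z))).
have hw z : [/\ forall i, Defs.eigenspace D a b z%:C%C (w z i),
    forall c : 'I_(k z) -> R[i],
      ae_eq_on D (fun x => \sum_(i < k z) c i * w z i x) (fun=> 0) -> forall i, c i = 0 &
    forall u, Defs.eigenspace D a b z%:C%C u -> exists c : 'I_(k z) -> R[i],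
      ae_eq_on D u (fun x => \sum_(i < k z) c i * w z i x)].
  exact: (svalP (cid (proj1 (hk z)))).
have fk i : (f (lam i) i < k (lam i))%N.
  by have [+ _ _] := hf (lam i); apply.
pose W i := w (lam i) (Ordinal (fk i)).
exists W; split=> [i|K z zK u hu].
  have [+ wfree _] := hw (lam i) => /(_ (Ordinal (fk i))) op; split=> //.
  have [Lw _] := operator_L2 op.
  have [_ _ r0] := rinner_psd mD mb lo0 bb (K := L2 D) (fun u hu => hu).
  rewrite lt_neqAle r0// andbT; apply/eqP => /esym w0.
  have /wfree/(_ (Ordinal (fk i))) : ae_eq_on D (fun x =>
      \sum_(j < k (lam i)) (j == Ordinal (fk i))%:R * w (lam i) j x) (fun=> 0).
    rewrite (_ : (fun x => _) = W i); first exact: (rinner_eq0_ae mD mb lo0 bb).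
    apply/funext => x; rewrite (bigD1 (Ordinal (fk i)))//= ?eqxx mul1r.
    rewrite big1 ?addr0// => j /negbTE ->.
    by rewrite mul0r.
  by move/eqP; rewrite eqxx oner_eq0.
have [_ _ /(_ _ hu)[c hc]] := hw z.
have [_ _ fsurj] := hf z.
have /choice[g hg] : forall p : 'I_(k z), exists i : 'I_K, lam i = z /\ f z i = p.
  move=> p; have [i /= /complexI iz fp] := fsurj p (ltn_ord p).
  have iK : (i < K)%N.
    by rewrite ltnNge; apply/negP => /homo; rewrite iz leNgt zK.
  by exists (Ordinal iK).
(* [g] inverts the enumeration. Collecting coefficients over its fibres turns the sum over basis
   vectors into one over indices, with 0 at the indices not reached. *)
exists (fun i => \sum_(p < k z | g p == i) c p).
apply: filterS hc => x /= h Dx; rewrite h//.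
rewrite (partition_big g xpredT)//=; apply: eq_bigr => i _.
rewrite mulr_suml; apply: eq_bigr => p /eqP gp; congr (_ * _).
have [lz fp] := hg p; rewrite gp in lz fp; rewrite /W.
move: (fk i); rewrite lz => fk'; congr (w z _ x).
by apply: val_inj => /=; rewrite fp.
Qed.

Lemma eigenvalue_sequence_ge0 i : 0 <= lam i.
Proof.
have [W [/(_ i)[op W0] _]] := eigenvalue_sequence_basis.
exact: (eigenvalue_ge0 mD ma alo0 ab mb lo0 bb op W0).
Qed.

(** There are k + 1 functions because [lam] is indexed from 0: the [k] orthogonality conditions
    against W 0, ..., W (k - 1) leave a nonzero combination. *)
Theorem eigenvalue_sequence_le (k : nat) (c : R) (phi : 'I_k.+1 -> E -> R[i]) :
  purely_discrete_spectrum D a b -> 0 <= c ->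
  (forall cf : 'I_k.+1 -> R[i], (exists j, cf j != 0) ->
     let u := fun x => \sum_j cf j * phi j x in
     exists h, [/\ H10 D u h, 0 < rinner u u & rform D a h h <= c * rinner u u]) ->
  lam k <= c.
Proof.
move=> disc c0 ray.
have Lphi j : L2 D (phi j).
  have [|h [/H10_L2[+ _] _ _]] := ray (fun i => (i == j)%:R).
    by exists j; rewrite eqxx oner_eq0.
  congr (L2 D _); apply/funext => x.
  rewrite (bigD1 j)//= eqxx mul1r big1 ?addr0// => i /negbTE ->.
  by rewrite mul0r.
rewrite leNgt; apply/negP => ck.
have [W [opW span]] := eigenvalue_sequence_basis.
have LW i : L2 D (W i) by have [/operator_L2[]] := opW i.
have [cf cf0 hcf] := row_kernel_neq0 (\matrix_(j < k.+1, i < k) inner (phi j) (W i)).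
have [h [hh u0 hr]] := ray cf cf0; set u := (fun x => _) in hh u0 hr.
have orth (i : 'I_k) : inner u (W i) = 0.
  rewrite /u (inner_sum mD mb lo0 bb)//; have := hcf i.
  by under eq_bigr do rewrite mxE.
have [z zc [v opv [v0 ov]]] := eigenvector_below mD ma alo0 ab mb lo0 bb disc
  (I := 'I_k) (W := fun i => W i) (s := fun i => lam i) c0
  (fun i => proj1 (opW i)) (fun i => eigenvalue_sequence_ge0 i) hh orth u0 hr.
(* The eigenvalue of [v] is below [lam k], so [v] is a combination of the very functions it is
   orthogonal to, and its norm is 0. *)
have [d hd] := span k z (le_lt_trans zc ck) _ opv.
have [Lv _] := operator_L2 opv.
have Ls : L2 D (fun x => \sum_(i < k) d i * W i x).
  by apply: L2_sum => // i; exact: L2Z.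
have := ae_eq_inner mD mb lo0 bb Lv Ls Lv hd.
rewrite (inner_sum mD mb lo0 bb)//.
rewrite big1 => [e|i _]; first by move: v0; rewrite /real_inner e ltxx.
by rewrite (inner_conj mD mb lo0 bb)// ov conjc0 mulr0.
Qed.

End counting.

(** * Test functions on the cells *)

Section shells.
Context {R : realType} {n : nat}.
Local Notation E := 'rV[R]_n.
Local Notation mu := (@row_lebesgue_measure R n).
Local Notation Re := complex.Re.
Local Notation Im := complex.Im.
Local Notation kappa := (unit_ball_volume n : R).
Implicit Types (x : E).

Lemma abs2M (z w : R[i]) : abs2 (z * w) = abs2 z * abs2 w.
Proof. by rewrite /abs2 !cplxE; ring. Qed.

Lemma abs2_real (r : R) : abs2 r%:C%C = r ^+ 2.
Proof. by rewrite /abs2 /= expr0n addr0. Qed.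

Lemma abs2_ge0 (z : R[i]) : 0 <= abs2 z.
Proof. by rewrite addr_ge0 ?sqr_ge0. Qed.

Lemma abs2_gt0 (z : R[i]) : z != 0 -> 0 < abs2 z.
Proof.
rewrite lt_neqAle abs2_ge0 andbT; apply: contraNN.
rewrite eq_sym paddr_eq0 ?sqr_ge0// !sqrf_eq0 => /andP[/eqP ? /eqP ?].
by apply/eqP; exact: complex_eqP.
Qed.

Lemma abs2_sum_single (I : finType) (F : I -> R[i]) i0 :
  (forall i, i != i0 -> F i = 0) -> abs2 (\sum_i F i) = \sum_i abs2 (F i).
Proof.
move=> F0; rewrite (bigD1 i0)//= big1 ?addr0// (bigD1 i0)//= big1 ?addr0// => i /F0 ->.
by rewrite /abs2 /= expr0n addr0.
Qed.

Lemma Re_sum (I : Type) (s : seq I) (F : I -> R[i]) :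
  Re (\sum_(i <- s) F i) = \sum_(i <- s) Re (F i).
Proof. by elim/big_ind2: _ => // x1 x2 y1 y2 <- <-; rewrite cReD. Qed.

Lemma Im_sum (I : Type) (s : seq I) (F : I -> R[i]) :
  Im (\sum_(i <- s) F i) = \sum_(i <- s) Im (F i).
Proof. by elim/big_ind2: _ => // x1 x2 y1 y2 <- <-; rewrite cImD. Qed.

Lemma Rintegral_sum_indic (D : set E) k (c : 'I_k -> R) (A : 'I_k -> set E) (v : R) :
  measurable D -> (forall i, measurable (A i)) -> (forall i, A i `<=` D) ->
  (forall i, mu (A i) = v%:E) ->
  mu.-integrable D (EFin \o (fun x => \sum_i c i * \1_(A i) x)) /\
  (\int[mu]_(x in D) (\sum_i c i * \1_(A i) x))%R = (\sum_i c i) * v.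
Proof.
move=> mD mA AD muA.
suff [ii ->] : mu.-integrable D (EFin \o (fun x => \sum_i c i * \1_(A i) x)) /\
  (\int[mu]_(x in D) (\sum_i c i * \1_(A i) x))%R = \sum_i c i * v.
  by rewrite mulr_suml.
elim: (index_enum _) => [|i s [i1 i2]].
  rewrite (_ : (fun x => _) = fun=> 0); last by apply/funext => x; rewrite big_nil.
  by rewrite big_nil /Rintegral integral0; split=> //; exact: integrable0.
have iA : mu.-integrable D (EFin \o \1_(A i)).
  have : (mu (A i) < +oo)%E by rewrite muA ltry.
  exact: integrable_indic_lty.
rewrite (_ : (fun x => _) = (fun x => c i * \1_(A i) x +
    1 * \sum_(i <- s) c i * \1_(A i) x)); last first.
  by apply/funext => x; rewrite big_cons mul1r.
split; first exact: integrable_comb.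
rewrite Rintegral_comb// mul1r i2 big_cons; congr (_ * _ + _).
rewrite /Rintegral integral_indic// setIidl//.
by have /= -> := muA i.
Qed.

Variable D : set E.
Hypothesis mD : measurable D.
Variables (a : E -> R) (alo ahi : R).
Hypothesis ma : measurable_fun D a.
Hypothesis alo0 : 0 < alo.
Hypothesis ab : forall x, D x -> alo <= a x <= ahi.
Variables (b : E -> R) (lo hi : R).
Hypothesis mb : measurable_fun D b.
Hypothesis lo0 : 0 < lo.
Hypothesis bb : forall x, D x -> lo <= b x <= hi.
Variables (k : nat) (c : 'I_k.+1 -> E) (s d alpha beta : R).
Hypothesis d0 : 0 < d.
Hypothesis ds : d <= s / 2.
Hypothesis alpha0 : 0 < alpha.
Hypothesis beta0 : 0 < beta.
Hypothesis ballD : forall j x, sqdist (c j) x <= s ^+ 2 -> D x.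
Hypothesis disj : forall i j x, i != j -> sqdist (c i) x < s ^+ 2 -> s ^+ 2 <= sqdist (c j) x.
Hypothesis a_shell : forall j x, (s - d) ^+ 2 < sqdist (c j) x < s ^+ 2 -> a x = alpha.
Hypothesis b_core : forall j x, sqdist (c j) x < (s - d) ^+ 2 -> b x = beta.

Let s0 : 0 < s. Proof. by move: d0 ds; lra. Qed.
Let ds' : d < s. Proof. by move: d0 ds; lra. Qed.
Let sd0 : 0 < s - d. Proof. by rewrite subr_gt0. Qed.

Variable cf : 'I_k.+1 -> R[i].
Local Notation p := (@bump_height R).
Let phi j : E -> R := radial_bump (c j) s d.
Definition bump_sum x : R[i] := \sum_j cf j * (phi j x)%:C%C.

Let M := \sum_j abs2 (cf j).

Let flat_phi j : flat_elementary (phi j).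
Proof. exact: radial_bump_flat. Qed.

Lemma bump_sum_test : test_function D bump_sum.
Proof.
have fs (r : 'I_k.+1 -> R) : smooth (fun x => \sum_j r j * phi j x).
  apply: flat_elementary_smooth; elim: (index_enum _) => [|j t ih].
    rewrite (_ : (fun x => _) = fun=> 0); first exact: flat_cst.
    by apply/funext => x; rewrite big_nil.
  rewrite (_ : (fun x => _) = fun x => r j * phi j x + \sum_(j <- t) r j * phi j x).
    by apply: flat_add => //; apply: flat_mul => //; exact: flat_cst.
  by apply/funext => x; rewrite big_cons.
split.
- rewrite (_ : (fun x => _) = fun x => \sum_j Re (cf j) * phi j x) //.
  apply/funext => x; rewrite Re_sum; apply: eq_bigr => j _.
  by rewrite !cplxE /= mulr0 subr0.
- rewrite (_ : (fun x => _) = fun x => \sum_j Im (cf j) * phi j x) //.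
  apply/funext => x; rewrite Im_sum; apply: eq_bigr => j _.
  by rewrite !cplxE /= mulr0 add0r.
- exists (\big[setU/set0]_(j < k.+1) [set x | sqdist (c j) x <= s ^+ 2]); split.
  + by apply: bigsetU_compact => j _; exact: compact_sqdist_le.
  + by rewrite -bigcup_seq => x [j _ /=]; exact: ballD.
  + move=> x nx; rewrite /bump_sum big1// => j _; rewrite /phi radial_bump_out ?mulr0//.
    rewrite leNgt; apply/negP => h; apply: nx; rewrite -bigcup_seq; exists j => /=.
      by rewrite mem_index_enum.
    exact: ltW.
Qed.

Lemma bump_sum_gradE l x : cgrad bump_sum l x = \sum_j cf j * (partial l (phi j) x)%:C%C.
Proof.
have pS (r : 'I_k.+1 -> R) : partial l (fun x => \sum_j r j * phi j x) x =
    \sum_j r j * partial l (phi j) x.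
  have dphi j : differentiable (fun x => r j * phi j x) x.
    apply: flat_elementary_differentiable; apply: flat_mul => //; exact: flat_cst.
  rewrite (_ : (fun x => _) = \sum_j (fun x => r j * phi j x)); last first.
    by apply/funext => y; rewrite fct_sumE.
  rewrite /partial derive_sum => [|j]; last exact: diff_derivable.
  apply: eq_bigr => j _; rewrite -/(partial _ _ _) partialM//; last first.
    exact: flat_elementary_differentiable.
  by rewrite partial_cst mulr0 addr0.
apply: complex_eqP; rewrite /= ?Re_sum ?Im_sum.
  rewrite (_ : (fun x => _) = fun x => \sum_j Re (cf j) * phi j x); last first.
    apply/funext => y; rewrite Re_sum; apply: eq_bigr => j _.
    by rewrite !cplxE /= mulr0 subr0.
  by rewrite pS; apply: eq_bigr => j _; rewrite !cplxE /= mulr0 subr0.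
rewrite (_ : (fun x => _) = fun x => \sum_j Im (cf j) * phi j x); last first.
  apply/funext => y; rewrite Im_sum; apply: eq_bigr => j _.
  by rewrite !cplxE /= mulr0 add0r.
by rewrite pS; apply: eq_bigr => j _; rewrite !cplxE /= mulr0 add0r.
Qed.

(** At most one bump is nonzero at a given point, so the squared moduli of the sum and of its
    gradient have no cross terms. If no ball contains the point, the index is arbitrary. *)
Let single x : exists j0 : 'I_k.+1, forall j, j != j0 -> s ^+ 2 <= sqdist (c j) x.
Proof.
have [[j0 h]|h] := pselect (exists j0, sqdist (c j0) x < s ^+ 2).
  by exists j0 => j jj; apply: (disj _ h); rewrite eq_sym.
exists ord0 => j _; rewrite leNgt; apply/negP => hj; apply: h; by exists j.
Qed.

Lemma abs2_bump_sum x : abs2 (bump_sum x) = \sum_j abs2 (cf j) * phi j x ^+ 2.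
Proof.
have [j0 hj] := single x.
rewrite /bump_sum (@abs2_sum_single _ _ j0) => [|j /hj h].
  by apply: eq_bigr => j _; rewrite abs2M abs2_real.
by rewrite /phi radial_bump_out// mulr0.
Qed.

Lemma abs2_bump_sum_grad l x :
  abs2 (cgrad bump_sum l x) = \sum_j abs2 (cf j) * partial l (phi j) x ^+ 2.
Proof.
have [j0 hj] := single x.
rewrite bump_sum_gradE (@abs2_sum_single _ _ j0) => [|j /hj h].
  by apply: eq_bigr => j _; rewrite abs2M abs2_real.
by rewrite /phi radial_bump_partial_out ?mulr0// negb_and -!leNgt h orbT.
Qed.

Let core j : set E := [set x | enorm (x - c j) < s - d].
(** Defined with the inner sphere included, so that its measure is a difference of volumes of
    balls. *)
Let shell j : set E := [set x | enorm (x - c j) < s] `\` core j.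

Let mball j r : measurable [set x | enorm (x - c j) < r].
Proof. by apply: open_row_measurable; exact: open_enorm_ball. Qed.

Let muball j r : 0 < r -> mu [set x | enorm (x - c j) < r] = (r ^+ n * kappa)%:E.
Proof. by move=> r_gt0; rewrite row_lebesgue_measure_ball// unit_ball_volumeE. Qed.

Let mushell j : mu (shell j) = ((s ^+ n - (s - d) ^+ n) * kappa)%:E.
Proof.
have sub : core j `<=` [set x | enorm (x - c j) < s].
  by move=> x /= h; apply: lt_le_trans h _; rewrite gerBl ltW.
have fin : (mu [set x | (enorm (x - c j) < s)%R] < +oo)%E by rewrite muball// ltry.
rewrite /shell (measureD (mball j s) (mball j (s - d)) fin) setIidr//.
transitivity ((s ^+ n * kappa)%:E - ((s - d) ^+ n * kappa)%:E)%E; last by rewrite -EFinB mulrBl.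
by congr (_ - _)%E; exact: muball.
Qed.

(** Only the cores are counted: there the bump equals its height and the weight is [beta]; elsewhere
    the integrand is nonnegative. *)
Lemma rinner_bump_sum_ge :
  M * (p ^+ 2 * beta * ((s - d) ^+ n * kappa)) <= real_inner D b bump_sum bump_sum.
Proof.
have Lu := test_function_L2 mD bump_sum_test.
rewrite -[leRHS]/(weighted_sqnorm D b bump_sum) weighted_sqnormE//.
have [|||i1 i2] := @Rintegral_sum_indic D k.+1
  (fun j => abs2 (cf j) * (p ^+ 2 * beta)) core ((s - d) ^+ n * kappa) mD.
- by move=> j; exact: mball.
- move=> j x /=; rewrite /core /= enormB_lt ?(ltW sd0)// => h; apply: (@ballD j).
  by rewrite (le_trans (ltW h))// lerXn2r ?nnegrE ?(ltW sd0) ?(ltW s0)// gerBl ltW.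
- by move=> j; exact: muball.
rewrite mulrA mulr_suml -i2.
apply: le_Rintegral => //.
  exact: (integrable_weight mD mb lo0 bb (integrable_abs2 mD Lu)).
move=> x Dx; rewrite abs2_bump_sum mulr_sumr; apply: ler_sum => j _.
have /andP[b1 _] := bb Dx.
have b0 : 0 <= b x by exact: le_trans (ltW lo0) b1.
rewrite [leRHS]mulrCA -[leLHS]mulrA ler_wpM2l ?abs2_ge0//.
have [h|h] := pselect (core j x); last first.
  by rewrite indicE memNset// mulr0 mulr_ge0// sqr_ge0.
rewrite indicE mem_set// mulr1 mulrC.
move: h; rewrite /core /= enormB_lt ?(ltW sd0)// => h.
by rewrite (b_core h) /phi radial_bump_core ?(ltW h).
Qed.

Lemma rform_bump_sum_le :
  rform D a (cgrad bump_sum) (cgrad bump_sum) <=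
  M * (alpha * (64 / d ^+ 2) * ((s ^+ n - (s - d) ^+ n) * kappa)).
Proof.
have Lg l := test_function_grad_L2 mD l bump_sum_test.
have E : rform D a (cgrad bump_sum) (cgrad bump_sum) =
    (\int[mu]_(x in D) (\sum_l a x * abs2 (cgrad bump_sum l x)))%R.
  apply: Rintegral_eq => x _; rewrite cReM /= mul0r subr0 Re_sum mulr_sumr.
  by apply: eq_bigr => l _; rewrite !cplxE /abs2; ring.
rewrite E.
have [|||i1 i2] := @Rintegral_sum_indic D k.+1
  (fun j => abs2 (cf j) * (alpha * (64 / d ^+ 2))) shell ((s ^+ n - (s - d) ^+ n) * kappa) mD.
- by move=> j; apply: measurableD; exact: mball.
- move=> j x [/=]; rewrite enormB_lt ?(ltW s0)// => /ltW h _; exact: (@ballD j).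
- by move=> j; exact: mushell.
rewrite mulrA mulr_suml -i2.
apply: le_Rintegral => //.
  elim: (index_enum _) => [|l t ih].
    rewrite (_ : (fun x => _) = fun=> 0); first exact: integrable0.
    by apply/funext => x; rewrite big_nil.
  rewrite (_ : (fun x => _) = 
      fun x => 1 * (a x * abs2 (cgrad bump_sum l x)) +
        1 * \sum_(l <- t) a x * abs2 (cgrad bump_sum l x)).
    apply: integrable_comb => //.
    exact: (integrable_weight mD ma alo0 ab (integrable_abs2 mD (Lg l))).
  by apply/funext => x; rewrite big_cons !mul1r.
move=> x Dx.
rewrite (_ : \sum_l _ = \sum_j abs2 (cf j) * (a x * \sum_l partial l (phi j) x ^+ 2)); last first.
  under eq_bigr do rewrite abs2_bump_sum_grad mulr_sumr.
  rewrite exchange_big; apply: eq_bigr => j _ /=.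
  by rewrite !mulr_sumr; apply: eq_bigr => l _; ring.
apply: ler_sum => j _; rewrite -mulrA ler_wpM2l ?abs2_ge0//.
have [h|h] := boolP ((s - d) ^+ 2 < sqdist (c j) x < s ^+ 2); last first.
  rewrite big1 => [|l _]; last by rewrite /phi radial_bump_partial_out// expr0n.
  by rewrite mulr0 !mulr_ge0// ?(ltW alpha0)// ?invr_ge0 ?sqr_ge0.
rewrite (a_shell h) indicE mem_set; last first.
  move/andP: h => [h1 h2]; split; rewrite /core /= enormB_lt ?(ltW s0) ?(ltW sd0)//.
  by apply/negP; rewrite -leNgt ltW.
rewrite mulr1 ler_pM2l//; exact: radial_bump_gradient_le.
Qed.

(** The factor alpha / (beta d^2) of the two estimates meets |shell| / |core| <= 2^n n d / s, and
    the product is 2^n q. *)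
Theorem bump_sum_rayleigh (q : R) : (exists j, cf j != 0) ->
  q = alpha * n%:R / (d * s * beta) ->
  0 < real_inner D b bump_sum bump_sum /\
  rform D a (cgrad bump_sum) (cgrad bump_sum) <=
    64 * 2 ^+ n / p ^+ 2 * q * real_inner D b bump_sum bump_sum.
Proof.
move=> [j0 cj0] qE.
have M0 : 0 < M.
  rewrite /M (bigD1 j0)//= ltr_pwDl ?abs2_gt0// sumr_ge0// => j _; exact: abs2_ge0.
have p0 : 0 < p by exact: bump_height_gt0.
have k0 := unit_ball_volume_gt0 R n.
have low := rinner_bump_sum_ge.
have lowp : 0 < M * (p ^+ 2 * beta * ((s - d) ^+ n * kappa)).
  by rewrite !mulr_gt0 ?exprn_gt0.
split; first exact: lt_le_trans low.
apply: (le_trans rform_bump_sum_le).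
have q0 : 0 <= q.
  by rewrite qE !mulr_ge0 ?invr_ge0 ?mulr_ge0 ?(ltW alpha0) ?(ltW d0) ?(ltW s0) ?(ltW beta0).
have C0 : 0 <= 64 * 2 ^+ n / p ^+ 2 * q.
  by rewrite mulr_ge0// divr_ge0 ?sqr_ge0// mulr_ge0// exprn_ge0.
apply: le_trans (ler_wpM2l C0 low).
(* The difference of powers factors into d times [n] terms, each at most s^(n - 1), which is written
   s^n / s to avoid truncated subtraction. *)
have sX : s ^+ n - (s - d) ^+ n <= d * (n%:R * s ^+ n / s).
  rewrite subrXX opprB addrC subrK ler_pM2l//.
  have -> : n%:R * s ^+ n / s = \sum_(i < n) s ^+ n / s.
    by rewrite sumr_const card_ord -[RHS]mulr_natl mulrA.
  apply: ler_sum => i _; rewrite ler_pdivlMr//.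
  have -> : s ^+ n = s ^+ (n.-1 - i) * s ^+ i * s.
    by rewrite -exprD subnK ?exprSr -?exprSr ?prednK//;
      [exact: leq_ltn_trans (ltn_ord i)|rewrite -ltnS prednK//; exact: leq_ltn_trans (ltn_ord i)].
  rewrite ler_pM2r// ler_pM// ?exprn_ge0 ?(ltW sd0) ?(ltW s0)//.
  by rewrite lerXn2r ?nnegrE ?(ltW sd0) ?(ltW s0)// gerBl ltW.
(* By d <= s / 2 one has s <= 2 (s - d): the core keeps a fraction 2^-n of the volume. *)
have sd : s ^+ n <= 2 ^+ n * (s - d) ^+ n.
  rewrite -exprMn lerXn2r ?nnegrE ?mulr_ge0 ?(ltW sd0) ?(ltW s0)//.
  move: ds; lra.
apply: (@le_trans _ _ (M * (alpha * (64 / d ^+ 2) * (d * (n%:R * s ^+ n / s) * kappa)))).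
  rewrite ler_pM2l// ler_wpM2l ?mulr_ge0 ?(ltW alpha0) ?invr_ge0 ?sqr_ge0//.
  by rewrite ler_pM2r.
apply: (@le_trans _ _ (M * (alpha * (64 / d ^+ 2) *
    (d * (n%:R * (2 ^+ n * (s - d) ^+ n) / s) * kappa)))).
  rewrite ler_pM2l// ler_wpM2l ?mulr_ge0 ?(ltW alpha0) ?invr_ge0 ?sqr_ge0//.
  rewrite ler_pM2r// ler_pM2l// ler_wpM2r ?invr_ge0 ?(ltW s0)//.
  by rewrite ler_wpM2l.
rewrite le_eqVlt; apply/orP; left; apply/eqP; rewrite qE; field.
by rewrite !gt_eqF.
Qed.

End shells.

(** [edist] is an infimum over the frontier, so a lower bound for it needs the frontier to be
    nonempty. Otherwise the set would be open and closed, contain a whole coordinate axis by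
    connectedness of the line, and be unbounded. *)
Lemma bounded_open_frontier (R : realType) (m : nat) (Omega : set 'rV[R]_m.+1) :
  open Omega -> bounded_set Omega -> Omega 0 -> frontier Omega !=set0.
Proof.
move=> oO [M [_ bO]] O0; apply/set0P/negP => /eqP f0.
have cO : closed Omega.
  move=> x cx; apply: contrapT => nOx.
  have : frontier Omega x by split=> // /interior_subset.
  by rewrite f0.
pose phi t : 'rV[R]_m.+1 := t *: delta_mx 0 0.
have cphi : continuous phi by move=> t; exact: differentiable_continuous.
have : phi @^-1` Omega = setT.
  have /connected_intervalP : is_interval [set: R] by [].
  apply.
  - by exists 0; rewrite /phi /= scale0r.
  - exists (phi @^-1` Omega); last by rewrite setTI.
    by move/continuousP: cphi; exact.
  - exists (phi @^-1` Omega); last by rewrite setTI.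
    by move/continuous_closedP: cphi; exact.
move=> /seteqP[_ /(_ (`|M| + 2) I)] /= Ot.
have h1 : M < `|M| + 1 by rewrite (le_lt_trans (ler_norm M))// ltrDl.
have := bO _ h1 _ Ot; apply/negP; rewrite -ltNge.
apply: lt_le_trans (coord_le_norm _ 0).
by rewrite !mxE eqxx /= mulr1 [ltRHS]ger0_norm ?addr_ge0// ltrD2l ltr1n.
Qed.

(** * Cells near the origin *)

Section cells.
Context {R : realType} {m : nat}.
Local Notation E := 'rV[R]_m.+1.
Variable m0 : (0 < m)%N.
Variables (Omega : set E) (rho : R) (d alpha beta : R -> R) (e r0 : R) (k : nat).
Hypothesis oO : open Omega.
Hypothesis fO : frontier Omega !=set0.
Hypothesis r0O : forall x : E, (forall l, `|x 0 l| < r0) -> Omega x.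
Hypothesis e0 : 0 < e.
Hypothesis hrho : 0 < rho < 1 / 2.
(** Room in the cube of half-side [r0]: e k for the farthest centre, e sqrt n for the admissibility
    distance, and e for the radius of the balls. *)
Hypothesis er0 : e * (k%:R + Num.sqrt m.+1%:R + 1) <= r0.
Hypothesis d0 : 0 < d e.
Hypothesis ds : d e <= rho * e / 2.
Hypothesis alpha0 : 0 < alpha e.
Hypothesis beta0 : 0 < beta e.

Let mO : measurable Omega. Proof. exact: open_row_measurable. Qed.

Let rho0 : 0 < rho. Proof. by case/andP: hrho. Qed.
Let s0 : 0 < rho * e. Proof. exact: mulr_gt0. Qed.
Let sd0 : 0 < rho * e - d e. Proof. by move: s0 ds; lra. Qed.
Let se : 2 * (rho * e) < e.
Proof. by case/andP: hrho => _ h; rewrite mulrA gtr_pMl//; lra. Qed.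

(** The cells are lined up along the first axis of the hyperplane, which exists because m > 0, that
    is, n >= 2. *)
Definition cell_index (j : nat) : 'I_m -> int := fun l => if val l == 0%N then j%:Z else 0.

Local Notation c j := (Defs.center e (cell_index j) : E).

Lemma cell_center_head j : c j 0 (lift ord_max (Ordinal m0)) = e * j%:R.
Proof. by rewrite mxE liftK. Qed.

Lemma cell_center_le j l : (j <= k)%N -> `|c j 0 l| <= e * k%:R.
Proof.
move=> jk; rewrite mxE; case: unliftP => [l' _|_]; last first.
  by rewrite normr0 mulr_ge0// ltW.
rewrite normrM (gtr0_norm e0) ler_wpM2l ?(ltW e0)// /cell_index.
case: ifP => _; last by rewrite normr0.
by rewrite ger0_norm ?ler0z// ler_nat.
Qed.

(** The first coordinates of two centres differ by at least [e], whereas the diameter 2 rho e is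
    smaller than [e]. *)
Lemma cell_disjoint i j x : i != j ->
  sqdist (c i) x < (rho * e) ^+ 2 -> (rho * e) ^+ 2 <= sqdist (c j) x.
Proof.
move=> ij hi; rewrite leNgt; apply/negP => hj.
have near p : sqdist (c p) x < (rho * e) ^+ 2 -> 
    `|x 0 (lift ord_max (Ordinal m0)) - e * p%:R| < rho * e.
  move=> h; rewrite -cell_center_head -[_ < _](@ltr_pXn2r _ 2)// ?nnegrE ?(ltW s0)//.
  by rewrite real_normK ?num_real// (le_lt_trans (sqr_coord_le_sqdist _ _ _)).
have := near _ hi; have := near _ hj; rewrite !ltr_norml => /andP[h1 h2] /andP[h3 h4].
have gap (p q : nat) : (p < q)%N -> e * p%:R + e <= e * q%:R.
  by move=> pq; rewrite -[X in _ + X]mulr1 -mulrDr ler_pM2l// natr1 ler_nat.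
by move: ij; rewrite neq_ltn => /orP[/gap|/gap] g; move: se; lra.
Qed.

Lemma cell_ball_sub j x : (j <= k)%N -> sqdist (c j) x <= (rho * e) ^+ 2 -> Omega x.
Proof.
move=> jk h; apply: r0O => l.
have h1 : `|x 0 l - c j 0 l| <= rho * e.
  rewrite -[_ <= _](@ler_pXn2r _ 2)// ?nnegrE ?(ltW s0)//.
  by rewrite real_normK ?num_real// (le_trans (sqr_coord_le_sqdist _ _ _)).
have h2 := cell_center_le l jk.
rewrite -[x 0 l](subrK (c j 0 l)) (le_lt_trans (ler_normD _ _))//.
apply: lt_le_trans er0; rewrite !mulrDr mulr1.
have : 0 <= e * Num.sqrt m.+1%:R by rewrite mulr_ge0 ?sqrtr_ge0// ltW.
by move: se s0; lra.
Qed.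

(** A frontier point lies outside the open domain, so one of its coordinates has size at least [r0],
    while those of the centre are at most e k. The difference r0 - e k is at least e (sqrt n +
    1). *)
Lemma cell_admissible j : (j <= k)%N -> admissible Omega e (cell_index j).
Proof.
move=> jk; split; first split.
- apply: r0O => l; apply: (le_lt_trans (cell_center_le l jk)).
  apply: lt_le_trans er0; rewrite ltr_pM2l// -addrA ltrDl.
  by rewrite ltr_wpDl// sqrtr_ge0.
- by rewrite mxE unlift_none.
rewrite /edist; apply: lb_le_inf.
  by have [y fy] := fO; exists (enorm (c j - y)); exists y.
move=> _ [y [_ ny] <-].
have [l hl] : exists l, r0 <= `|y 0 l|.
  apply: contrapT => nl; apply: ny; move/interior_id: (oO) => ->.
  apply: r0O => l; rewrite ltNge; apply/negP => h; by apply: nl; exists l.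
apply: le_trans (coord_le_enorm _ l); rewrite !mxE.
have h2 := cell_center_le l jk; rewrite mxE in h2.
rewrite -(normrN (_ - _)) opprB.
apply: (@le_trans _ _ (r0 - e * k%:R)).
  rewrite lerBrDr; apply: le_trans er0.
  have h4 : 0 <= e * Num.sqrt m.+1%:R by rewrite mulr_ge0 ?sqrtr_ge0// ltW.
  by rewrite !mulrDr mulr1; move: e0; lra.
apply: le_trans (lerB hl h2) _; exact: lerB_dist.
Qed.

Let measurable_two_valued (A : set E) (t : R) : open A ->
  measurable_fun Omega (fun x => if x \in A then t else 1).
Proof.
move=> oA; rewrite (_ : (fun x => _) = fun x => (t - 1) * \1_A x + 1).
  apply: measurable_funD => //; apply: measurable_funM => //.
  by apply: measurable_indic; exact: open_row_measurable.
by apply/funext => x; rewrite indicE; case: (x \in A); rewrite ?mulr1 ?mulr0 ?add0r ?subrK.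
Qed.

Let two_valued_bounds (A : set E) (t : R) x : 0 < t ->
  Num.min t 1 <= (if x \in A then t else 1) <= Num.max t 1.
Proof. by move=> t0; case: ifP => _; rewrite ge_min le_max lexx ?orbT. Qed.

Lemma eigenvalue_bounds (lam : nat -> R) :
  let a := acoef Omega rho d alpha e in let b := bcoef Omega rho d beta e in
  purely_discrete_spectrum Omega a b -> eigenvalue_sequence Omega a b lam ->
  0 <= lam k <= 64 * 2 ^+ m.+1 / @bump_height R ^+ 2 * qcoef m.+1 rho d alpha beta e.
Proof.
move=> a b disc hlam.
have ma : measurable_fun Omega a.
  apply: measurable_two_valued; apply: bigcup_open => i _.
  by apply: open_enorm_shell; exact: ltW.
have mb : measurable_fun Omega b.
  by apply: measurable_two_valued; apply: bigcup_open => i _; exact: open_enorm_ball.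
have alo0 : 0 < Num.min (alpha e) 1 by rewrite lt_min alpha0 ltr01.
have blo0 : 0 < Num.min (beta e) 1 by rewrite lt_min beta0 ltr01.
have ab x : Omega x -> Num.min (alpha e) 1 <= a x <= Num.max (alpha e) 1.
  by move=> _; exact: two_valued_bounds.
have bb x : Omega x -> Num.min (beta e) 1 <= b x <= Num.max (beta e) 1.
  by move=> _; exact: two_valued_bounds.
have jk (j : 'I_k.+1) : (j <= k)%N by rewrite -ltnS.
apply/andP; split.
  exact: (eigenvalue_sequence_ge0 mO ma alo0 ab mb blo0 bb hlam).
pose cc (j : 'I_k.+1) : E := c j.
have shellE (j : 'I_k.+1) x :
    (rho * e - d e) ^+ 2 < sqdist (cc j) x < (rho * e) ^+ 2 -> a x = alpha e.
  move=> h; rewrite /a /acoef ifT// inE; exists (cell_index j); first exact: cell_admissible.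
  by rewrite /shell /= enormB_gt ?(ltW sd0)// enormB_lt ?(ltW s0).
have coreE (j : 'I_k.+1) x : sqdist (cc j) x < (rho * e - d e) ^+ 2 -> b x = beta e.
  move=> h; rewrite /b /bcoef ifT// inE; exists (cell_index j); first exact: cell_admissible.
  by rewrite /core /= enormB_lt ?(ltW sd0).
have ballD (j : 'I_k.+1) x : sqdist (cc j) x <= (rho * e) ^+ 2 -> Omega x.
  exact: cell_ball_sub.
have disj (i j : 'I_k.+1) x : i != j -> sqdist (cc i) x < (rho * e) ^+ 2 ->
    (rho * e) ^+ 2 <= sqdist (cc j) x.
  by move=> ij; apply: cell_disjoint.
have qE : qcoef m.+1 rho d alpha beta e = alpha e * m.+1%:R / (d e * (rho * e) * beta e).
  by rewrite /qcoef; congr (_ / _); ring.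
apply: (@eigenvalue_sequence_le _ _ _ mO _ _ _ ma alo0 ab _ _ _ mb blo0 bb _ hlam k _
  (fun j x => (radial_bump (cc j) (rho * e) (d e) x)%:C%C)) => //.
- rewrite qE; apply: mulr_ge0; apply: divr_ge0; rewrite ?sqr_ge0 ?mulr_ge0 ?exprn_ge0
    ?(ltW alpha0) ?(ltW d0) ?(ltW rho0) ?(ltW e0) ?(ltW beta0)//.
- move=> cf cf0 u.
  have tu := bump_sum_test d0 ds ballD cf.
  have [u0 hu] := bump_sum_rayleigh mO ma alo0 ab mb blo0 bb d0 ds
    alpha0 beta0 ballD disj shellE coreE cf0 qE.
  exists (cgrad u); split=> //; exact: (test_function_H10 mO tu).
Qed.

End cells.

Theorem corollary2p1 (R : realType) (m : nat) (hn : (2 <= m.+1)%N)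
  (Omega : set 'rV[R]_m.+1)
  (hOmega : bounded_lipschitz_domain Omega) (hOmega0 : Omega 0)
  (rho : R) (hrho : 0 < rho < 1 / 2)
  (eps0 : R) (heps0 : 0 < eps0) (d alpha beta : R -> R)
  (hd : forall e : R, 0 < e < eps0 -> 0 < d e < rho * e)
  (hdo : d e / e @[e --> 0^'+] --> 0)
  (halpha : forall e : R, 0 < e < eps0 -> 0 < alpha e)
  (hbeta : forall e : R, 0 < e < eps0 -> 0 < beta e)
  (hdisc : forall e : R, 0 < e < eps0 ->
    purely_discrete_spectrum Omega
      (acoef Omega rho d alpha e) (bcoef Omega rho d beta e))
  (hda : d e ^+ 2 / alpha e @[e --> 0^'+] --> 0)
  (q : R) (hq : qcoef m.+1 rho d alpha beta e @[e --> 0^'+] --> q) (hq0 : q = 0)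
  (r : R) (hr0 : 0 <= r) (hr : rcoef m.+1 rho beta e @[e --> 0^'+] --> r)
  (lam : R -> nat -> R)
  (hlam : forall e : R, 0 < e < eps0 ->
    eigenvalue_sequence Omega
      (acoef Omega rho d alpha e) (bcoef Omega rho d beta e) (lam e)) :
  forall k : nat, lam e k @[e --> 0^'+] --> 0.
Proof.
move=> k; have [oO _ bO _] := hOmega.
have m0 : (0 < m)%N by rewrite -ltnS.
have fO := bounded_open_frontier oO bO hOmega0.
have /andP[rho0 _] := hrho.
have [r0 /= r00 r0O] : exists2 r0 : R, 0 < r0 &
    forall x : 'rV[R]_m.+1, (forall l, `|x 0 l| < r0) -> Omega x.
  have /nbhs_ballP[r0 /= r00 hr0'] := open_nbhs_nbhs (conj oO hOmega0).
  exists r0 => // x hx; apply: hr0'; apply/row_ballE => // l.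
  by rewrite mxE sub0r normrN.
pose C : R := 64 * 2 ^+ m.+1 / bump_height ^+ 2.
have Cq0 : C * qcoef m.+1 rho d alpha beta e @[e --> 0^'+] --> 0.
  rewrite -[X in _ --> X](mulr0 C); rewrite hq0 in hq.
  by apply: cvgM hq; exact: cvg_cst.
apply: (squeeze_cvgr _ (cvg_cst 0) Cq0).
have w0 : 0 < k%:R + Num.sqrt m.+1%:R + 1 :> R by rewrite ltr_wpDl// addr_ge0// sqrtr_ge0.
(* The assumption d = o(eps) yields d <= R eps / 2 for small eps, the thinness that the volume bound
   for the core asks for. *)
have de_small : \forall e \near 0^'+, `|d e / e| < rho / 2.
  have rho2 : 0 < rho / 2 by rewrite divr_gt0.
  move/cvgrPdist_lt : hdo => /(_ _ rho2).
  by apply: filterS => e; rewrite sub0r normrN.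
near=> e.
have e0 : 0 < e by near: e; exact: nbhs_right_gt.
have e1 : e < eps0 by near: e; exact: nbhs_right_lt.
have e2 : e <= r0 / (k%:R + Num.sqrt m.+1%:R + 1).
  by near: e; apply: nbhs_right_le; rewrite divr_gt0.
have e3 : `|d e / e| < rho / 2.
  by near: e.
have ee : 0 < e < eps0 by rewrite e0.
have /andP[d0 _] := hd _ ee.
have er0 : e * (k%:R + Num.sqrt m.+1%:R + 1) <= r0 by rewrite -ler_pdivlMr.
have ds : d e <= rho * e / 2.
  move: e3; rewrite ger0_norm ?divr_ge0 ?(ltW d0) ?(ltW e0)//.
  by rewrite ltr_pdivrMr// => h; rewrite mulrAC ltW.
exact: (eigenvalue_bounds m0 oO fO r0O e0 hrho er0 d0 ds (halpha _ ee) (hbeta _ ee)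
  (hdisc _ ee) (hlam _ ee)).
Unshelve. all: by end_near. Qed.
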